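(* Let $G$ be a nilpotent group of class 2 that can be generated by two or by three elements. Then $G$ has a real-time combing which is boundedly asynchronous and whose length function is at most quadratic (i.e. bounded above by a polynomial of degree 2).
   Context: Let $G$ be a group with a finite inverse-closed generating set $X$. A word is an element of the free monoid $X^*$; $l(w)$ is the length of $w$, $w=_G v$ means that $w,v$ represent the same element of $G$, and the geodesic length $l_G(w)$ is the length of a shortest word in $X^*$ representing the same element as $w$. Let $\Gamma$ be the Cayley graph (vertices $g\in G$, an edge labelled $x$ from $g$ to $gx$ for each $x\in X$), and let $d_{G,X}$ be the path metric on its 1-skeleton. A word $w$ is identified with the path from $1$ labelled by $w$, parameterised by $t\in[0,\infty)$ with unit speed for $t<l(w)$ and constant, $w(t)=w(l(w))$, for $t\ge l(w)$. Words $v,w$ asynchronously $K$-fellow-travel if there is a differentiable function $h:\mathbf R\to\mathbf R$ (the relative-speed function), mapping $[0,l(v)+1]$ onto $[0,l(w)+1]$ and strictly increasing on $[0,l(v)+1]$, such that $d_{G,X}(v(t),w(h(t)))\le K$ for all $t>0$; they boundedly asynchronously fellow-travel with bound $M$ if moreover $1/M\le h'(t)\le M$ for all $t$. A language $L\subseteq X^*$ containing at least one representative of each element of $G$ is an (asynchronous) combing for $G$ over $X$ if for some $K$ all pairs $v,w\in L$ with $w=_G vx$ for some $x\in X\cup\{1\}$ asynchronously $K$-fellow-travel; it is a boundedly asynchronous combing if there is also a global $M$ such that all these pairs boundedly asynchronously fellow-travel with bound $M$. The length function of $L$ is $f:\mathbf N\to\mathbf N$, $f(n)$ = the maximum length of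 a word in $L$ of geodesic length at most $n$. A real-time language is a language accepted by a deterministic real-time Turing machine: it has a fixed number of tapes, one of which is the input tape containing just the input string; at each transition it reads one input symbol and moves to the next input symbol, and on each of the other (two-way infinite) tapes it may write a symbol or blank and then stay still or move one place left or right; it halts on reaching the end of the input. A real-time combing is an asynchronous combing that is a real-time language. *)

(* Defs.v *)
From HB Require Import structures.
From mathcomp Require Import all_boot all_order all_algebra finmap.
From mathcomp Require Import all_classical all_reals all_analysis.

Set Implicit Arguments.
Unset Strict Implicit.
Unset Printing Implicit Defensive.

Import Order.TTheory GRing.Theory Num.Theory.
Import numFieldNormedType.Exports.

Local Open Scope classical_set_scope.
Local Open Scope ring_scope.

Section Groups.
Variable G : groupType.

Definition is_subgroup (H : set G) : Prop :=
  [/\ H 1%g, (forall x y, H x -> H y -> H (x * y)%g)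
    & forall x, H x -> H (x^-1)%g].

Definition generated (S : set G) : set G := smallest is_subgroup S.

Definition generates (S : set G) : Prop := generated S = setT.

(* The indexing starts at [0]: [lower_central 0] is gamma_1(G) = G and
   [lower_central c] is gamma_(c+1)(G). *)
Fixpoint lower_central (n : nat) : set G :=
  if n is m.+1 then
    generated [set z | exists x y : G, lower_central m x /\ z = [~ x, y]%g]
  else setT.

Definition nilpotent_of_class (c : nat) : Prop :=
  lower_central c = [set 1%g] /\
  forall i : nat, (i < c)%N -> lower_central i <> [set 1%g].

End Groups.

Section Words.
Variables (G : groupType) (X : {fset G}).

Definition inverse_closed : Prop := forall x : G, x \in X -> (x^-1)%g \in X.

(* The word [w] over [X] is an element of [seq X]. *)
Definition word_eval (w : seq X) : G := (\prod_(x <- w) val x)%g.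

Definition same_element (v w : seq X) : Prop := word_eval v = word_eval w.

Lemma geodesic_length_subproof (w : seq X) :
  exists n : nat, `[< exists v : seq X, size v = n /\ same_element v w >].
Proof. by exists (size w); apply/asboolP; exists w. Qed.

Definition geodesic_length (w : seq X) : nat :=
  ex_minn (geodesic_length_subproof w).

Definition represents_all (L : set (seq X)) : Prop :=
  forall g : G, exists2 w : seq X, L w & word_eval w = g.

(* [f n] is the maximum (in particular, the maximum exists). *)
Definition is_length_function (L : set (seq X)) (f : nat -> nat) : Prop :=
  forall n : nat,
    (exists w : seq X, [/\ L w, (geodesic_length w <= n)%N & size w = f n]) /\
    (forall w : seq X, L w -> (geodesic_length w <= n)%N -> (size w <= f n)%N).

End Words.

Section Cayley.
Variables (R : realType) (G : groupType) (X : {fset G}).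

(* [EdgePoint g x s], for [0 <= s <= 1], lies at distance [s] from [g] on the
   edge labelled [x] from [g] to [g * x].  The endpoints of edges are
   identified with vertices in [segment] below. *)
Inductive cayley_point : Type :=
| Vertex of G
| EdgePoint of G & X & R.

(* [segment p q r]: [p] and [q] are either two points of one edge and are
   joined by a piece of length [r] of that edge, or two names of one vertex. *)
Inductive segment : cayley_point -> cayley_point -> R -> Prop :=
| SegEdge (g : G) (x : X) (s s' : R) : 0 <= s <= 1 -> 0 <= s' <= 1 ->
    segment (EdgePoint g x s) (EdgePoint g x s') `|s - s'|
| SegSource (g : G) (x : X) : segment (EdgePoint g x 0) (Vertex g) 0
| SegSourceV (g : G) (x : X) : segment (Vertex g) (EdgePoint g x 0) 0
| SegTarget (g : G) (x : X) :
    segment (EdgePoint g x 1) (Vertex (g * val x)%g) 0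
| SegTargetV (g : G) (x : X) :
    segment (Vertex (g * val x)%g) (EdgePoint g x 1) 0.

Inductive cayley_path : cayley_point -> cayley_point -> R -> Prop :=
| PathNil (p : cayley_point) : cayley_path p p 0
| PathCons (p q r : cayley_point) (a b : R) :
    segment p q a -> cayley_path q r b -> cayley_path p r (a + b).

Definition cayley_dist (p q : cayley_point) : \bar R :=
  ereal_inf [set r%:E | r in [set r : R | cayley_path p q r]].

Fixpoint path_from (g : G) (w : seq X) (t : R) : cayley_point :=
  if w is x :: w' then
    if t < 1 then EdgePoint g x t else path_from (g * val x)%g w' (t - 1)
  else Vertex g.

(* [w(t)]; paths are parameterised by [0, +oo[, and the truncation at [0]
   only makes the function total. *)
Definition path_at (w : seq X) (t : R) : cayley_point :=
  path_from 1%g w (Num.max 0 t).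

Definition relative_speed_function (v w : seq X) (h : R -> R) : Prop :=
  [/\ forall t : R, derivable h t 1,
      h @` `[0, (size v)%:R + 1]%classic = `[0, (size w)%:R + 1]%classic
    & {in `[0, (size v)%:R + 1] &, {homo h : s t / s < t}}].

Definition fellow_travel_via (K : R) (v w : seq X) (h : R -> R) : Prop :=
  relative_speed_function v w h /\
  forall t : R, 0 < t ->
    (cayley_dist (path_at v t) (path_at w (h t)) <= K%:E)%E.

Definition async_fellow_travel (K : R) (v w : seq X) : Prop :=
  exists h : R -> R, fellow_travel_via K v w h.

Definition bounded_async_fellow_travel (K M : R) (v w : seq X) : Prop :=
  exists2 h : R -> R, fellow_travel_via K v w h &
    forall t : R, 1 / M <= derive1 h t <= M.

(* [w =_G v x] for some [x] in [X] or [x = 1] *)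
Definition neighbours (v w : seq X) : Prop :=
  exists x : G, (x \in X \/ x = 1%g) /\ word_eval w = (word_eval v * x)%g.

Definition async_combing (L : set (seq X)) : Prop :=
  represents_all L /\
  exists K : R, forall v w : seq X, L v -> L w -> neighbours v w ->
    async_fellow_travel K v w.

Definition bounded_async_combing (L : set (seq X)) : Prop :=
  represents_all L /\
  exists K M : R, 0 < M /\
    forall v w : seq X, L v -> L w -> neighbours v w ->
      bounded_async_fellow_travel K M v w.

End Cayley.

Section RealTime.
Variable A : finType.

Inductive head_move : Type := MoveLeft | Stay | MoveRight.

Definition displacement (m : head_move) : int :=
  match m with MoveLeft => -1 | Stay => 0 | MoveRight => 1 end.

(* The input tape is not among the [rt_tapes] work tapes.  A cell of a work
   tape holds a symbol, or [None], which is the blank. *)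
Record rt_machine : Type := RTMachine {
  rt_state : finType;
  rt_symbol : finType;
  rt_tapes : nat;
  rt_start : rt_state;
  rt_accepting : {set rt_state};
  rt_next : rt_state -> A -> {ffun 'I_rt_tapes -> option rt_symbol} -> rt_state;
  rt_act : rt_state -> A -> {ffun 'I_rt_tapes -> option rt_symbol} ->
           'I_rt_tapes -> option rt_symbol * head_move
}.

Record rt_config (T : rt_machine) : Type := RTConfig {
  cfg_state : rt_state T;
  cfg_tape : 'I_(rt_tapes T) -> int -> option (rt_symbol T);
  cfg_head : 'I_(rt_tapes T) -> int
}.

Definition rt_initial (T : rt_machine) : rt_config T :=
  RTConfig (rt_start T) (fun _ _ => None) (fun _ => 0).

Definition rt_step (T : rt_machine) (c : rt_config T) (a : A) : rt_config T :=
  let scanned := [ffun i => cfg_tape c i (cfg_head c i)] in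
  let act := rt_act (cfg_state c) a scanned in
  RTConfig (rt_next (cfg_state c) a scanned)
    (fun i z => if z == cfg_head c i then (act i).1 else cfg_tape c i z)
    (fun i => cfg_head c i + displacement (act i).2).

Definition rt_accepts (T : rt_machine) (w : seq A) : Prop :=
  cfg_state (foldl (@rt_step T) (rt_initial T) w) \in rt_accepting T.

Definition real_time_language (L : set (seq A)) : Prop :=
  exists T : rt_machine, forall w : seq A, L w <-> rt_accepts T w.

End RealTime.

Definition real_time_combing (R : realType) (G : groupType) (X : {fset G})
    (L : set (seq X)) : Prop :=
  async_combing R L /\ real_time_language L.

(* Main.v *)
Require Import Defs.
From HB Require Import structures.
From mathcomp Require Import all_boot all_order all_algebra finmap.
From mathcomp Require Import all_classical all_reals all_analysis.
From mathcomp Require Import zify ring lra.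

Set Implicit Arguments.
Unset Strict Implicit.
Unset Printing Implicit Defensive.

Import Order.TTheory GRing.Theory Num.Theory.
Import numFieldNormedType.Exports.

Local Open Scope classical_set_scope.
Local Open Scope ring_scope.

(** Up to a finite set of right factors, every element of [G] is a product
    [E v] of integer powers of elements [e i], grouped into three segments with
    commuting [e i]: if the three commutators [a, b], [a, c], [b, c] are
    independent, take a | b, [a, b] | c, [a, c], [b, c]; if they satisfy
    [a, b]^al [a, c]^be [b, c]^ga = 1 with al <> 0, then a^al c^(-ga) and
    b^al c^be commute and generate with the commutators an abelian normal
    subgroup [N] such that <c> N has finite index.

    The word for [E v f] follows, in each segment, the straight line: it has
    [4 J ^ 2 + 1] letters with [J ^ 2] comparable to [max |v i|], an idle quarter
    followed by one quarter for each segment, and a letter moves all coordinates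
    of its segment at once.  In these coordinates the words of neighbours stay close under a
    linear reparametrization.  Since coordinates grow at most quadratically with
    the geodesic length, so do the words.

    To recognize these words in real time, write [v i] as [q J + r] up to signs
    with [0 <= q, r <= J], and spread [q] and [r] as digital lines over a pattern
    of [J] symbols, which the machine copies from the first [J] letters.  A
    quarter has [J] rows of [J] letters; every row emits [q] through the pattern
    and at its end one symbol of the line for [r].  Heads that bounce between the
    ends of copies of the pattern check all this without ever rewinding. *)

(** * Powers and commutators in class 2 *)

(** What obstructs straight lines is that right multiplication by a fixed element changes the
    exponent of a commutator by an unbounded amount: that of [[b, c]], say, by a multiple of the
    exponent of [c]. Words for neighbours drift apart if these two exponents are written at
    different times. Every commutator therefore moves in the same segment, at the same fraction, as
    the exponent on which its correction depends. In the dependent case all of [N] moves in one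
    segment, and conjugation acts linearly on it. The square format serves the machine: a coordinate
    of size [J ^ 2] is cut into two lines over the same [J] cells, so that a tape of length [J]
    replaces a counter up to [J ^ 2], and all coordinates can move at once. Coordinates need not be
    unique, and an element may have several words: the estimates are demanded for all pairs of
    coordinate vectors related by a fixed element. *)

Section IntegerPowers.
Local Open Scope group_scope.
Variable G : groupType.
Implicit Types (g h k : G) (m n : int).

Definition zpow g (m : int) : G :=
  match m with Posz k => g ^+ k | Negz k => (g ^+ k.+1)^-1 end.

Lemma zpow0 g : zpow g 0%R = 1. Proof. by []. Qed.
Lemma zpow1 g : zpow g 1%R = g. Proof. by []. Qed.

Lemma zpowS g m : zpow g (m + 1)%R = zpow g m * g.
Proof.
case: m => [k|[|k]].
- have -> : (Posz k + 1)%R = Posz k.+1 by lia.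
  by rewrite /= expgSr.
- by rewrite [RHS]mulVg.
- have -> : (Negz k.+1 + 1)%R = Negz k by lia.
  by rewrite /= [g ^+ k.+2]expgS invgM mulgVK.
Qed.

Lemma zpowP g m : zpow g (m - 1)%R = zpow g m * g^-1.
Proof. by rewrite -{2}(subrK 1%R m) zpowS mulgK. Qed.

Lemma zpowD g m n : zpow g (m + n)%R = zpow g m * zpow g n.
Proof.
elim/int_rect: n => [|n IH|n IH]; first by rewrite addr0 mulg1.
- by rewrite intS [(1 + _)%R]addrC addrA !zpowS IH mulgA.
- rewrite intS opprD [(-1 - _)%R]addrC addrA.
  by rewrite !zpowP IH mulgA.
Qed.

Lemma zpowN g m : zpow g (- m)%R = (zpow g m)^-1.
Proof. by apply/esym/mulg1_eq; rewrite -zpowD subrr. Qed.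

Lemma zpowB g m n : zpow g (m - n)%R = zpow g m * (zpow g n)^-1.
Proof. by rewrite zpowD zpowN. Qed.

Lemma zpow1g m : zpow (1 : G) m = 1.
Proof. by case: m => k /=; rewrite expg1n ?invg1. Qed.

Lemma zpowX g (k : nat) : g ^+ k = zpow g k%:Z. Proof. by []. Qed.

Lemma commute_zpow g h m : commute g h -> commute g (zpow h m).
Proof.
move=> gh; case: m => k /=; first exact: commuteX.
exact/commuteV/commuteX.
Qed.

Lemma commute_zpow2 g h m n : commute g h -> commute (zpow g m) (zpow h n).
Proof.
by move=> gh; apply/commute_zpow/commute_sym/commute_zpow/commute_sym.
Qed.

Lemma zpowMg g h m : commute g h -> zpow (g * h) m = zpow g m * zpow h m.
Proof.
move=> gh; case: m => k /=; first exact: expgMn.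
rewrite expgMn // -invgM; congr (_^-1).
by apply: commuteX2.
Qed.

Lemma zpowA g m n : zpow g (m * n)%R = zpow (zpow g m) n.
Proof.
elim/int_rect: n => [|n IH|n IH]; first by rewrite mulr0.
- by rewrite intS mulrDr mulr1 addrC zpowD IH [(1 + _)%R]addrC zpowS.
- by rewrite intS opprD mulrDr mulrN1 addrC zpowB IH [(-1 - _)%R]addrC zpowP.
Qed.

Lemma zpowJ g h m : zpow g m ^ h = zpow (g ^ h) m.
Proof. by case: m => k /=; rewrite ?conjVg conjXg. Qed.

Lemma zpowVg g m : zpow g^-1 m = (zpow g m)^-1.
Proof. by case: m => k /=; rewrite expVgn. Qed.

End IntegerPowers.

Section ClassTwo.
Local Open Scope group_scope.
Variable G : groupType.
Hypothesis central_commg : forall x y z : G, commute [~ x, y] z.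
Implicit Types x y z : G.

Lemma commMg x y z : [~ x * y, z] = [~ x, z] * [~ y, z].
Proof.
rewrite [LHS]/commg conjMg invgM -mulgA [x^-1 * _]mulgA -/(commg x z).
by rewrite mulgA -(central_commg x z) -mulgA.
Qed.

Lemma commgM x y z : [~ x, y * z] = [~ x, y] * [~ x, z].
Proof. by rewrite -invgR commMg invgM !invgR central_commg. Qed.

Lemma commVg x y : [~ x^-1, y] = [~ x, y]^-1.
Proof. by apply/esym/mulg1_eq; rewrite -commMg mulgV comm1g. Qed.

Lemma commZg x y m : [~ zpow x m, y] = zpow [~ x, y] m.
Proof.
case: m => k /=.
  by elim: k => [|k IH]; rewrite ?comm1g // !expgS commMg IH.
rewrite commVg; congr (_^-1); elim: k => [|k IH] //.
by rewrite expgS [RHS]expgS commMg IH.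
Qed.

Lemma commgZ x y m : [~ x, zpow y m] = zpow [~ x, y] m.
Proof. by rewrite -invgR commZg -zpowVg invgR. Qed.

Lemma commZZ x y m n : [~ zpow x m, zpow y n] = zpow [~ x, y] (m * n)%R.
Proof. by rewrite commgZ commZg -zpowA. Qed.

End ClassTwo.

(** * Coordinates *)

Section CoordinateSystems.
Local Open Scope group_scope.
Variable G : groupType.
Implicit Types (e : nat -> G) (seg : nat -> nat) (u v : nat -> int) (n : nat).

Definition coord_prod e seg n v : G :=
  \prod_(k < 3) \prod_(i < n | seg i == k) zpow (e i) (v i).

(* [u] is a point of segment [k] of the path to [v], at the fraction [t / T]
   of that segment, up to an error [C] in each coordinate. *)
Definition near_point seg n (C T t k : nat) v u : Prop :=
  forall i, (i < n)%N ->
    [/\ (seg i < k)%N -> u i = v i, (k < seg i)%N -> u i = 0%R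
      & seg i = k -> (`|T%:Z * u i - t%:Z * v i| <= C%:Z * T%:Z)%R].

(** [cs_step] separates the coordinates that change by a bounded amount from those in [cen], whose
    change may be linear in the others; this yields quadratic growth and comparable lengths of
    neighbouring words. [cs_close] is fellow travelling at equal fractions of one segment. Its error
    [C] is arbitrary because digital lines and the rescaling of time both contribute to it. *)
Record coordinate_system n e seg (cen : pred nat) (F : seq G) : Prop := {
  cs_comm : forall i j, (i < n)%N -> (j < n)%N -> seg i = seg j ->
    commute (e i) (e j);
  cs_seg : forall i, (i < n)%N -> (seg i < 3)%N;
  cs_cover : forall g, exists v, exists2 f, f \in F &
    g = coord_prod e seg n v * f;
  cs_step : forall h, exists C : nat, forall v v',
    coord_prod e seg n v * h = coord_prod e seg n v' ->
    forall i, (i < n)%N -> (`|v' i - v i| <= C%:Z *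
      (1 + (if cen i then \sum_(j < n | ~~ cen j) `|v j| else 0)))%R;
  cs_close : forall h (C : nat), exists B : seq G, forall v v',
    coord_prod e seg n v * h = coord_prod e seg n v' ->
    forall T t k u u', (0 < T)%N -> (t <= T)%N -> (k < 3)%N ->
      near_point seg n C T t k v u -> near_point seg n C T t k v' u' ->
      (coord_prod e seg n u)^-1 * coord_prod e seg n u' \in B
}.

Definition zprod e n v : G := \prod_(i < n) zpow (e i) (v i).

Lemma zprod0 e v : zprod e 0 v = 1. Proof. exact: big_ord0. Qed.

Lemma zprodS e n v : zprod e n.+1 v = zprod e n v * zpow (e n) (v n).
Proof. exact: big_ord_recr. Qed.

Lemma eq_zprod e e' n v v' : (forall i, (i < n)%N -> e i = e' i) ->
  (forall i, (i < n)%N -> v i = v' i) -> zprod e n v = zprod e' n v'.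
Proof. by move=> ee vv; apply: eq_bigr => i _; rewrite ee ?vv. Qed.

Definition int_range (C : nat) : seq int :=
  [seq (k%:Z - C%:Z)%R | k <- iota 0 (C + C).+1].

Lemma mem_int_range C (z : int) : (`|z| <= C%:Z)%R -> z \in int_range C.
Proof.
move=> zC; apply/mapP; exists (absz (z + C%:Z)%R); last by lia.
by rewrite mem_iota; lia.
Qed.

Lemma zprod_bounded e n (C : nat) : exists B : seq G, forall v,
  (forall i, (i < n)%N -> (`|v i| <= C%:Z)%R) -> zprod e n v \in B.
Proof.
elim: n => [|n [B IH]]; first by exists [:: 1] => v _; rewrite zprod0 inE.
exists [seq b * zpow (e n) z | b <- B, z <- int_range C] => v vC.
rewrite zprodS; apply: allpairs_f; last exact/mem_int_range/vC.
by apply: IH => i /leqW/vC.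
Qed.

End CoordinateSystems.

(** Since [t <= T], the fraction [t / T] of [k] is no larger than [k]; working after multiplication
    by [T] avoids rationals. *)
Lemma scaled_bound (T t : nat) (C w k : int) : (0 < T)%N -> (t <= T)%N ->
  `|T%:Z * w - t%:Z * k| <= C * T%:Z -> `|w| <= C + `|k|.
Proof.
move=> T0 tT H; have T0' : 0 < T%:Z by lia.
rewrite -(ler_pM2l T0') -{1}[T%:Z]gtr0_norm // -normrM.
have -> : T%:Z * w = (T%:Z * w - t%:Z * k) + t%:Z * k by lia.
apply: (le_trans (ler_normD _ _)); rewrite mulrDr; apply: lerD.
  by rewrite [leRHS]mulrC.
by rewrite normrM ler_wpM2r // ger0_norm; lia.
Qed.

(** * Normal forms on three generators in class 2 *)

Section NormalForm.
Local Open Scope group_scope.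
Variable G : groupType.
Hypothesis central_commg : forall x y z : G, commute [~ x, y] z.
Variables a b c : G.
Let x := [~ a, b].
Let y := [~ a, c].
Let z := [~ b, c].

Definition nf (i j l p q r : int) : G :=
  zpow a i * zpow b j * zpow c l * (zpow x p * zpow y q * zpow z r).

(** Moving [A'] left past [B] and [C], and [B'] past [C], costs one central factor each; the central
    factors then float to the right end. *)
Lemma collect (A B C A' B' C' X Y Z W W' : G) :
  B * A' = A' * B * X -> C * A' = A' * C * Y -> C * B' = B' * C * Z ->
  (forall g, commute X g) -> (forall g, commute Y g) ->
  (forall g, commute Z g) -> (forall g, commute W g) ->
  (forall g, commute W' g) ->
  (A * B * C * W) * (A' * B' * C' * W') =
  (A * A') * (B * B') * (C * C') * (W * W' * X * Y * Z).
Proof.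
move=> BA CA CB cX cY cZ cW cW'.
have float (V : G) : (forall g, commute V g) -> forall u v, u * V * v = u * v * V.
  by move=> cV u v; rewrite -[LHS]mulgA cV mulgA.
have rBA u : u * B * A' = u * A' * B * X by rewrite -[LHS]mulgA BA !mulgA.
have rCA u : u * C * A' = u * A' * C * Y by rewrite -[LHS]mulgA CA !mulgA.
have rCB u : u * C * B' = u * B' * C * Z by rewrite -[LHS]mulgA CB !mulgA.
rewrite !mulgA !(float W cW) rCA !(float Y cY) rBA !(float X cX) rCB.
by rewrite !(float W cW) !(float W' cW') !(float X cX) !(float Y cY) !(float Z cZ).
Qed.

Lemma nfM i j l p q r i' j' l' p' q' r' :
  nf i j l p q r * nf i' j' l' p' q' r' =
  nf (i + i') (j + j') (l + l') (p + p' - j * i') (q + q' - l * i')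
     (r + r' - l * j').
Proof.
have cz (g h k : G) m : commute (zpow [~ g, h] m) k.
  by apply: commute_sym; apply: commute_zpow; apply: commute_sym; apply: central_commg.
(* The factor that appears is [[h, g]] to the power [k * m]; writing it through [[g, h]] gives the
   minus signs in the product formula. *)
have swap (g h : G) k m : zpow h k * zpow g m =
    zpow g m * zpow h k * zpow [~ g, h] (- (k * m))%R.
  by rewrite commgC (commZZ central_commg) -[in LHS](invgR g h) zpowVg zpowN.
have float (g h : G) m (u v : G) : u * zpow [~ g, h] m * v = u * v * zpow [~ g, h] m.
  by rewrite -[LHS]mulgA cz mulgA.
rewrite /nf (@collect _ _ _ _ _ _ _ _ _ _ _ (swap a b j i') (swap a c l i') (swap b c l j')).
- rewrite !zpowD !mulgA -/x -/y -/z !(float a c q) !(float a c q').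
  rewrite !(float a c (- (l * i'))%R) !(float b c r) !(float b c r').
  by rewrite !(float b c (- (l * j'))%R).
- by move=> k; apply: cz.
- by move=> k; apply: cz.
- by move=> k; apply: cz.
- by move=> g; apply/commute_sym; do ?apply: commuteM; apply/commute_sym/cz.
- by move=> g; apply/commute_sym; do ?apply: commuteM; apply/commute_sym/cz.
Qed.

Lemma nf0 : nf 0 0 0 0 0 0 = 1.
Proof. by rewrite /nf !zpow0 !mulg1. Qed.

Lemma nfV i j l p q r : (nf i j l p q r)^-1 =
  nf (- i) (- j) (- l) (- p - j * i) (- q - l * i) (- r - l * j).
Proof.
by apply: mulg1_eq; rewrite nfM -nf0; congr nf; ring.
Qed.

Lemma nf_eqM g i j l p q r i' j' l' p' q' r' :
  nf i j l p q r * g = nf i' j' l' p' q' r' ->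
  g = nf (i' - i) (j' - j) (l' - l) (p' - p + j * (i' - i))
    (q' - q + l * (i' - i)) (r' - r + l * (j' - j)).
Proof.
move=> /(congr1 (fun h => (nf i j l p q r)^-1 * h)); rewrite mulKg => ->.
by rewrite nfV nfM; congr nf; ring.
Qed.

Lemma nf_subgroup : is_subgroup (range (fun t : int * int * int * (int * int * int) =>
  nf t.1.1.1 t.1.1.2 t.1.2 t.2.1.1 t.2.1.2 t.2.2)).
Proof.
split; first by exists (0, 0, 0, (0, 0, 0))%R => //=; rewrite nf0.
- move=> _ _ [t _ <-] [s _ <-]; rewrite nfM; eexists (_, _, _, (_, _, _)) => //.
- move=> _ [t _ <-]; rewrite nfV; eexists (_, _, _, (_, _, _)) => //.
Qed.

Lemma nf_generated (S : set G) : generates S ->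
  (forall s, S s -> s \in [:: a; b; c; 1]) ->
  forall g, exists i j l p q r, g = nf i j l p q r.
Proof.
move=> gS Ssub g; have : generated S g by rewrite gS.
move=> /(_ _ (conj nf_subgroup _))/=; case.
  move=> s /Ssub; rewrite !inE => /or4P[]/eqP->.
  - by exists (1, 0, 0, (0, 0, 0))%R => //=; rewrite /nf !zpow0 !mulg1.
  - by exists (0, 1, 0, (0, 0, 0))%R => //=; rewrite /nf !zpow0 !mulg1 mul1g.
  - by exists (0, 0, 1, (0, 0, 0))%R => //=; rewrite /nf !zpow0 !mulg1 !mul1g.
  - by exists (0, 0, 0, (0, 0, 0))%R => //=; rewrite nf0.
by move=> t _ <-; do 6 eexists.
Qed.

Hypothesis indep : forall p q r,
  zpow x p * zpow y q * zpow z r = 1 -> [/\ p = 0, q = 0 & r = 0].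

Lemma nf_comm g i j l p q r :
  [~ nf i j l p q r, g] = zpow [~ a, g] i * zpow [~ b, g] j * zpow [~ c, g] l.
Proof.
have triv (u v h : G) m : [~ zpow [~ u, v] m, h] = 1.
  by apply/eqP/commgP/commute_sym/commute_zpow/commute_sym.
rewrite /nf !(commMg central_commg) !triv !mulg1 !(commZg central_commg).
by [].
Qed.

(** The quotient of two equal normal forms is a trivial normal form, so its commutators with [a] and
    [b] are trivial. By independence the first kills the exponents of [b] and [c], the second that
    of [a]; what remains is a product of commutators. *)
Lemma nf_inj i j l p q r i' j' l' p' q' r' :
  nf i j l p q r = nf i' j' l' p' q' r' ->
  [/\ i = i', j = j' & l = l'] /\ [/\ p = p', q = q' & r = r'].
Proof.
move=> E.
have E1 : nf (i' - i) (j' - j) (l' - l) (p' - p + j * (i' - i))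
    (q' - q + l * (i' - i)) (r' - r + l * (j' - j)) = 1.
  by apply/esym/nf_eqM; rewrite mulg1.
(* A trivial identity, of which only the first [1] is rewritten by [E1]: it becomes the vanishing of
   the commutator of the quotient with [a]. *)
have Ea : [~ 1, a] = [~ 1, a] :> G by [].
move: Ea; rewrite -{1}E1 comm1g nf_comm commgg zpow1g mul1g => Ea.
have Eb : [~ 1, b] = [~ 1, b] :> G by [].
move: Eb; rewrite -{1}E1 comm1g nf_comm commgg zpow1g mulg1 => Eb.
have [] := indep (p := - (j' - j)) (q := - (l' - l)) (r := 0).
  by rewrite zpow0 mulg1 !zpowN -!zpowVg !invgR.
move=> j0 l0 _.
have [] := indep (p := i' - i) (q := 0) (r := - (l' - l)).
  by rewrite zpow0 mulg1 !zpowN -!zpowVg !invgR.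
move=> i0 _ _.
have [jj [ll ii]] : j' - j = 0 /\ (l' - l = 0 /\ i' - i = 0).
  by split; [lia|split; lia].
move: E1; rewrite ii jj ll !mulr0 !addr0 /nf !zpow0 !mul1g => /indep[].
by move=> *; split; split; lia.
Qed.

End NormalForm.

Lemma near_bound (C T t : nat) (u v u' v' k : int) : (0 < T)%N -> (t <= T)%N ->
  `|T%:Z * u - t%:Z * v| <= C%:Z * T%:Z ->
  `|T%:Z * u' - t%:Z * v'| <= C%:Z * T%:Z ->
  v' - v = k -> `|u' - u| <= 2 * C%:Z + `|k|.
Proof.
move=> T0 tT h h' <-; apply: (scaled_bound T0 tT).
have -> : T%:Z * (u' - u) - t%:Z * (v' - v) =
  (T%:Z * u' - t%:Z * v') - (T%:Z * u - t%:Z * v) by ring.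
by apply: (le_trans (ler_normB _ _)); lia.
Qed.

(** The difference [v' - v = l - s * k] is unbounded, but [u' - u] follows the same fraction of it
    as [w] does of [s]. Adding [w * k] cancels the drift, up to [|k|] times the error of [w]. *)
Lemma near_bound_skew (C T t : nat) (u v u' v' w s k l : int) :
  (0 < T)%N -> (t <= T)%N ->
  `|T%:Z * u - t%:Z * v| <= C%:Z * T%:Z ->
  `|T%:Z * u' - t%:Z * v'| <= C%:Z * T%:Z ->
  `|T%:Z * w - t%:Z * s| <= C%:Z * T%:Z ->
  v' - v + s * k = l -> `|u' - u + w * k| <= C%:Z * (2 + `|k|) + `|l|.
Proof.
move=> T0 tT h h' hw <-; apply: (scaled_bound T0 tT).
have -> : T%:Z * (u' - u + w * k) - t%:Z * (v' - v + s * k) =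
  (T%:Z * u' - t%:Z * v') - (T%:Z * u - t%:Z * v) + (T%:Z * w - t%:Z * s) * k
  by ring.
apply: (le_trans (ler_normD _ _)).
have : `|(T%:Z * w - t%:Z * s) * k| <= C%:Z * T%:Z * `|k|.
  by rewrite normrM ler_wpM2r.
have := ler_normB (T%:Z * u' - t%:Z * v') (T%:Z * u - t%:Z * v); lia.
Qed.

Lemma skew_step_bound (p s k D S : int) : `|p| <= D -> `|k| <= D -> `|s| <= S ->
  `|p - s * k| <= D * (1 + S).
Proof.
move=> pD kD sS; apply: (le_trans (ler_normB _ _)); rewrite mulrDr mulr1.
by apply: lerD => //; rewrite normrM mulrC ler_pM.
Qed.

(** * Independent commutators: six integer coordinates *)

Section FreeCase.
Local Open Scope group_scope.
Variable G : groupType.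
Hypothesis central_commg : forall x y z : G, commute [~ x, y] z.
Variables a b c : G.
Let x := [~ a, b].
Let y := [~ a, c].
Let z := [~ b, c].
Hypothesis nf_all : forall g, exists i j l p q r, g = nf a b c i j l p q r.
Hypothesis indep : forall p q r,
  zpow x p * zpow y q * zpow z r = 1 -> [/\ p = 0, q = 0 & r = 0]%R.

(** Position 2 holds [[a, b]], next to [b] in segment 1; positions 4 and 5 hold [[a, c]] and
    [[b, c]], next to [c] in segment 2. By [nfM] the corrections to these exponents are multiples of
    the exponents of [b], [c] and [c] respectively. *)
Let e := nth 1 [:: a; b; x; c; y; z].
Let seg := nth 0%N [:: 0; 1; 1; 2; 2; 2]%N.
Let cen : pred nat := [pred i | i \in [:: 2; 4; 5]]%N.

Lemma free_coord_prod v : coord_prod e seg 6 v =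
  nf a b c (v 0%N) (v 1%N) (v 3%N) (v 2%N) (v 4%N) (v 5%N).
Proof.
rewrite /coord_prod !big_ord_recl big_ord0.
do 3! [rewrite big_mkcond !big_ord_recl big_ord0].
rewrite /= /e /= !mul1g !mulg1 /nf !mulgA.
congr (_ * _ * _); rewrite -[LHS]mulgA -[RHS]mulgA; congr (_ * _).
exact: (commute_zpow2 _ _ (central_commg a b c)).
Qed.

Lemma free_coordinate_system : coordinate_system 6 e seg cen [:: 1].
Proof.
have cz (g h k : G) m : commute (zpow [~ g, h] m) k.
  exact/commute_sym/commute_zpow/commute_sym/central_commg.
have close (C : nat) : exists B : seq G, forall i j l p q r : int,
  (`|i| <= C%:Z)%R -> (`|j| <= C%:Z)%R -> (`|l| <= C%:Z)%R ->
  (`|p| <= C%:Z)%R -> (`|q| <= C%:Z)%R -> (`|r| <= C%:Z)%R ->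
  nf a b c i j l p q r \in B.
  have [B hB] := zprod_bounded (nth 1 [:: a; b; c; x; y; z]) 6 C.
  exists B => i j l p q r hi hj hl hp hq hr.
  have := hB (nth 0%R [:: i; j; l; p; q; r]).
  rewrite /zprod !big_ord_recl big_ord0 /= mulg1 /nf !mulgA; apply.
  by case=> [|[|[|[|[|[|]]]]]].
split.
- move=> i j; rewrite /e /seg.
  case: i => [|[|[|[|[|[|//]]]]]] _; case: j => [|[|[|[|[|[|//]]]]]] _ //= _;
    do ?[exact: commute_refl]; by [exact: central_commg|exact/commute_sym/central_commg].
- by case=> [|[|[|[|[|[|]]]]]].
- move=> g; have [i [j [l [p [q [r ->]]]]]] := nf_all g.
  exists (nth 0%R [:: i; j; p; l; q; r]); exists 1; rewrite ?inE //.
  by rewrite free_coord_prod mulg1.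
- move=> h; have [i [j [l [p [q [r ->]]]]]] := nf_all h.
  pose D := (`|i| + `|j| + `|l| + `|p| + `|q| + `|r|)%N.
  have [hi hj hl] : [/\ `|i| <= D%:Z, `|j| <= D%:Z & `|l| <= D%:Z]%R.
    by rewrite /D; split; lia.
  have [hp hq hr] : [/\ `|p| <= D%:Z, `|q| <= D%:Z & `|r| <= D%:Z]%R.
    by rewrite /D; split; lia.
  exists D => v v'.
  rewrite !free_coord_prod (nfM central_commg).
  move=> /(nf_inj central_commg indep)[[e0 e1 e3] [e2 e4 e5]].
  set S := (\sum_(_ < _ | _) _)%R.
  have HS : S = (`|v 0%N| + `|v 1%N| + `|v 3%N|)%R.
    by rewrite /S big_mkcond /= !big_ord_recl big_ord0 /= /bump /=; rewrite !add0r !addr0 !addrA.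
  rewrite HS.
  have add (s s' k : int) : (s + k = s' -> s' - s = k)%R by lia.
  have sub (s s' k w : int) : (s + k - w = s' -> s' - s = k - w)%R by lia.
  rewrite -(add _ _ _ e0) in hi; rewrite -(add _ _ _ e1) in hj.
  rewrite -(add _ _ _ e3) in hl.
  case=> [|[|[|[|[|[|]]]]]] //= _; rewrite ?addr0 ?mulr1 //.
  + rewrite (sub _ _ _ _ e2); apply: skew_step_bound => //; lia.
  + rewrite (sub _ _ _ _ e4); apply: skew_step_bound => //; lia.
  + rewrite (sub _ _ _ _ e5); apply: skew_step_bound => //; lia.
- move=> h C; have [i [j [l [p [q [r ->]]]]]] := nf_all h.
  pose D := (C * (2 + `|i|) + C * (2 + `|j|) + (`|i| + `|j| + `|l| + `|p| + `|q| + `|r|))%N.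
  have [hi hj hl] : [/\ `|i| <= D%:Z, `|j| <= D%:Z & 2 * C%:Z + `|l| <= D%:Z]%R.
    by rewrite /D; split; lia.
  have [hi' hj'] : [/\ 2 * C%:Z + `|i| <= D%:Z & 2 * C%:Z + `|j| <= D%:Z]%R.
    by rewrite /D; split; lia.
  have [hp hq hr] : [/\ C%:Z * (2 + `|i|) + `|p| <= D%:Z,
      C%:Z * (2 + `|i|) + `|q| <= D%:Z & C%:Z * (2 + `|j|) + `|r| <= D%:Z]%R.
    by rewrite /D; split; lia.
  have hp' : (`|p| <= D%:Z)%R by rewrite /D; lia.
  have [B hB] := close D; exists B => v v'.
  rewrite !free_coord_prod (nfM central_commg).
  move=> /(nf_inj central_commg indep)[[e0 e1 e3] [e2 e4 e5]].
  have add (s s' k : int) : (s + k = s' -> s' - s = k)%R by lia.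
  have sub (s s' k w : int) : (s + k - w = s' -> s' - s + w = k)%R by lia.
  move/add: e0 => e0; move/add: e1 => e1; move/add: e3 => e3.
  move/sub: e2 => e2; move/sub: e4 => e4; move/sub: e5 => e5.
  move=> T t k u u' T0 tT k3 hu hu'.
  have := nf_eqM central_commg (g := (nf a b c (u 0%N) (u 1%N) (u 3%N) (u 2%N) (u 4%N) (u 5%N))^-1 *
     nf a b c (u' 0%N) (u' 1%N) (u' 3%N) (u' 2%N) (u' 4%N) (u' 5%N)) (mulVKg _ _).
  rewrite !free_coord_prod => ->.
  have [u0 z0 n0] := hu 0%N erefl; have [u0' z0' n0'] := hu' 0%N erefl.
  have [u1 z1 n1] := hu 1%N erefl; have [u1' z1' n1'] := hu' 1%N erefl.
  have [u2 z2 n2] := hu 2%N erefl; have [u2' z2' n2'] := hu' 2%N erefl.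
  have [u3 z3 n3] := hu 3%N erefl; have [u3' z3' n3'] := hu' 3%N erefl.
  have [u4 z4 n4] := hu 4%N erefl; have [u4' z4' n4'] := hu' 4%N erefl.
  have [u5 z5 n5] := hu 5%N erefl; have [u5' z5' n5'] := hu' 5%N erefl.
  (* Coordinates of later segments vanish in [u] and [u'], those of earlier segments have reached
     [v] and [v']. Only segment [k] needs estimates, and the commutators in it use the skew one. *)
  case: k k3 hu hu' u0 z0 n0 u0' z0' n0' u1 z1 n1 u1' z1' n1' u2 z2 n2 u2' z2' n2'
     u3 z3 n3 u3' z3' n3' u4 z4 n4 u4' z4' n4' u5 z5 n5 u5' z5' n5' => [|[|[|//]]] _ _ _ /=.
  + move=> _ _ /(_ erefl) n0 _ _ /(_ erefl) n0'.
    have b0 := near_bound T0 tT n0 n0' e0.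
    do 10! [move=> _ /(_ erefl) -> _].
    rewrite ?(mul0r, subr0, addr0).
    apply: hB; rewrite ?normr0 //; exact: le_trans b0 _.
  + move=> /(_ erefl) -> _ _ /(_ erefl) -> _ _.
    move=> _ _ /(_ erefl) n1 _ _ /(_ erefl) n1' _ _ /(_ erefl) n2 _ _ /(_ erefl) n2'.
    have b1 := near_bound T0 tT n1 n1' e1.
    have b2 := near_bound_skew T0 tT n2 n2' n1 e2.
    do 6! [move=> _ /(_ erefl) -> _].
    rewrite e0.
    rewrite ?(mul0r, subr0, addr0).
    apply: hB; rewrite ?normr0 //; [exact: le_trans b1 _|exact: le_trans b2 _].
  + move=> /(_ erefl) -> _ _ /(_ erefl) -> _ _ /(_ erefl) -> _ _ /(_ erefl) -> _ _
      /(_ erefl) -> _ _ /(_ erefl) -> _ _.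
    move=> _ _ /(_ erefl) n3 _ _ /(_ erefl) n3' _ _ /(_ erefl) n4 _ _ /(_ erefl) n4'
      _ _ /(_ erefl) n5 _ _ /(_ erefl) n5'.
    have b3 := near_bound T0 tT n3 n3' e3.
    have b4 := near_bound_skew T0 tT n4 n4' n3 e4.
    have b5 := near_bound_skew T0 tT n5 n5' n3 e5.
    rewrite e0 e1 e2.
    apply: hB => //;
      [exact: le_trans b3 _|exact: le_trans b4 _|exact: le_trans b5 _].
Qed.

End FreeCase.

(** * Free coordinates of finite index in abelian subgroups *)

Section AbelianStructure.
Local Open Scope group_scope.
Variable G : groupType.
Implicit Types (e : nat -> G) (v w : nat -> int) (n : nat) (N : set G).

Lemma zprod_commute e n (g : G) v :
  (forall i, (i < n)%N -> commute g (e i)) -> commute g (zprod e n v).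
Proof.
move=> gP; apply: (big_ind (commute g)) => [|h k|i _].
- exact: commute1.
- exact: commuteM.
- exact/commute_zpow/gP.
Qed.

Section Zprod.
Variables (e : nat -> G) (n : nat).
Hypothesis comm_e : forall i j, (i < n)%N -> (j < n)%N -> commute (e i) (e j).

Lemma zprod_add v w :
  zprod e n (fun i => v i + w i)%R = zprod e n v * zprod e n w.
Proof.
suff H m : (m <= n)%N ->
    zprod e m (fun i => v i + w i)%R = zprod e m v * zprod e m w by exact: H.
elim: m => [|m IH] mn; first by rewrite !zprod0 mulg1.
rewrite !zprodS IH ?(ltnW mn) // zpowD !mulgA; congr (_ * _).
rewrite -!mulgA; congr (_ * _).
apply/commute_zpow/commute_sym/zprod_commute => i im.
by apply: comm_e => //; exact: ltn_trans mn.
Qed.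

Lemma zprod_scale v (m : int) :
  zprod e n (fun i => m * v i)%R = zpow (zprod e n v) m.
Proof.
suff H k : (k <= n)%N ->
    zprod e k (fun i => m * v i)%R = zpow (zprod e k v) m by exact: H.
elim: k => [|k IH] kn; first by rewrite !zprod0 zpow1g.
rewrite !zprodS IH ?(ltnW kn) // zpowMg; last first.
  apply/commute_zpow/commute_sym/zprod_commute => i ik.
  by apply: comm_e => //; exact: ltn_trans kn.
by rewrite mulrC zpowA.
Qed.

Lemma zprod_zero : zprod e n (fun=> 0%R) = 1.
Proof. by rewrite /zprod big1. Qed.

Lemma zprod_opp v : zprod e n (fun i => - v i)%R = (zprod e n v)^-1.
Proof.
apply/esym/mulg1_eq; rewrite -zprod_add -zprod_zero.
by apply: eq_zprod => // i _; rewrite subrr.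
Qed.

Lemma zprod_sum m (a : nat -> int) (b : nat -> nat -> int) :
  zprod e n (fun i => \sum_(j < m) a j * b j i)%R =
  \prod_(j < m) zpow (zprod e n (b j)) (a j).
Proof.
elim: m => [|m IH].
  by rewrite big_ord0 -zprod_zero; apply: eq_zprod => // i _; rewrite big_ord0.
rewrite big_ord_recr /= -IH -zprod_scale -zprod_add.
by apply: eq_zprod => // i _; rewrite big_ord_recr.
Qed.

End Zprod.

Section Subgroup.
Variable N : set G.
Hypothesis subN : is_subgroup N.

Lemma sub1 : N 1. Proof. by case: subN. Qed.
Lemma subM g h : N g -> N h -> N (g * h). Proof. by case: subN => _ + _; apply. Qed.
Lemma subV g : N g -> N g^-1. Proof. by case: subN => _ _; apply. Qed.
Lemma subX g (k : nat) : N g -> N (g ^+ k).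
Proof.
move=> gN; elim: k => [|k IH]; first by rewrite expg0; exact: sub1.
by rewrite expgS; exact: subM.
Qed.
Lemma subZ g m : N g -> N (zpow g m).
Proof. by case: m => k gN /=; [exact: subX|exact/subV/subX]. Qed.
Lemma sub_zprod e n v : (forall i, (i < n)%N -> N (e i)) -> N (zprod e n v).
Proof.
move=> eN; apply: (big_ind N) => [|h k|i _].
- exact: sub1.
- exact: subM.
- exact/subZ/eN.
Qed.
End Subgroup.

(* A free abelian subgroup on [e 0 .. e (n - 1)] of finite index in the abelian
   group [N], containing all [M]-th powers. *)
Record abel_struct N e n (M : nat) (F : seq G) : Prop := {
  as_sub : is_subgroup N;
  as_comm : forall g h, N g -> N h -> commute g h;
  as_mem : forall i, (i < n)%N -> N (e i);
  as_indep : forall v, zprod e n v = 1 -> forall i, (i < n)%N -> v i = 0%R;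
  as_pos : (0 < M)%N;
  as_root : forall h, N h -> exists v, h ^+ M = zprod e n v;
  as_Fsub : forall f, f \in F -> N f;
  as_cover : forall h, N h -> exists v, exists2 f, f \in F & h = zprod e n v * f
}.

Lemma as_comm_e N e n M F : abel_struct N e n M F ->
  forall i j, (i < n)%N -> (j < n)%N -> commute (e i) (e j).
Proof. by move=> S i j ? ?; apply: (as_comm S); apply: (as_mem S). Qed.

Lemma as_inj N e n M F : abel_struct N e n M F -> forall v w,
  zprod e n v = zprod e n w -> forall i, (i < n)%N -> v i = w i.
Proof.
move=> S v w vw i ni; apply/eqP; rewrite -subr_eq0; apply/eqP.
apply: (as_indep S (v := fun i => (v i - w i)%R)) => //.
by rewrite zprod_add ?zprod_opp ?vw ?mulgV //; exact: (as_comm_e S).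
Qed.

Definition adjoin N (g : G) : set G :=
  [set h | exists k t, N k /\ h = k * zpow g t].

Lemma adjoin_subset N g : N `<=` adjoin N g.
Proof. by move=> h Nh; exists h, 0%R; rewrite zpow0 mulg1. Qed.

Lemma adjoin_mem N g : N 1 -> adjoin N g g.
Proof. by move=> N1; exists 1, 1%R; rewrite mul1g zpow1. Qed.

Lemma adjoin_subgroup N g : is_subgroup N -> (forall h, N h -> commute g h) ->
  is_subgroup (adjoin N g).
Proof.
move=> S gN; split.
- exact: adjoin_subset (sub1 S).
- move=> _ _ [k [t [kN ->]]] [l [s [lN ->]]].
  exists (k * l), (t + s)%R; split; first exact: subM.
  rewrite zpowD !mulgA; congr (_ * _); rewrite -!mulgA; congr (_ * _).
  by apply/commute_sym/commute_zpow/commute_sym/gN.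
- move=> _ [k [t [kN ->]]]; exists k^-1, (- t)%R; split; first exact: subV.
  rewrite invgM zpowN; apply/commuteV/commute_sym/commuteV.
  by apply/commute_zpow/commute_sym/gN.
Qed.

Lemma adjoin_comm N g : (forall h k, N h -> N k -> commute h k) ->
  (forall h, N h -> commute g h) ->
  forall h k, adjoin N g h -> adjoin N g k -> commute h k.
Proof.
move=> NN gN _ _ [k [t [kN ->]]] [l [s [lN ->]]].
have H (h : G) : N h -> commute h (l * zpow g s).
  by move=> hN; apply: commuteM; [exact: NN|exact/commute_zpow/commute_sym/gN].
apply/commute_sym/commuteM; apply/commute_sym; first exact: H.
apply/commute_sym/commute_zpow/commute_sym/commuteM; first exact: gN.
exact/commute_zpow.
Qed.

(** Either some [g ^+ s] with [s > 0] falls into [N], and then the basis is unchanged while [M]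
    becomes [M * s] and [F] is multiplied by the powers of [g] below [s]; or no nontrivial power
    does, and [g] is a new basis element. The divisibility lets roots taken in the smaller group be
    reused in the larger one. *)
Lemma as_extend N e n M F (g : G) : abel_struct N e n M F ->
  (forall h, N h -> commute g h) ->
  exists e' n' M' F', [/\ abel_struct (adjoin N g) e' n' M' F', (n <= n')%N,
    (forall i, (i < n)%N -> e' i = e i) & (M %| M')%N].
Proof.
move=> S gN; have sS := as_sub S; have cE := as_comm_e S.
have gZ t h : N h -> commute h (zpow g t).
  by move=> hN; apply/commute_zpow/commute_sym/gN.
have [[s s0 gs]|indep] := pselect (exists2 s, (0 < s)%N & N (g ^+ s)).
  exists e, n, (M * s)%N, [seq f * g ^+ t | f <- F, t <- iota 0 s].
  split=> //; last exact: dvdn_mulr.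
  have [w gw] := as_root S gs.
  split.
  - exact: adjoin_subgroup.
  - by apply: adjoin_comm => //; exact: (as_comm S).
  - by move=> i ni; apply/adjoin_subset/(as_mem S).
  - exact: (as_indep S).
  - by rewrite muln_gt0 (as_pos S).
  - move=> _ [k [t [kN ->]]]; have [v kv] := as_root S kN.
    exists (fun i => s%:Z * v i + t * w i)%R.
    rewrite zprod_add // !zprod_scale // -kv -gw expgMn; last exact: gZ.
    rewrite expgnA; congr (_ * _); rewrite !zpowX -!zpowA; congr zpow; lia.
  - move=> _ /allpairsP[[f t] /= [fF _ ->]]; exists f, t%:Z.
    by split=> //; exact: (as_Fsub S).
  - move=> _ [k [t [kN ->]]].
    have tE : t = (s%:Z * (t %/ s%:Z)%Z + (t %% s%:Z)%Z)%R.
      by rewrite {1}(divz_eq t s%:Z); lia.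
    have r0 : (0 <= (t %% s%:Z)%Z)%R by apply: modz_ge0; lia.
    have rs : ((t %% s%:Z)%Z < s%:Z)%R by apply: ltz_pmod; lia.
    have : N (k * zpow (g ^+ s) (t %/ s%:Z)%Z) by apply: subM => //; apply: subZ.
    move=> /(as_cover S)[v [f fF E]].
    exists v, (f * g ^+ absz (t %% s%:Z)%Z).
      by apply: allpairs_f => //; rewrite mem_iota; lia.
    rewrite mulgA -E {1}tE zpowD zpowA -zpowX mulgA; congr (_ * _).
    by rewrite zpowX gez0_abs.
have gN0 t : N (zpow g t) -> t = 0%R.
  move=> Ng; have [|t0] := posnP (absz t); first by lia.
  case: indep; exists (absz t) => //.
  rewrite zpowX; case: (ger0P t) => tp; first by rewrite gez0_abs.
  by rewrite abszE ltr0_norm // zpowN; exact: subV.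
pose e' i := if i == n then g else e i.
have e'E v : zprod e' n.+1 v = zprod e n v * zpow g (v n).
  rewrite zprodS /e' eqxx; congr (_ * _); apply: eq_zprod => // i ni.
  by rewrite ltn_eqF.
exists e', n.+1, M, F; split => //; last by move=> i ni; rewrite /e' ltn_eqF.
split.
- exact: adjoin_subgroup.
- by apply: adjoin_comm => //; exact: (as_comm S).
- move=> i; rewrite ltnS leq_eqVlt /e' => /orP[/eqP->|ni].
    by rewrite eqxx; exact: adjoin_mem (sub1 sS).
  by rewrite ltn_eqF //; exact/adjoin_subset/(as_mem S).
- move=> v; rewrite e'E => E.
  have vn0 : v n = 0%R.
    apply: gN0; rewrite -(mulKg (zprod e n v) (zpow g (v n))) E mulg1.
    apply: subV => //; apply: sub_zprod => //; exact: (as_mem S).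
  move: E; rewrite vn0 mulg1 => /(as_indep S) v0 i.
  by rewrite ltnS leq_eqVlt => /orP[/eqP->|/v0].
- exact: (as_pos S).
- move=> _ [k [t [kN ->]]]; have [v kv] := as_root S kN.
  exists (fun i => if i == n then M%:Z * t else v i)%R.
  rewrite e'E eqxx expgMn; last exact: gZ.
  rewrite kv [X in _ * X = _]zpowX -zpowA mulrC; congr (_ * _).
  by apply: eq_zprod => // i ni; rewrite ltn_eqF.
- by move=> f fF; exact/adjoin_subset/(as_Fsub S).
- move=> _ [k [t [kN ->]]]; have [v [f fF ->]] := as_cover S kN.
  exists (fun i => if i == n then t else v i), f => //.
  rewrite e'E eqxx -!mulgA gZ; last exact: (as_Fsub S).
  congr (_ * _); by apply: eq_zprod => // i ni; rewrite ltn_eqF.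
Qed.

Lemma as_trivial : abel_struct [set 1] (fun=> 1) 0 1 [:: 1].
Proof.
split=> //.
- split=> //=; first by move=> _ _ -> ->; rewrite mulg1.
  by move=> _ ->; rewrite invg1.
- by move=> _ _ /= -> ->.
- by move=> h /= ->; exists (fun=> 0%R); rewrite zprod0.
- by move=> f; rewrite inE => /eqP.
- by move=> h /= ->; exists (fun=> 0%R), 1; rewrite ?inE // zprod0 mulg1.
Qed.

(** The last clause makes [N'] the least subgroup of its kind; this is how centrality passes from
    the generators to [N']. *)
Lemma as_extend_seq (gs : seq G) N e n M F : abel_struct N e n M F ->
  (forall g h, g \in gs -> N h -> commute g h) ->
  (forall g h, g \in gs -> h \in gs -> commute g h) ->
  exists N' e' n' M' F', [/\ abel_struct N' e' n' M' F', (n <= n')%N,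
    (forall i, (i < n)%N -> e' i = e i) & (M %| M')%N] /\
    [/\ N `<=` N', (forall g, g \in gs -> N' g) &
      forall K, is_subgroup K -> N `<=` K -> (forall g, g \in gs -> K g) -> N' `<=` K].
Proof.
elim: gs N e n M F => [|g gs IH] N e n M F S gN gg.
  by exists N, e, n, M, F; split; split.
have [|e1 [n1 [M1 [F1 [S1 n01 e01 M01]]]]] := as_extend (g := g) S.
  by move=> h; apply: gN; rewrite mem_head.
have [||N2 [e2 [n2 [M2 [F2 [[S2 n12 e12 M12] [N12 gs2 min2]]]]]]] := IH _ _ _ _ _ S1.
- move=> h _ hgs [k [t [kN ->]]]; apply: commuteM.
    by apply: gN => //; rewrite inE hgs orbT.
  by apply: commute_zpow; apply: gg; rewrite inE ?eqxx // hgs orbT.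
- by move=> h k hg kg; apply: gg; rewrite inE ?hg ?kg orbT.
exists N2, e2, n2, M2, F2; split; split=> //.
- exact: leq_trans n12.
- by move=> i ni; rewrite e12 ?e01 // (leq_trans ni).
- exact: dvdn_trans M12.
- by move=> h Nh; apply/N12/adjoin_subset.
- move=> h; rewrite inE => /orP[/eqP->|/gs2//].
  by apply: N12; exact: adjoin_mem (sub1 (as_sub S)).
- move=> K KS NK gK; apply: min2 => //.
    move=> _ [k [t [kN ->]]]; apply: subM => //; first exact: NK.
    by apply: subZ => //; apply: gK; rewrite mem_head.
  by move=> h hgs; apply: gK; rewrite inE hgs orbT.
Qed.

End AbelianStructure.

(** * Conjugation on an abelian subgroup, in coordinates *)

Section AbelianPart.
Local Open Scope group_scope.
Variable G : groupType.
Variables (N : set G) (e : nat -> G) (n M : nat) (F : seq G).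
Hypothesis S : abel_struct N e n M F.
Implicit Types (u v w r : nat -> int).

(** Write [w] as [zprod e n v * f]: then [M * v = r - p f], where [p f] are the coordinates of
    [f ^+ M] and [f] has finitely many values. Conjugation need not preserve the free part of [N],
    which is why elements are compared through their [M]-th powers. *)
Lemma finite_roots (C : nat) : exists B : seq G, forall (w : G) r, N w ->
  w ^+ M = zprod e n r -> (forall i, (i < n)%N -> (`|r i| <= C%:Z)%R) -> w \in B.
Proof.
have /choice[p pP] : forall f, exists p, f \in F -> f ^+ M = zprod e n p.
  move=> f; have [/(as_Fsub S)/(as_root S)[p fp]|nF] := boolP (f \in F).
    by exists p.
  by exists (fun=> 0%R).
pose D := (C + \max_(f <- F) \max_(i < n) `|p f i|)%N.
have [B0 hB0] := zprod_bounded e n D.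
exists [seq b * f | b <- B0, f <- F] => w r wN wr rC.
have [v [f fF wE]] := as_cover S wN; rewrite wE.
apply: allpairs_f => //; apply: hB0 => i ni.
have : zprod e n (fun i => M%:Z * v i + p f i)%R = zprod e n r.
  rewrite -wr wE expgMn; last first.
    apply: (as_comm S); last exact: (as_Fsub S).
    by apply: (sub_zprod (as_sub S)); exact: (as_mem S).
  rewrite zprod_add; last exact: (as_comm_e S).
  by rewrite zprod_scale -?zpowX ?(pP f) //; exact: (as_comm_e S).
move=> /(as_inj S)/(_ i ni) E.
have pD : (absz (p f i) <= \max_(f <- F) \max_(i < n) `|p f i|)%N.
  apply: (bigmaxn_sup_seq f) => //.
  exact: (leq_bigmax (F := fun i : 'I_n => absz (p f i)) (Ordinal ni)).
have rCi := rC i ni; have M0 := as_pos S.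
rewrite /D PoszD; move: (\max_(f <- F) _)%N pD => m pD.
have : (`|v i| <= `|M%:Z * v i|)%R by rewrite normrM ler_peMl //; lia.
move: (M%:Z * v i)%R E => q E; lia.
Qed.

Variables (g : G) (nu : nat -> nat -> int).
Hypothesis conjN : forall h, N h -> N (h ^ g).
Hypothesis conj_e : forall j, (j < n)%N -> (e j ^ g) ^+ M = zprod e n (nu j).

Lemma conj_root v : (zprod e n v ^ g) ^+ M =
  zprod e n (fun i => \sum_(j < n) v j * nu j i)%R.
Proof.
rewrite zprod_sum; last exact: (as_comm_e S).
have -> : zprod e n v ^ g = zprod (fun j => e j ^ g) n v.
  by rewrite /zprod conjg_prod; apply: eq_bigr => i _; rewrite zpowJ.
rewrite zpowX -zprod_scale; last first.
  move=> i j ni nj; apply: (as_comm S); apply: conjN; exact: (as_mem S).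
by apply: eq_bigr => j _; rewrite zpowA -zpowX conj_e.
Qed.

Variables (k : G) (kappa : nat -> int).
Hypothesis kN : N k.
Hypothesis k_root : k ^+ M = zprod e n kappa.

(** [nu] is [M] times the rational matrix of conjugation by [g], so the affine action on coordinates
    becomes integral after multiplication by [M]. *)
Lemma conj_linear v v' : zprod e n v ^ g * k = zprod e n v' ->
  forall i, (i < n)%N ->
    (M%:Z * v' i = \sum_(j < n) v j * nu j i + kappa i)%R.
Proof.
move=> E i ni.
pose w i := (\sum_(j < n) v j * nu j i + kappa i)%R.
apply: (as_inj S (v := (fun i => M%:Z * v' i)%R) (w := w)) => //.
rewrite zprod_scale; last exact: (as_comm_e S).
rewrite -E -zpowX expgMn; last first.
  apply: (as_comm S) => //; apply: conjN; apply: (sub_zprod (as_sub S)).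
  exact: (as_mem S).
by rewrite conj_root k_root -zprod_add //; exact: (as_comm_e S).
Qed.

Lemma conj_close (C : nat) : exists B : seq G, forall v v',
  zprod e n v ^ g * k = zprod e n v' ->
  forall T t u u', (0 < T)%N -> (t <= T)%N ->
    (forall i, (i < n)%N -> (`|T%:Z * u i - t%:Z * v i| <= C%:Z * T%:Z)%R) ->
    (forall i, (i < n)%N -> (`|T%:Z * u' i - t%:Z * v' i| <= C%:Z * T%:Z)%R) ->
    (zprod e n u ^ g)^-1 * zprod e n u' \in B.
Proof.
(* The [M]-th power of the quotient has coordinates [M u' - nu u]. By linearity this is the fraction
   [t / T] of [kappa], up to [M * C] from [u'] and [C * |nu j i|] from each [u j]. *)
pose D := (\max_(i < n) (M * C + \sum_(j < n) C * `|nu j i| + `|kappa i|))%N.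
have [B hB] := finite_roots D; exists B => v v' E T t u u' T0 tT hu hu'.
have zN w : N (zprod e n w).
  by apply: (sub_zprod (as_sub S)); exact: (as_mem S).
apply: (hB _ (fun i => M%:Z * u' i - \sum_(j < n) u j * nu j i)%R).
- apply: (subM (as_sub S)) => //; apply: (subV (as_sub S)); exact: conjN.
- rewrite expgMn; last first.
    apply: (as_comm S) => //; apply: (subV (as_sub S)); exact: conjN.
  rewrite expVgn conj_root -zprod_opp; last exact: (as_comm_e S).
  rewrite [X in _ * X]zpowX -zprod_scale; last exact: (as_comm_e S).
  rewrite -zprod_add; last exact: (as_comm_e S).
  by apply: eq_zprod => // i _; rewrite addrC.
move=> i ni; have L := conj_linear E ni.
apply: le_trans (_ : _ <= (M * C + \sum_(j < n) C * `|nu j i| + `|kappa i|)%N%:Z)%R _; last first.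
  rewrite lez_nat /D.
  exact: (leq_bigmax (F := fun i : 'I_n => (M * C + \sum_(j < n) C * `|nu j i| + `|kappa i|)%N) (Ordinal ni)).
rewrite PoszD abszE; apply: (scaled_bound T0 tT).
have -> : (T%:Z * (M%:Z * u' i - \sum_(j < n) u j * nu j i) - t%:Z * kappa i =
  M%:Z * (T%:Z * u' i - t%:Z * v' i) -
  \sum_(j < n) (T%:Z * u j - t%:Z * v j) * nu j i)%R.
  have -> : (kappa i = M%:Z * v' i - \sum_(j < n) v j * nu j i)%R.
    by rewrite L addrC addKr.
  have -> : (\sum_(j < n) (T%:Z * u j - t%:Z * v j) * nu j i =
     T%:Z * (\sum_(j < n) u j * nu j i) - t%:Z * (\sum_(j < n) v j * nu j i))%R.
    rewrite !mulr_sumr -sumrB; apply: eq_bigr => j _; ring.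
  ring.
apply: (le_trans (ler_normB _ _)); rewrite PoszD mulrDl; apply: lerD.
  rewrite normrM PoszM -mulrA; apply: ler_wpM2l => //; exact: hu'.
apply: (le_trans (ler_norm_sum _ _ _)).
rewrite (big_morph Posz PoszD (id1 := 0%R)) // mulr_suml.
apply: ler_sum => j _; rewrite normrM PoszM abszE -mulrA [(`|nu j i| * _)%R]mulrC mulrA.
by apply: ler_wpM2r => //; exact: hu.
Qed.

End AbelianPart.

(** * An abelian normal subgroup whose basis starts with a central one *)

Section CentralFirst.
Local Open Scope group_scope.
Variable G : groupType.
Variables (N1 N : set G) (e1 e : nat -> G) (n1 n M1 M : nat) (F1 F : seq G).
Hypothesis S1 : abel_struct N1 e1 n1 M1 F1.
Hypothesis S : abel_struct N e n M F.
Hypothesis n1n : (n1 <= n)%N.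
Hypothesis e1e : forall i, (i < n1)%N -> e i = e1 i.
Hypothesis M1M : (M1 %| M)%N.
Hypothesis N1N : N1 `<=` N.
Hypothesis N1_central : forall h g, N1 h -> commute h g.
Hypothesis N1_comm : forall g h, N1 [~ g, h].
Implicit Types (u v w r : nat -> int).

Lemma zprod_delta (d : nat -> G) m j : (j < m)%N ->
  zprod d m (fun i => (i == j)%:R)%R = d j.
Proof.
elim: m => // m IH; rewrite ltnS leq_eqVlt zprodS => /orP[/eqP->|jm].
  rewrite eqxx zpow1 -[RHS]mul1g; congr (_ * _).
  rewrite -[RHS](zprod_zero d m); apply: eq_zprod => // i im.
  by rewrite (ltn_eqF im).
by rewrite (IH jm) gtn_eqF // mulg1.
Qed.

Lemma conj_stable g h : N h -> N (h ^ g).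
Proof.
move=> hN; have -> : h ^ g = h * [~ h, g] by rewrite commgEl mulVKg.
by apply: (subM (as_sub S)) => //; apply: N1N.
Qed.

Lemma zprod_mem v : N (zprod e n v).
Proof. by apply: (sub_zprod (as_sub S)) => i; exact: (as_mem S). Qed.

(** As [M1] divides [M], a multiple of the coordinates of the root in [N1], padded with zeros,
    serves in [N]. *)
Lemma root_central h : N1 h -> exists2 v,
  (forall i, (n1 <= i)%N -> v i = 0%R) & h ^+ M = zprod e n v.
Proof.
move=> hN; have [v hv] := as_root S1 hN.
have /dvdnP[q Mq] := M1M.
exists (fun i => if (i < n1)%N then q%:Z * v i else 0)%R.
  by move=> i; rewrite ltnNge => ->.
have trunc m : (n1 <= m)%N -> (m <= n)%N ->
    zprod e m (fun i => if (i < n1)%N then q%:Z * v i else 0)%R =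
    zprod e1 n1 (fun i => q%:Z * v i)%R.
  elim: m => [|m IH] n1m mn.
    by move: n1m; rewrite leqn0 => /eqP->; rewrite !zprod0.
  move: n1m; rewrite leq_eqVlt => /orP[/eqP n1m|n1m].
    by rewrite -n1m; apply: eq_zprod => i im; [exact: e1e|rewrite im].
  by rewrite zprodS IH // ?(ltnW mn) // ltnNge -ltnS n1m /= mulg1.
rewrite trunc // zprod_scale; last exact: (as_comm_e S1).
by rewrite -hv Mq mulnC expgnA.
Qed.

(** Conjugation by [g] multiplies [e j] by [[~ e j, g]], which lies in [N1] and is trivial for
    [j < n1]. Hence the matrix is [M] times the identity, except for entries from some [j >= n1] to
    some [i < n1]. *)
Lemma conj_matrix g : exists nu : nat -> nat -> int,
  (forall j, (j < n)%N -> (e j ^ g) ^+ M = zprod e n (nu j)) /\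
  (forall i j, (i < n)%N -> (j < n)%N -> (n1 <= i)%N || (j < n1)%N ->
     nu j i = (M%:Z * (i == j)%:R)%R).
Proof.
have /choice[mu muP] : forall j, exists mu : nat -> int,
    (forall i, (n1 <= i)%N || (j < n1)%N -> mu i = 0%R) /\
    [~ e j, g] ^+ M = zprod e n mu.
  move=> j; have [jn1|jn1] := ltnP j n1.
    exists (fun=> 0%R); split=> //; rewrite zprod_zero.
    have -> : [~ e j, g] = 1.
      apply/eqP/commgP; rewrite e1e //; apply: N1_central; exact: (as_mem S1).
    exact: expg1n.
  have [mu mu0 E] := root_central (N1_comm (e j) g).
  by exists mu; split=> // i; rewrite orbF => /mu0.
exists (fun j i => M%:Z * (i == j)%:R + mu j i)%R; split=> [j jn|i j ni nj ij].
  have -> : e j ^ g = e j * [~ e j, g] by rewrite commgEl mulVKg.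
  rewrite expgMn; last by apply/commute_sym/N1_central.
  rewrite zprod_add; last exact: (as_comm_e S).
  rewrite (proj2 (muP j)); congr (_ * _).
  rewrite zprod_scale; last exact: (as_comm_e S).
  by rewrite zprod_delta.
rewrite (proj1 (muP j)) ?addr0 //.
Qed.

Lemma sum_delta v i : (i < n)%N ->
  (\sum_(j < n) v j * (M%:Z * (i == j)%:R) = M%:Z * v i)%R.
Proof.
move=> ni; rewrite (bigD1 (Ordinal ni)) //= eqxx big1 ?addr0; first by rewrite mulr1 mulrC.
move=> j ij; have /negPf -> : i != j :> nat; last by rewrite !mulr0.
by apply: contraNneq ij => ij; apply/eqP/val_inj.
Qed.

(** The diagonal of the matrix cancels in [M (v' - v)]; its triangular shape leaves only coordinates
    from [n1] on, and these only in rows below [n1]. *)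
Lemma conj_step g k : N k -> exists C : nat, forall v v',
  zprod e n v ^ g * k = zprod e n v' -> forall i, (i < n)%N ->
    (`|v' i - v i| <= C%:Z *
      (1 + (if (i < n1)%N then \sum_(j < n | (n1 <= j)%N) `|v j| else 0)))%R.
Proof.
move=> kN; have [nu [nuP nuD]] := conj_matrix g; have [ka kaP] := as_root S kN.
pose D1 := (\max_(i < n) `|ka i|)%N.
pose D2 := (\max_(i < n) \max_(j < n) `|nu j i|)%N.
exists (D1 + D2)%N => v v' /(conj_linear S (@conj_stable g) nuP kN kaP) H i ni.
have {}H := H i ni.
have kaD : (absz (ka i) <= D1)%N.
  exact: (leq_bigmax (F := fun i : 'I_n => absz (ka i)) (Ordinal ni)).
have nuB j : (j < n)%N -> (absz (nu j i) <= D2)%N.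
  move=> nj; apply: leq_trans (leq_bigmax (Ordinal ni)).
  exact: (leq_bigmax (F := fun j : 'I_n => absz (nu j i)) (Ordinal nj)).
have M0 := as_pos S.
have E : (M%:Z * (v' i - v i) = ka i +
   (if (i < n1)%N then \sum_(j < n | (n1 <= j)%N) v j * nu j i else 0))%R.
  rewrite mulrBr H; case: ltnP => ni1.
    rewrite -(sum_delta v ni) (bigID (fun j : 'I_n => (n1 <= j)%N)) /=.
    rewrite [X in (_ - X)%R](bigID (fun j : 'I_n => (n1 <= j)%N)) /=.
    rewrite [X in (_ - (X + _))%R]big1; last first.
      move=> j n1j; have /negPf -> : i != j :> nat; last by rewrite !mulr0.
      by rewrite neq_ltn (leq_trans ni1).
    rewrite add0r [X in (_ + X + _ - _)%R](eq_bigr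
      (fun j : 'I_n => v j * (M%:Z * (i == j)%:R)))%R; first by ring.
    by move=> j; rewrite -ltnNge => jn1; rewrite nuD // jn1 orbT.
  rewrite -(sum_delta v ni) (eq_bigr (fun j : 'I_n => v j * (M%:Z * (i == j)%:R)))%R.
    by ring.
  by move=> j _; rewrite nuD // ni1.
have L : (`|v' i - v i| <= `|M%:Z * (v' i - v i)|)%R.
  by rewrite normrM ler_peMl //; lia.
apply: (le_trans L); rewrite E; apply: (le_trans (ler_normD _ _)).
rewrite mulrDr mulr1 PoszD; case: ifP => _; last by rewrite normr0; lia.
apply: lerD; first by lia.
apply: (le_trans (ler_norm_sum _ _ _)); rewrite mulr_sumr.
apply: ler_sum => j _; rewrite normrM mulrC; apply: ler_wpM2r => //.
have := nuB j (ltn_ord j); lia.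
Qed.

Lemma conj_close_exists g k (C : nat) : N k -> exists B : seq G, forall v v',
  zprod e n v ^ g * k = zprod e n v' ->
  forall T t u u', (0 < T)%N -> (t <= T)%N ->
    (forall i, (i < n)%N -> (`|T%:Z * u i - t%:Z * v i| <= C%:Z * T%:Z)%R) ->
    (forall i, (i < n)%N -> (`|T%:Z * u' i - t%:Z * v' i| <= C%:Z * T%:Z)%R) ->
    (zprod e n u ^ g)^-1 * zprod e n u' \in B.
Proof.
move=> kN; have [nu [nuP _]] := conj_matrix g; have [ka kaP] := as_root S kN.
exact: (conj_close S (@conj_stable g) nuP kN kaP).
Qed.

Lemma coord_prod_one v : coord_prod e (fun=> 0%N) n v = zprod e n v.
Proof.
rewrite /coord_prod !big_ord_recl big_ord0 /= !big_pred0_eq !mulg1.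
by apply: eq_bigl => i; rewrite eqxx.
Qed.

Variables (c : G) (F0 : seq G).
Hypothesis cover0 : forall g, exists i h f,
  [/\ N h, f \in F0 & g = zpow c i * h * f].

(** One segment suffices: [zpow c i] is split by Euclidean division of [i] by [s]; the multiple of
    [s] gives an element of [N], and the remainder joins [F']. *)
Lemma coordinates_finite s : (0 < s)%N -> N (c ^+ s) ->
  exists F', coordinate_system n e (fun=> 0%N) (fun i => i < n1)%N F'.
Proof.
move=> s0 cs.
exists [seq f1 * h | f1 <- F, h <- [seq c ^+ t * f | t <- iota 0 s, f <- F0]].
(* Only elements of [N] relate two coordinate vectors; for any other [h] the last two clauses hold
   vacuously. *)
have inN v v' h : coord_prod e (fun=> 0%N) n v * h = coord_prod e (fun=> 0%N) n v' -> N h.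
  rewrite !coord_prod_one => E; rewrite -(mulKg (zprod e n v) h) E.
  apply: (subM (as_sub S)); first apply: (subV (as_sub S)); exact: zprod_mem.
split=> //.
- by move=> i j ni nj _; apply: (as_comm_e S).
- move=> g; have [i [h [f [hN fF ->]]]] := cover0 g.
  have iE : i = (s%:Z * (i %/ s%:Z)%Z + (i %% s%:Z)%Z)%R.
    by rewrite {1}(divz_eq i s%:Z); lia.
  have r0 : (0 <= (i %% s%:Z)%Z)%R by apply: modz_ge0; lia.
  have rs : ((i %% s%:Z)%Z < s%:Z)%R by apply: ltz_pmod; lia.
  set t := absz (i %% s%:Z)%Z.
  have : N (zpow (c ^+ s) (i %/ s%:Z)%Z * h ^ (c ^+ t)^-1).
    by apply: (subM (as_sub S)); [exact: (subZ (as_sub S))|exact: conj_stable].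
  move=> /(as_cover S)[v [f1 f1F E]].
  exists v, (f1 * (c ^+ t * f)).
    do 2! [apply: allpairs_f => //]; rewrite mem_iota /t; lia.
  rewrite coord_prod_one !mulgA -E {1}iE zpowD zpowA -zpowX.
  have -> : zpow c (i %% s%:Z)%Z = c ^+ t by rewrite zpowX gez0_abs.
  by rewrite conjgE invgK !mulgA mulgVK.
- move=> h; have [hN|hN] := pselect (N h); last first.
    by exists 0%N => v v' /inN.
  have [C hC] := conj_step 1 hN; exists C => v v'.
  rewrite !coord_prod_one => E i ni.
  have := hC v v' _ i ni; rewrite conjg1 => /(_ E).
  by under eq_bigl do rewrite leqNgt.
- move=> h C; have [hN|hN] := pselect (N h); last first.
    by exists [::] => v v' /inN.
  have [B hB] := conj_close_exists 1 C hN; exists (h :: B) => v v'.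
  rewrite !coord_prod_one => E T t [|k] u u' T0 tT _ hu hu'; rewrite !coord_prod_one.
    rewrite inE; apply/orP; right.
    have := hB v v'; rewrite conjg1 => /(_ E T t u u' T0 tT).
    rewrite conjg1; apply=> i ni; first by have [_ _ /(_ erefl)] := hu i ni.
    by have [_ _ /(_ erefl)] := hu' i ni.
  (* After segment 0 both elements are completely written, so the quotient is [h] itself. *)
  have -> : zprod e n u = zprod e n v.
    by apply: eq_zprod => // i ni; have [/(_ isT)] := hu i ni.
  have -> : zprod e n u' = zprod e n v'.
    by apply: eq_zprod => // i ni; have [/(_ isT)] := hu' i ni.
  by rewrite -E mulKg mem_head.
Qed.

(** [c] comes first in the product but takes the last index [n]: the basis of [N] keeps its indices,
    and the central coordinates stay below [n1]. *)
Let e' i := if (i < n)%N then e i else c.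
Let seg i := if (i < n)%N then 1%N else 0%N.

Lemma coord_prod_two v : coord_prod e' seg n.+1 v = zpow c (v n) * zprod e n v.
Proof.
rewrite /coord_prod !big_ord_recl big_ord0 mulg1.
congr (_ * _).
  rewrite big_mkcond big_ord_recr /= /seg /e' ltnn eqxx big1 ?mul1g // => i _.
  by rewrite ltn_ord.
rewrite [X in _ * X]big_pred0 ?mulg1; last first.
  by move=> i; rewrite /seg; case: ifP.
rewrite big_mkcond big_ord_recr /= /seg ltnn mulg1.
by apply: eq_bigr => i _; rewrite /e' ltn_ord.
Qed.

Lemma coordinates_infinite : (forall s, N (zpow c s) -> s = 0%R) ->
  exists F', coordinate_system n.+1 e' seg (fun i => i < n1)%N F'.
Proof.
move=> cN.
exists [seq f1 * f | f1 <- F, f <- F0].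
have comc i j : (zpow c i)^-1 * zpow c j = zpow c j * (zpow c i)^-1.
  by rewrite -zpowB addrC zpowD zpowN.
have shape v v' h : coord_prod e' seg n.+1 v * h = coord_prod e' seg n.+1 v' ->
    exists d k, N k /\ h = zpow c d * k.
  rewrite !coord_prod_two => /(canRL (mulKg _)) ->.
  exists (v' n - v n)%R, ((zprod e n v)^-1 ^ (zpow c (v' n - v n)%R) * zprod e n v').
  split.
    apply: (subM (as_sub S)); last exact: zprod_mem.
    by apply: conj_stable; apply: (subV (as_sub S)); exact: zprod_mem.
  have := conjgC (zprod e n v)^-1 (zpow c (v' n - v n)%R).
  move: (_ ^ zpow c _) => w cw.
  rewrite [RHS]mulgA -cw invgM zpowB -!mulgA; congr (_ * _).
  by rewrite !mulgA; congr (_ * _); exact: comc.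
(* Powers of [c] are independent modulo [N], so they can be compared separately. What is left is
   conjugation by [zpow c d] followed by multiplication by [k], the situation of [conj_step] and
   [conj_close_exists]. *)
have solve v v' d k : N k ->
    coord_prod e' seg n.+1 v * (zpow c d * k) = coord_prod e' seg n.+1 v' ->
    (v' n - v n = d)%R /\ zprod e n v ^ (zpow c d) * k = zprod e n v'.
  rewrite !coord_prod_two => kN E.
  have E2 : zpow c (v n + d - v' n) * (zprod e n v ^ (zpow c d) * k) = zprod e n v'.
    rewrite addrC zpowD zpowN -mulgA; apply: (canLR (mulKg _)).
    have := conjgC (zprod e n v) (zpow c d).
    move: (zprod e n v ^ zpow c d) => w cw.
    by rewrite -E zpowD -!mulgA; congr (_ * _); rewrite [RHS]mulgA cw -mulgA.
  have d0 : (v n + d - v' n = 0)%R.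
    apply: cN; rewrite -[zpow c _](mulgK (zprod e n v ^ (zpow c d) * k)) E2.
    apply: (subM (as_sub S)); first exact: zprod_mem.
    apply: (subV (as_sub S)); apply: (subM (as_sub S)) => //.
    exact/conj_stable/zprod_mem.
  by split; [lia|move: E2; rewrite d0 mul1g].
split.
- move=> i j; rewrite !ltnS /e' /seg [(i <= n)%N]leq_eqVlt [(j <= n)%N]leq_eqVlt.
  move=> /orP[/eqP->|ni] /orP[/eqP->|nj]; rewrite ?ltnn ?ni ?nj //.
  by move=> _; apply: (as_comm_e S).
- by move=> i _; rewrite /seg; case: ifP.
- move=> g; have [i [h [f [hN fF ->]]]] := cover0 g.
  have [v [f1 f1F ->]] := as_cover S hN.
  exists (fun j => if (j < n)%N then v j else i), (f1 * f); first exact: allpairs_f.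
  rewrite coord_prod_two ltnn !mulgA; congr (_ * _ * _ * _).
  by apply: eq_zprod => // j ->.
- move=> h; have [[d [k [kN hE]]]|nh] := pselect (exists d k, N k /\ h = zpow c d * k); last first.
    by exists 0%N => v v' /shape.
  have [C hC] := conj_step (zpow c d) kN; exists (C + `|d|)%N => v v'.
  rewrite hE => /(solve _ _ _ _ kN)[dE E] i; rewrite ltnS leq_eqVlt => /orP[/eqP->|ni].
    by rewrite dE ltnNge n1n /=; lia.
  apply: (le_trans (hC v v' E i ni)).
  have P1 : (0 <= 1 + (if (i < n1)%N then \sum_(j < n | (n1 <= j)%N) `|v j| else 0) :> int)%R.
    by apply: addr_ge0 => //; case: ifP => // _; apply: sumr_ge0.
  apply: ler_pM => //; first by lia.
  rewrite lerD2l; case: ifP => // _.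
  rewrite [leRHS]big_mkcond big_ord_recr -leqNgt n1n /= big_mkcond /=.
  by under [X in (_ <= X + _)%R]eq_bigr do rewrite -leqNgt; rewrite lerDl.
- move=> h C; have [[d [k [kN hE]]]|nh] := pselect (exists d k, N k /\ h = zpow c d * k); last first.
    by exists [::] => v v' /shape.
  have [B hB] := conj_close_exists (zpow c d) C kN.
  (* One part for each segment: the empty last one leaves [h], segment 0 leaves a bounded power of
     [c], and segment 1 leaves [zpow c d] times a quotient in [N]. *)
  exists (h :: ([seq zpow c z | z <- int_range (2 * C + `|d|)] ++ [seq zpow c d * b | b <- B])).
  move=> v v' Eh; have := Eh; rewrite {1}hE => /(solve _ _ _ _ kN)[dE E].
  move=> T t k' u u' T0 tT k3 hu hu'.
  rewrite inE mem_cat.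
  have nn : (n < n.+1)%N by [].
  have segn : seg n = 0%N by rewrite /seg ltnn.
  have segi i : (i < n)%N -> seg i = 1%N by rewrite /seg => ->.
  case: k' k3 hu hu' => [|[|[|//]]] _ hu hu'.
  + apply/orP; right; apply/orP; left; rewrite !coord_prod_two.
    have z0 w w' : near_point seg n.+1 C T t 0 w w' -> zprod e n w' = 1.
      move=> hw; rewrite -[RHS](zprod_zero e n); apply: eq_zprod => // i ni.
      by have [_ + _] := hw i (ltnW ni); rewrite segi //; apply.
    rewrite (z0 _ _ hu) (z0 _ _ hu') !mulg1 -zpowN -zpowD addrC.
    apply: map_f; apply: mem_int_range.
    have [_ _] := hu n nn; have [_ _] := hu' n nn; rewrite segn => /(_ erefl) a1 /(_ erefl) a2.
    by have := near_bound T0 tT a2 a1 dE; lia.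
  + apply/orP; right; apply/orP; right; rewrite !coord_prod_two.
    have [] := hu n nn; rewrite segn => /(_ isT) -> _ _.
    have [] := hu' n nn; rewrite segn => /(_ isT) -> _ _.
    have -> : (zpow c (v n) * zprod e n u)^-1 * (zpow c (v' n) * zprod e n u') =
        zpow c d * ((zprod e n u ^ zpow c d)^-1 * zprod e n u').
      have := conjgC (zprod e n u)^-1 (zpow c d); rewrite conjVg.
      move: (zprod e n u ^ zpow c d)^-1 => w cw.
      rewrite [RHS]mulgA -cw -dE invgM zpowB -!mulgA; congr (_ * _).
      by rewrite !mulgA; congr (_ * _); exact: comc.
    apply: map_f; apply: (hB _ _ E T t) => // i ni.
      by have [_ _] := hu i (ltnW ni); rewrite segi //; apply.
    by have [_ _] := hu' i (ltnW ni); rewrite segi //; apply.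
  + have full w w' : near_point seg n.+1 C T t 2 w w' ->
        coord_prod e' seg n.+1 w' = coord_prod e' seg n.+1 w.
      move=> hw; rewrite !coord_prod_two; congr (zpow c _ * _).
        by have [] := hw n nn; rewrite segn => /(_ isT).
      by apply: eq_zprod => // i ni; have [] := hw i (ltnW ni); rewrite segi // => /(_ isT).
    by rewrite (full _ _ hu) (full _ _ hu') -Eh mulKg eqxx.
Qed.

End CentralFirst.

(** * Dependent commutators *)

Section DependentCase.
Local Open Scope group_scope.
Variable G : groupType.
Hypothesis central_commg : forall x y z : G, commute [~ x, y] z.
Variables a b c : G.
Let x := [~ a, b].
Let y := [~ a, c].
Let z := [~ b, c].
Hypothesis nf_all : forall g, exists i j l p q r, g = nf a b c i j l p q r.
Variables al be ga : int.
Hypothesis al0 : al <> 0%R.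
Hypothesis relation : zpow x al * zpow y be * zpow z ga = 1.

Let u := zpow a al * zpow c (- ga).
Let v := zpow b al * zpow c be.

(** By bilinearity [[~ u, v]] is the product of the powers [al * al], [be * al] and [ga * al] of
    [x], [y] and [z], that is, the [al]-th power of the relation. *)
Lemma commute_uv : commute u v.
Proof.
have cz (g h k : G) m : commute (zpow [~ g, h] m) k.
  exact/commute_sym/commute_zpow/commute_sym/central_commg.
apply/commgP/eqP; rewrite /u /v (commMg central_commg) !(commgM central_commg).
rewrite !(commZZ central_commg) commgg zpow1g mulg1 -/x -/y.
have -> : [~ c, b] = z^-1 by rewrite invgR.
rewrite zpowVg -zpowN.
have -> : (- (- ga * al) = ga * al)%R by ring.
rewrite !zpowA -(zpow1g G al) -relation.
rewrite zpowMg; last exact: (commute_sym (cz _ _ _ _)).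
rewrite zpowMg; last exact: cz.
by rewrite -!zpowA (mulrC be) .
Qed.

Section Modulo.
Variable N1 : set G.
Hypothesis sub1 : is_subgroup N1.
Hypothesis N1_central : forall h g, N1 h -> commute h g.
Hypothesis N1_comm : forall g h, N1 [~ g, h].

(** Equality in the quotient by [N1], abelian because [N1] contains all commutators; it spares the
    bookkeeping of commutators when powers of [a], [b], [c] are regrouped into powers of [u], [v],
    [c]. *)
Definition eqmod (g h : G) : Prop := N1 (g^-1 * h).

Lemma eqmod_refl g : eqmod g g.
Proof. by rewrite /eqmod mulVg; case: sub1. Qed.

Lemma eqmod_trans g h k : eqmod g h -> eqmod h k -> eqmod g k.
Proof.
by move=> gh hk; have := subM sub1 gh hk; rewrite /eqmod mulgA mulgK.
Qed.

Lemma eqmodM g g' h h' : eqmod g h -> eqmod g' h' -> eqmod (g * g') (h * h').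
Proof.
move=> gh gh'; have := subM sub1 gh gh'; rewrite /eqmod invgM.
have := N1_central g'^-1 gh; rewrite /commute => E.
by rewrite mulgA E -!mulgA.
Qed.

Lemma eqmodC g h : eqmod (g * h) (h * g).
Proof.
have -> : eqmod (g * h) (h * g) = N1 [~ h, g]; last exact: N1_comm.
by rewrite /eqmod invgM commgEl conjgE !mulgA.
Qed.

Lemma eqmod_zpow g h m : eqmod (zpow (g * h) m) (zpow g m * zpow h m).
Proof.
elim/int_rect: m => [|m IH|m IH].
- by rewrite !zpow0 mulg1; exact: eqmod_refl.
- have -> : (m.+1%:Z = m%:Z + 1)%R by lia.
  rewrite !zpowS; apply: eqmod_trans (eqmodM IH (eqmod_refl _)) _.
  rewrite -!mulgA; apply: eqmodM; first exact: eqmod_refl.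
  rewrite !mulgA; apply: eqmodM; last exact: eqmod_refl.
  exact: eqmodC.
- have -> : (- m.+1%:Z = - m%:Z - 1)%R by lia.
  rewrite !zpowP; apply: eqmod_trans (eqmodM IH (eqmod_refl _)) _.
  rewrite invgM -!mulgA; apply: eqmodM; first exact: eqmod_refl.
  rewrite mulgA; apply: eqmod_trans (eqmodC _ _) _.
  apply: eqmodM; [exact: eqmod_refl|].
  rewrite /eqmod; have -> : (zpow h (- m%:Z) / h)^-1 * (zpow h (- m%:Z) / h) = 1.
    exact: mulVg.
  by case: sub1.
Qed.

Lemma nf_eqmod i j l p q r p' q' r' :
  eqmod (nf a b c i j l p q r) (nf a b c i j l p' q' r').
Proof.
rewrite /nf; apply: eqmodM; first exact: eqmod_refl.
rewrite /eqmod; apply: (subM sub1).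
  by apply: (subV sub1); do ?[apply: (subM sub1)]; apply: (subZ sub1).
by do ?[apply: (subM sub1)]; apply: (subZ sub1).
Qed.

End Modulo.

Lemma dependent_coordinates :
  exists n e seg cen F, @coordinate_system G n e seg cen F.
Proof.
have [||N1 [e1 [n1 [M1 [F1 [[S1 _ _ _] [_ N1gs N1min]]]]]]] :=
    as_extend_seq (gs := [:: x; y; z]) (as_trivial G).
- by move=> g h _ ->; exact: commute1.
- move=> g h; rewrite !inE => /or3P[] /eqP-> _; exact: central_commg.
(* The centre contains [x], [y] and [z], hence [N1] by minimality. *)
have N1c h g : N1 h -> commute h g.
  have : N1 `<=` [set h | forall g, commute h g].
    apply: N1min.
    - split=> /=.
      + by move=> k; apply/commute_sym/commute1.
      + by move=> k l kc lc m; apply/commute_sym/commuteM; apply/commute_sym.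
      + by move=> k kc m; apply/commute_sym/commuteV/commute_sym/kc.
    - by move=> _ -> k; apply/commute_sym/commute1.
    - move=> k; rewrite !inE => /or3P[] /eqP-> l; exact: central_commg.
  by move=> /(_ h) + hN => /(_ hN).
have sN1 := as_sub S1.
have Nx : N1 x by apply: N1gs; rewrite !inE eqxx.
have Ny : N1 y by apply: N1gs; rewrite !inE eqxx orbT.
have Nz : N1 z by apply: N1gs; rewrite !inE eqxx !orbT.
have N1_comm g h : N1 [~ g, h].
  have gen k : N1 [~ a, k] -> N1 [~ b, k] -> N1 [~ c, k] -> forall g, N1 [~ g, k].
    move=> ka kb kc l; have [i [j [t [p [q [r ->]]]]]] := nf_all l.
    rewrite (nf_comm central_commg).
    by do ?[apply: (subM sN1)]; apply: (subZ sN1).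
  have swap k l : N1 [~ k, l] -> N1 [~ l, k].
    by move=> /(subV sN1); rewrite invgR.
  have N11 : N1 1 by exact: (sub1 sN1).
  have ha k : N1 [~ k, a].
    by apply: gen; [rewrite commgg|apply: swap|apply: swap].
  have hb k : N1 [~ k, b].
    by apply: gen; [|rewrite commgg|apply: swap].
  have hc k : N1 [~ k, c].
    by apply: gen; [| |rewrite commgg].
  by apply: gen; apply: swap.
have [||N [e [n [M [F [[S n1n e1e M1M] [N1N Ngs Nmin]]]]]]] :=
    as_extend_seq (gs := [:: u; v]) S1.
- by move=> g h _ /N1c hc; apply: commute_sym.
- move=> g h; rewrite !inE => /orP[]/eqP-> /orP[]/eqP->;
    do ?[exact: commute_refl]; [exact: commute_uv|exact/commute_sym/commute_uv].
have sN := as_sub S.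
have Nu : N u by apply: Ngs; rewrite !inE eqxx.
have Nv : N v by apply: Ngs; rewrite !inE eqxx orbT.
have cover0 g : exists i h f, [/\ N h,
    f \in [seq a ^+ s * b ^+ t | s <- iota 0 `|al|, t <- iota 0 `|al|] &
    g = zpow c i * h * f].
  have [i [j [l [p [q [r ->]]]]]] := nf_all g.
  have dec (m : int) : exists m1 (s : nat), (s < `|al|)%N /\ m = (al * m1 + s%:Z)%R.
    exists (m %/ al)%Z, (absz (m %% al)%Z).
    have al0' : al != 0%R by apply/eqP.
    have := modz_ge0 m al0'; have := ltz_mod m al0'; have := divz_eq m al.
    by move: (m %/ al)%Z (m %% al)%Z => d1 d2 -> ? ?; split; lia.
  have [i1 [s [sal ->]]] := dec i; have [j1 [t [tal ->]]] := dec j.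
  (* Modulo [N1], [zpow u i1] contributes [- ga * i1] to the exponent of [c], and [zpow v j1]
     contributes [be * j1]; [m] compensates for both. *)
  pose m := (l + ga * i1 - be * j1)%R.
  have E : eqmod N1 (zpow c m * (zpow u i1 * zpow v j1) * (a ^+ s * b ^+ t))
     (nf a b c (al * i1 + s%:Z) (al * j1 + t%:Z) l p q r).
    have Eu : eqmod N1 (zpow u i1) (nf a b c (al * i1) 0 (- ga * i1) 0 0 0).
      rewrite /nf !zpow0 !mulg1 !zpowA; exact: eqmod_zpow.
    have Ev : eqmod N1 (zpow v j1) (nf a b c 0 (al * j1) (be * j1) 0 0 0).
      rewrite /nf !zpow0 !mulg1 mul1g !zpowA; exact: eqmod_zpow.
    have -> : zpow c m = nf a b c 0 0 m 0 0 0 by rewrite /nf !zpow0 !mulg1 !mul1g.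
    have -> : a ^+ s * b ^+ t = nf a b c s%:Z t%:Z 0 0 0 0.
      by rewrite /nf !zpow0 !mulg1.
    apply: (eqmod_trans sN1).
      apply: (eqmodM sN1 N1c); last exact: (eqmod_refl sN1).
      apply: (eqmodM sN1 N1c); [exact: (eqmod_refl sN1)|exact: (eqmodM sN1 N1c Eu Ev)].
    rewrite !(nfM central_commg).
    have -> : (0 + (al * i1 + 0) + s%:Z = al * i1 + s%:Z)%R by ring.
    have -> : (0 + (0 + al * j1) + t%:Z = al * j1 + t%:Z)%R by ring.
    have -> : (m + (- ga * i1 + be * j1) + 0 = l)%R by rewrite /m; ring.
    exact: nf_eqmod.
  pose zeta := (zpow c m * (zpow u i1 * zpow v j1) * (a ^+ s * b ^+ t))^-1 *
     nf a b c (al * i1 + s%:Z) (al * j1 + t%:Z) l p q r.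
  exists m, (zpow u i1 * zpow v j1 * zeta), (a ^+ s * b ^+ t); split.
  - apply: (subM sN); last exact: N1N E.
    by apply: (subM sN); apply: (subZ sN).
  - by apply: allpairs_f; rewrite mem_iota add0n.
  - have zc f : zeta * f = f * zeta by exact: N1c.
    rewrite -[nf _ _ _ _ _ _ _ _ _](mulVKg
      (zpow c m * (zpow u i1 * zpow v j1) * (a ^+ s * b ^+ t))) -/zeta.
    by move: zeta zc => w zc; rewrite -!mulgA zc !mulgA.
have [[s s0 cs]|nfin] := pselect (exists2 s, (0 < s)%N & N (c ^+ s)).
  have [F' HF'] := coordinates_finite S1 S n1n e1e M1M N1N N1c N1_comm cover0 s0 cs.
  by exists n, e, (fun=> 0%N), (fun i => i < n1)%N, F'.
have [|F' HF'] := coordinates_infinite S1 S n1n e1e M1M N1N N1c N1_comm cover0.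
  move=> s Ns; have [|s0] := posnP (absz s); first by lia.
  case: nfin; exists (absz s) => //.
  rewrite zpowX; case: (ger0P s) => sp; first by rewrite gez0_abs.
  by rewrite abszE ltr0_norm // zpowN; exact: (subV sN).
by do 5 eexists; exact: HF'.
Qed.

End DependentCase.

(** * Choice between the two cases *)

Section Existence.
Local Open Scope group_scope.
Variable G : groupType.

Lemma generated_sub (S : set G) : S `<=` generated S.
Proof. by move=> s Ss M [_]; apply. Qed.

Lemma class2_central : nilpotent_of_class G 2 ->
  forall x y z : G, commute [~ x, y] z.
Proof.
move=> [L _] x y z; apply/commgP/eqP.
suff : @lower_central G 2 [~ [~ x, y], z] by rewrite L.
apply: generated_sub; exists [~ x, y], z; split=> //.
by apply: generated_sub; exists x, y.
Qed.

Lemma class2_nontrivial : nilpotent_of_class G 2 -> exists g : G, g != 1.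
Proof.
move=> [_ /(_ 0%N isT) H]; apply: contrapT => H'; apply: H.
apply/seteqP; split=> // g _ /=; apply/eqP/negPn/negP => g1.
by apply: H'; exists g.
Qed.

Lemma coordinates_exist (hclass : nilpotent_of_class G 2)
    (hgen : exists s : seq G,
      (size s = 2%N \/ size s = 3%N) /\ generates [set x | x \in s]) :
  exists n e seg cen F, @coordinate_system G n e seg cen F.
Proof.
have cc := class2_central hclass.
have [a [b [c [S [gS Ssub]]]]] : exists a b c, exists S : set G, generates S /\
    (forall s, S s -> s \in [:: a; b; c; 1]).
  have [s [ss gs]] := hgen; move: gs; case: ss.
    (* Two generators are completed by [c = 1]. Commutators with [c] are then trivial, so the
       dependent case applies. *)
    case: s => [|a [|b []]] //= _ gs; exists a, b, 1; exists [set x | x \in [:: a; b]].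
    by split=> // s /=; rewrite !inE => /orP[]->; rewrite ?orbT.
  case: s => [|a [|b [|c []]]] //= _ gs; exists a, b, c; exists [set x | x \in [:: a; b; c]].
  by split=> // s /=; rewrite !inE => /or3P[]->; rewrite ?orbT.
have all a' b' c' : {subset [:: a; b; c; 1] <= [:: a'; b'; c'; 1]} ->
    forall g, exists i j l p q r, g = nf a' b' c' i j l p q r.
  by move=> abc; apply: (nf_generated cc gS) => s /Ssub/abc.
have abc := all a b c (fun _ => id).
have acb : forall g, exists i j l p q r, g = nf a c b i j l p q r.
  by apply: all => s; rewrite !inE => /or4P[]->; rewrite ?orbT.
have bca : forall g, exists i j l p q r, g = nf b c a i j l p q r.
  by apply: all => s; rewrite !inE => /or4P[]->; rewrite ?orbT.
have [indep|/existsNP[p /existsNP[q /existsNP[r /not_implyP[E ne]]]]] := pselect (forall p q r,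
  zpow [~ a, b] p * zpow [~ a, c] q * zpow [~ b, c] r = 1 ->
    [/\ p = 0, q = 0 & r = 0]%R).
  by do 5 eexists; exact: (free_coordinate_system cc abc indep).
(* The dependent case wants a nonzero exponent on its first commutator; reordering the generators
   brings a nonzero one to the front. *)
have [p0|p0] := pselect (p = 0%R); last exact: (dependent_coordinates cc abc p0 E).
have [q0|q0] := pselect (q = 0%R); last first.
  apply: (dependent_coordinates cc acb (al := q) (be := p) (ga := (- r)%R) q0).
  by rewrite p0 !zpow0 mulg1 zpowN -zpowVg invgR -E p0 zpow0 mul1g.
have r0 : r <> 0%R by move=> r0; apply: ne; split.
apply: (dependent_coordinates cc bca (al := r) (be := 0%R) (ga := 0%R) r0).
by rewrite !zpow0 !mulg1 -E p0 q0 !zpow0 !mul1g.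
Qed.

End Existence.

(** * Real-time recognition *)

Section BlockCoding.
Variables (A Sg : finType) (T : rt_machine Sg) (B : nat).
Variable code : Sg -> seq A.
Hypothesis size_code : forall s, size (code s) = B.+1.
Hypothesis code_inj : injective code.

(** The state buffers an unfinished block while tapes and heads stand still; the simulated machine
    moves at the last letter of each block, so no time is lost. [None] is a rejecting sink, entered
    when a full block is not a code word. *)
Definition block_machine : rt_machine A :=
  @RTMachine A (option (rt_state T * {bseq B of A}))%type (rt_symbol T)
    (rt_tapes T) (Some (rt_start T, [bseq]))
    [set st : option (rt_state T * {bseq B of A}) |
       if st is Some (q, b) then (q \in rt_accepting T) && (b == [bseq]) else false]%SET
    (fun st x sc => if st is Some (q, b) then
       if (size b < B)%N then Some (q, insub_bseq B (rcons b x))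
       else if [pick s | code s == rcons b x] is Some s
         then Some (rt_next q s sc, [bseq]) else None
       else None)
    (fun st x sc i => if st is Some (q, b) then
       if (size b < B)%N then (sc i, Stay)
       else if [pick s | code s == rcons b x] is Some s
         then rt_act q s sc i else (sc i, Stay)
       else (sc i, Stay)).

Definition block_config (c : rt_config T) (b : {bseq B of A}) :
    rt_config block_machine :=
  @RTConfig _ block_machine (Some (cfg_state c, b)) (cfg_tape c) (cfg_head c).

Lemma block_step_short c (b : {bseq B of A}) x : (size b < B)%N ->
  rt_step (block_config c b) x = block_config c (insub_bseq B (rcons b x)).
Proof.
move=> bB; rewrite /rt_step /block_config /= bB; congr RTConfig.
- apply/funext => i; apply/funext => z; rewrite ffunE.
  by case: eqP => // ->.
- by apply/funext => i; rewrite /= addr0.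
Qed.

Lemma block_step_full c (b : {bseq B of A}) x s : size b = B ->
  code s = rcons b x ->
  rt_step (block_config c b) x = block_config (rt_step c s) [bseq].
Proof.
move=> bB cs; rewrite /rt_step /block_config /= bB ltnn.
by case: pickP => [s' /eqP|/(_ s)/eqP//]; rewrite -cs => /code_inj ->.
Qed.

Lemma val_insub_bseq (w : seq A) : (size w <= B)%N -> insub_bseq B w = w :> seq A.
Proof. by move=> wB; rewrite /insub_bseq /insubd insubT. Qed.

Lemma block_run_short c w : (size w <= B)%N ->
  foldl (@rt_step A block_machine) (block_config c [bseq]) w =
  block_config c (insub_bseq B w).
Proof.
elim/last_ind: w => [|w x IH] sB.
  by rewrite /=; congr block_config; apply/val_inj; rewrite /= val_insub_bseq.
rewrite size_rcons in sB; rewrite -cats1 foldl_cat /= IH ?(ltnW sB) //.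
rewrite block_step_short ?val_insub_bseq ?(ltnW sB) //.
by rewrite cats1.
Qed.

Lemma block_run_code c s :
  foldl (@rt_step A block_machine) (block_config c [bseq]) (code s) =
  block_config (rt_step c s) [bseq].
Proof.
case/lastP E : (code s) => [|w x].
  by have := size_code s; rewrite E.
have sw : size w = B by have := size_code s; rewrite E size_rcons => -[].
rewrite -cats1 foldl_cat block_run_short ?sw //=.
by rewrite (@block_step_full _ _ _ s) // val_insub_bseq ?sw.
Qed.

Lemma block_run c W :
  foldl (@rt_step A block_machine) (block_config c [bseq]) (flatten (map code W)) =
  block_config (foldl (@rt_step Sg T) c W) [bseq].
Proof. by elim: W c => //= s W IH c; rewrite foldl_cat block_run_code. Qed.

Lemma block_sound w :
  let c := foldl (@rt_step A block_machine) (rt_initial block_machine) w in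
  cfg_state c = None \/ exists W b, w = flatten (map code W) ++ val b /\
    c = block_config (foldl (@rt_step Sg T) (rt_initial T) W) b.
Proof.
elim/last_ind: w => [|w x IH] /=.
  by right; exists [::], [bseq]; split.
rewrite -cats1 foldl_cat /=; move: IH => /= [cN|[W [b [wE ->]]]].
  left; move: cN; set c := foldl _ _ _ => cN.
  by rewrite /rt_step /= cN.
have [bB|bB] := ltnP (size b) B.
  right; exists W, (insub_bseq B (rcons b x)); split.
    by rewrite val_insub_bseq ?size_rcons // wE -catA cats1.
  exact: block_step_short.
have {}bB : size b = B by apply/eqP; rewrite eqn_leq size_bseq.
have [[s cs]|nos] := pselect (exists s, code s = rcons b x).
  right; exists (rcons W s), [bseq]; split.
    by rewrite cats0 wE -catA cats1 -cs map_rcons flatten_rcons.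
  by rewrite (block_step_full _ bB cs) -(cats1 W) foldl_cat.
left; rewrite /rt_step /= bB ltnn; case: pickP => // s /eqP cs.
by case: nos; exists s.
Qed.

Lemma block_accepts w : rt_accepts block_machine w <->
  exists2 W, rt_accepts T W & w = flatten (map code W).
Proof.
have init : rt_initial block_machine = block_config (rt_initial T) [bseq] by [].
split=> [|[W TW ->]]; last first.
  by rewrite /rt_accepts init block_run /= inE TW eqxx.
rewrite /rt_accepts => acc; have := block_sound w => /= -[cN|[W [b [wE cE]]]].
  by move: acc; rewrite cN inE.
move: acc; rewrite cE /= inE => /andP[accW /eqP b0].
by exists W => //; rewrite wE b0 cats0.
Qed.

End BlockCoding.

(** * Heads bouncing between two ends *)

Section Zigzag.
Local Open Scope nat_scope.
Variable J : nat.
Hypothesis J0 : 0 < J.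

(** Position after [c] moves of a head bouncing between cells 0 and [J - 1]. A turn is a move on the
    spot, so each sweep consists of exactly [J] counts and the parity of [c %/ J] is its
    direction. *)
Definition zigzag (c : nat) : nat :=
  if odd (c %/ J) then J.-1 - c %% J else c %% J.

Lemma zigzag_lt c : zigzag c < J.
Proof.
rewrite /zigzag; have := ltn_pmod c J0; case: ifP => _ //.
by move=> _; rewrite -subn1; lia.
Qed.

Lemma zigzag_small c : c < J -> zigzag c = c.
Proof. by move=> cJ; rewrite /zigzag divn_small // modn_small. Qed.

Definition wraps (c : nat) : bool := c %% J == J.-1.

Lemma divmodS c : (c.+1 %/ J, c.+1 %% J) =
  if wraps c then ((c %/ J).+1, 0) else (c %/ J, (c %% J).+1).
Proof.
rewrite /wraps; have cJ := ltn_pmod c J0; case: eqP => E.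
  have -> : c.+1 = (c %/ J).+1 * J by rewrite {1}(divn_eq c J) E; lia.
  by rewrite mulnK // modnMl.
have -> : c.+1 = c %/ J * J + (c %% J).+1 by rewrite {1}(divn_eq c J); lia.
have rJ : (c %% J).+1 < J by lia.
by rewrite divnMDl // modnMDl (divn_small rJ) (modn_small rJ) addn0.
Qed.

Lemma divSE c : c.+1 %/ J = (c %/ J) + wraps c.
Proof. by have := divmodS c; case: ifP => _ [-> _]; rewrite ?addn1 ?addn0. Qed.

Lemma wrapsE c : wraps c = (J %| c.+1).
Proof. by rewrite /dvdn; have := divmodS c; case: ifP => _ [_ ->]. Qed.

Lemma zigzagS c : zigzag c.+1 = if wraps c then zigzag c
  else if odd (c %/ J) then (zigzag c).-1 else (zigzag c).+1.
Proof.
rewrite /zigzag; have := divmodS c; have cJ := ltn_pmod c J0.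
case: ifP => W [-> ->]; last by case: odd => //=; lia.
by move: W => /eqP ->; rewrite oddS subn0; case: odd => //=; lia.
Qed.

Lemma zigzag_end c : wraps c = if odd (c %/ J) then zigzag c == 0 else zigzag c == J.-1.
Proof.
rewrite /wraps /zigzag; have cJ := ltn_pmod c J0; case: odd => //.
by move: (c %% J) cJ => r rJ; apply/idP/idP => /eqP H; apply/eqP; lia.
Qed.

Lemma zigzag_pos c : ~~ wraps c -> odd (c %/ J) -> 0 < zigzag c.
Proof. by rewrite zigzag_end => + od; rewrite od lt0n. Qed.

End Zigzag.

(** * The machine and the words that it accepts *)

Section TraceMachine.
Variables (P S Fi : finType).
Local Notation D := {ffun P -> bool}.
Variable good : pred D.

(* There is one tape for each role, and all carry the same pattern.  At each
   letter the head [None] moves along, [Some None] moves at the ends of rows, and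
   [Some (Some p)] moves at the marks of [p] during phase 1.  That last head
   turns around whenever the number of marks of [p] passes a multiple of [J],
   which produces the digital line against which the pattern is checked. *)
Definition role := option (option P).
(* [(eor, x, x', s, ph)]: end of row, symbol under the head [None], symbol under
   the head [Some None] (meaningful only if [eor]), signs, phase.  Phase 0 only
   records the pattern; phase [k.+1] follows segment [k]. *)
Definition letter : finType := ((bool * D * D * S * 'I_4) + Fi)%type.
Definition cell : finType := (D * bool * bool)%type.
(* In a state [(k, row0, dirs, bits, so)], [dirs r] tells whether the head [r]
   moves to the right and [bits p] whether the head [Some (Some p)] has turned
   around in the current row; [so] holds the signs, once read. *)
Definition tstate : finType :=
  option ('I_6 * bool * {ffun role -> bool} * D * option S)%type.

Definition cell_data (o : option cell) : D :=
  if o is Some (x, _, _) then x else [ffun=> false].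
Definition cell_end (dir : bool) (o : option cell) : bool :=
  if o is Some (_, l, r) then (if dir then r else l) else false.

Definition drive (k : nat) (eor : bool) (x : D) (r : role) : bool :=
  match r with
  | None => true
  | Some None => eor
  | Some (Some p) => (k == 1%N) && x p
  end.

Notation scan := {ffun 'I_(#|{: role}|) -> option cell}.

(** Besides consistency with the tapes there is one arithmetic check, at the row ends of phase 1:
    the mark heads that turned during the row must be those whose pattern has a mark under the row
    head. A turn at the last letter of the row counts, hence [bits']. Phase 4 awaits the final
    letter; 5 is the accepting phase. *)
Definition run_next (k : 'I_6) (dirs : {ffun role -> bool}) (bits : D) (s : S)
    (a : letter) (sc : scan) : tstate :=
  match a with
  | inr _ => if k == 4%N :> nat then Some (inord 5, false, dirs, bits, Some s)
             else None
  | inl (eor, x, x', s', ph) =>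
    let wrap r := cell_end (dirs r) (sc (enum_rank r)) in
    let bits' := [ffun p => bits p ||
      (drive k eor x (Some (Some p)) && wrap (Some (Some p)))] in
    if [&& (k < 4)%N, ph == k :> nat, s' == s, x == cell_data (sc (enum_rank None)),
        eor == wrap None, eor ==> (x' == cell_data (sc (enum_rank (Some None))))
      & (eor && (k == 1%N :> nat)) ==> (bits' == x')]
    then Some (if eor && wrap (Some None) then inord k.+1 else k, false,
           [ffun r => dirs r (+) (drive k eor x r && wrap r)],
           (if eor then [ffun=> false] else bits'), Some s)
    else None
  end.

Definition run_act (k : 'I_6) (dirs : {ffun role -> bool}) (a : letter)
    (sc : scan) (i : 'I_(#|{: role}|)) : option cell * head_move :=
  if a is inl (eor, x, _, _, _) then
    (sc i, if drive k eor x (enum_val i) && ~~ cell_end (dirs (enum_val i)) (sc i)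
           then (if dirs (enum_val i) then MoveRight else MoveLeft) else Stay)
  else (sc i, Stay).

(** [so == None] singles out the first letter, and the first [eor] fixes [J]. If both fall on one
    letter, then [J = 1] and phase 0 is already over. A final letter alone is the word of the empty
    pattern. *)
Definition row0_next (so : option S) (a : letter) : tstate :=
  match a with
  | inr _ => if so == None then
      Some (inord 5, false, [ffun=> false], [ffun=> false], so) else None
  | inl (eor, x, x', s, ph) =>
    if [&& good x, ph == 0%N :> nat, (if so is Some t then s == t else true)
      & eor ==> (x' == x)]
    then Some (if eor && (so == None) then inord 1 else ord0, ~~ eor,
           [ffun r => (r == Some None) && (so == None)], [ffun=> false], Some s)
    else None
  end.

Definition row0_act (so : option S) (a : letter) (sc : scan)
    (i : 'I_(#|{: role}|)) : option cell * head_move :=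
  if a is inl (eor, x, _, _, _) then
    (Some (x, so == None, eor),
     if eor then (if (enum_val i == Some None) && (so != None) then MoveLeft
                  else Stay)
     else MoveRight)
  else (sc i, Stay).

Definition trace_machine : rt_machine letter :=
  @RTMachine letter tstate cell #|{: role}|
    (Some (ord0, true, [ffun=> false], [ffun=> false], None))
    [set st : tstate | if st is Some (k, _, _, _, _) then k == 5%N :> nat else false]%SET
    (fun st a sc => if st is Some (k, row0, dirs, bits, so) then
       if row0 then row0_next so a
       else if so is Some s then run_next k dirs bits s a sc else None
       else None)
    (fun st a sc i => if st is Some (k, row0, dirs, bits, so) then
       if row0 then row0_act so a sc i else run_act k dirs a sc i
       else (sc i, Stay)).

Local Notation tstep := (@rt_step letter trace_machine).
Definition taccepts (c : rt_config trace_machine) (w : seq letter) : bool := cfg_state (foldl tstep c w) \in rt_accepting trace_machine.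

Lemma dead_rejects (c : rt_config trace_machine) w : cfg_state c = None -> ~~ taccepts c w.
Proof.
elim: w c => [|a w IH] c cN; first by rewrite /taccepts /= cN inE.
by apply: (IH (tstep c a)); rewrite /rt_step /= cN.
Qed.

Lemma final_accepts (c : rt_config trace_machine) w : (exists dirs bits so,
    cfg_state c = Some (inord 5, false, dirs, bits, so)) ->
  taccepts c w = (w == [::]).
Proof.
move=> [dirs [bits [so cE]]]; case: w => [|a w].
  by rewrite /taccepts /= cE inE inordK.
apply/negbTE; apply: (dead_rejects (c := tstep c a)); rewrite /rt_step /= cE.
by case: so {cE} => // s; rewrite /run_next inordK; case: a => [[[[[]]]]|].
Qed.

Section Run.
Variables (ds : seq D) (s : S).
Let J := size ds.
Hypothesis J0 : (0 < J)%N.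
Let d0 : D := [ffun=> false].
Let d t := nth d0 ds t.
Let zz := zigzag J.

(** The offset [J] stands for the sweep that wrote the pattern, after which this head is at the
    right end, about to go back. *)
Definition mark_count (p : P) (t : nat) : nat :=
  (J + \sum_(i < t) ((i %/ (J * J) == 1) && d (zz i) p))%N.

Definition head_count (r : role) (t : nat) : nat :=
  match r with
  | None => t
  | Some None => (J + t %/ J)%N
  | Some (Some p) => mark_count p t
  end.

Definition bounced (p : P) (t : nat) : bool :=
  (mark_count p t %/ J != mark_count p (t %/ J * J) %/ J)%N.

Definition good_letter (t : nat) (a : letter) : bool :=
  if a is inl (eor, x, x', s', ph) then
    [&& ph == t %/ (J * J) :> nat, s' == s, x == d (zz t), eor == (J %| t.+1)
      & eor ==> (x' == d (zz (J + t %/ J)))]%N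
  else false.

(** In row [i] of phase 1 the mark count goes from [J + i * q] to [J + i.+1 * q], where [q] is the
    number of marks of the pattern. Whether it passes a multiple of [J] is digit [i] of the line of
    slope [q / J]. The checks thus force each pattern to be its own digital line, although the
    machine never knows [q]. *)
Definition row_check (t : nat) : bool :=
  ((J %| t.+1) && (t %/ (J * J) == 1))%N ==>
  [forall p, (mark_count p t.+1 %/ J != mark_count p (t %/ J * J) %/ J)%N
     == d (zz (J + t %/ J)) p].

Definition run_config (t : nat) (c : rt_config trace_machine) : Prop :=
  (exists k : 'I_6, k = (t %/ (J * J))%N :> nat /\
    cfg_state c = Some (k, false,
      [ffun r => ~~ odd (head_count r t %/ J)], [ffun p => bounced p t], Some s)) /\
  forall r, cfg_head c (enum_rank r) = (zz (head_count r t))%:Z /\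
    forall i, (i < J)%N -> cfg_tape c (enum_rank r) i%:Z =
      Some (d i, i == 0%N, i == J.-1).

Lemma head_countS k r t a eor x x' s' ph :
  a = inl (eor, x, x', s', ph) -> k = (t %/ (J * J))%N -> good_letter t a ->
  head_count r t.+1 = (head_count r t + drive k eor x r)%N.
Proof.
move=> -> -> /and5P[_ _ /eqP-> /eqP-> _]; case: r => [[p|]|] /=.
- by rewrite /mark_count big_ord_recr /= addnA.
- by rewrite divSE // wrapsE // addnA.
- by rewrite addn1.
Qed.

Lemma mark_count_mono p t t' : (t <= t')%N -> (mark_count p t <= mark_count p t')%N.
Proof.
move=> /subnK <-; elim: (t' - t)%N => // k IH; rewrite addSn.
by apply: (leq_trans IH); rewrite /mark_count big_ord_recr /= addnA leq_addr.
Qed.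

(** The row head moves once per row and so turns once in [J] rows: its turn at a row end signals the
    end of a phase. *)
Lemma phaseS t : (t.+1 %/ (J * J) = (t %/ (J * J)) +
  ((J %| t.+1) && wraps J (J + t %/ J)))%N.
Proof.
rewrite divSE ?muln_gt0 ?J0 //; congr (_ + nat_of_bool _)%N.
rewrite !wrapsE ?muln_gt0 ?J0 //.
apply/idP/andP => [H|[/dvdnP[q Hq]]].
  have Jt : (J %| t.+1)%N by apply: dvdn_trans H; exact: dvdn_mulr.
  split=> //; move: H; have /dvdnP[q Hq] := Jt.
  have qt : (t %/ J).+1 = q.
    have := divSE J0 t; rewrite wrapsE // Jt Hq mulnK // => ->; rewrite addn1 //.
  by rewrite -addnS dvdn_addr // qt Hq dvdn_pmul2r.
have qt : (t %/ J).+1 = q.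
  have := divSE J0 t; rewrite wrapsE // Hq dvdn_mull // mulnK // => ->.
  by rewrite addn1.
by rewrite -addnS dvdn_addr // qt Hq dvdn_pmul2r.
Qed.

Lemma bounced_step p t (b : bool) : mark_count p t.+1 = (mark_count p t + b)%N ->
  (mark_count p t.+1 %/ J != mark_count p (t %/ J * J) %/ J)%N =
  bounced p t || (b && wraps J (mark_count p t)).
Proof.
rewrite /bounced => ->; case: b; rewrite /= ?addn0 ?orbF // addn1 divSE //.
case: wraps; rewrite ?addn0 ?orbF // orbT addn1.
by rewrite gtn_eqF // ltnS leq_div2r // mark_count_mono // leq_divM.
Qed.

Lemma run_step c t a : run_config t c -> (t < 4 * (J * J))%N ->
  if good_letter t a && row_check t then run_config t.+1 (tstep c a)
  else cfg_state (tstep c a) = None.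
Proof.
move=> [[k [kt cE]] tapes] t4.
set sc := [ffun i => cfg_tape c i (cfg_head c i)].
have scE r : sc (enum_rank r) = Some (d (zz (head_count r t)),
    zz (head_count r t) == 0%N, zz (head_count r t) == J.-1).
  by rewrite ffunE; have [-> /(_ _ (zigzag_lt J0 _)) ->] := tapes r.
have JJ0 : (0 < J * J)%N by rewrite muln_gt0 J0.
have k4 : (k < 4)%N by rewrite kt ltn_divLR // mulnC.
pose dirs := [ffun r => ~~ odd (head_count r t %/ J)].
have wrapE r : cell_end (dirs r) (sc (enum_rank r)) = wraps J (head_count r t).
  by rewrite scE /dirs ffunE /= zigzag_end //; case: odd.
have stE : cfg_state (tstep c a) = run_next k dirs [ffun p => bounced p t] s a sc.
  by rewrite /rt_step /= cE.
have hdE i : cfg_head (tstep c a) i =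
    cfg_head c i + displacement (run_act k dirs a sc i).2.
  by rewrite /rt_step /= cE.
have tpE i z : cfg_tape (tstep c a) i z =
    if z == cfg_head c i then (run_act k dirs a sc i).1 else cfg_tape c i z.
  by rewrite /rt_step /= cE.
have dirsE r : dirs r = ~~ odd (head_count r t %/ J) by rewrite ffunE.
pose bits := [ffun p => bounced p t].
have bitsE p : bits p = bounced p t by rewrite ffunE.
rewrite -/bits in stE; clearbody sc dirs bits; clear cE.
case: a stE hdE tpE => [[[[[eor x] x'] s'] ph]|f] stE hdE tpE; last first.
  by rewrite stE /= ltn_eqF.
have checkE : good_letter t (inl (eor, x, x', s', ph)) && row_check t =
   [&& (k < 4)%N, ph == k :> nat, s' == s, x == cell_data (sc (enum_rank None)),
        eor == cell_end (dirs None) (sc (enum_rank None)),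
        eor ==> (x' == cell_data (sc (enum_rank (Some None))))
      & (eor && (k == 1%N :> nat)) ==> ([ffun p => bits p ||
      (drive k eor x (Some (Some p)) && cell_end (dirs (Some (Some p))) (sc (enum_rank (Some (Some p)))))] == x')].
  rewrite k4 !wrapE !scE /= -kt wrapsE //.
  case: (ph =P k :> nat) => //= _; case: (s' =P s) => //= _.
  case: (x =P _) => //= xE; case: (eor =P _) => //= eorE.
  case: eor {stE hdE tpE} eorE => //= eorE; last by rewrite /row_check -eorE.
  case: (x' =P _) => //= x'E.
  rewrite /row_check -eorE -kt /=; case: (k =P 1%N :> nat) => //= k1.
  have mcS p : mark_count p t.+1 = (mark_count p t + x p)%N.
    by rewrite /mark_count big_ord_recr /= addnA -kt k1 eqxx xE.
  have bE p := bounced_step (mcS p).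
  apply/forallP/eqP => [H|H p].
    apply/ffunP => p; rewrite ffunE bitsE wrapE /= ?k1 ?eqxx /= -bE x'E.
    exact: (eqP (H p)).
  have := congr1 (fun g : D => g p) H; rewrite ffunE bitsE wrapE /= ?k1 ?eqxx /= -bE x'E.
  by move=> ->.
rewrite checkE; case: ifP => chk; last by rewrite stE /= chk.
have : good_letter t (inl (eor, x, x', s', ph)) by move: checkE; rewrite chk => /andP[].
move=> gl; have hS r := head_countS r erefl kt gl.
have /and5P[_ _ /eqP xE /eqP eorE _] := gl.
split.
  exists (if eor && wraps J (J + t %/ J)%N then inord k.+1 else k); split.
    rewrite phaseS -eorE -kt; case: ifP => _; last by rewrite addn0.
    by rewrite inordK ?addn1 // ltnS (leq_trans k4).
  rewrite stE /= chk wrapE /=; congr (Some (_, _, _, _, _)).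
    apply/ffunP => r; rewrite !ffunE wrapE dirsE hS.
    case: drive => /=; rewrite ?addn0 ?addbF // addn1 divSE //.
    by rewrite oddD; case: odd; case: wraps.
  case: eor eorE {chk checkE stE hdE tpE gl hS} => eorE.
    apply/ffunP => p; rewrite !ffunE /bounced.
    by rewrite divnK ?eqxx // -eorE.
  apply/ffunP => p; rewrite !ffunE bitsE wrapE /=.
  have mcS : mark_count p t.+1 = (mark_count p t + ((k == 1%N :> nat) && x p))%N.
    by rewrite /mark_count big_ord_recr /= addnA -kt xE.
  rewrite -(bounced_step mcS) /bounced; congr (_ != _ %/ _)%N.
  by congr mark_count; rewrite divSE // wrapsE // -eorE addn0.
move=> r; have [hr tr] := tapes r; split.
  rewrite hdE /= enum_rankK wrapE hr hS.
  have := zigzagS J0 (head_count r t); have := @zigzag_pos _ J0 (head_count r t).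
  rewrite dirsE /zz; case: drive; rewrite /= ?addn0 ?addr0 // addn1.
  move=> + ->; case: wraps; rewrite ?addr0 //= => /(_ isT).
  by case: odd => /= H; [rewrite -subn1 -subzn ?H|rewrite -addn1 PoszD].
move=> j jJ; rewrite tpE /= hr scE; case: eqP => [[->]|_]; last exact: tr.
by [].
Qed.

Definition trace_suffix (t : nat) (w : seq letter) : Prop :=
  let N := (4 * (J * J))%N in
  exists f : Fi, [/\ size w = (N - t).+1,
    (forall j, (j < N - t)%N ->
       good_letter (t + j) (nth (inr f) w j) && row_check (t + j))
    & nth (inr f) w (N - t) = inr f].

Lemma trace_suffix_cons t a w : (t < 4 * (J * J))%N ->
  trace_suffix t (a :: w) <->
  good_letter t a && row_check t /\ trace_suffix t.+1 w.
Proof.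
move=> t4; rewrite /trace_suffix.
have sub : (4 * (J * J) - t = (4 * (J * J) - t.+1).+1)%N by rewrite subnSK.
split=> [[f [sw lw ew]]|[chk [f [sw lw ew]]]].
  split; first by have := lw 0%N; rewrite addn0 sub; apply.
  exists f; split.
  - by move: sw; rewrite /= sub => -[].
  - by move=> j jN; have := lw j.+1; rewrite sub ltnS addnS -addSn; apply.
  - by move: ew; rewrite sub.
exists f; split.
- by rewrite /= sw sub.
- by move=> [|j]; rewrite ?addn0 // sub ltnS addnS -addSn => /lw.
- by rewrite sub.
Qed.

Lemma run_accepts t c w : run_config t c -> (t <= 4 * (J * J))%N ->
  taccepts c w <-> trace_suffix t w.
Proof.
elim: w t c => [|a w IH] t c R.
  have [[k [kt cE]] _] := R => t4; split; last by case=> f [].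
  rewrite /taccepts /= cE inE kt => /eqP k5.
  have JJ0 : (0 < J * J)%N by rewrite muln_gt0 J0.
  move: t4; rewrite leq_eqVlt => /orP[/eqP tE|].
    by move: k5; rewrite tE mulnK.
  by rewrite -ltn_divLR // k5.
rewrite leq_eqVlt => /orP[/eqP t4|t4].
  have JJ0 : (0 < J * J)%N by rewrite muln_gt0 J0.
  have [[k [kt cE]] _] := R; rewrite /trace_suffix -t4 subnn.
  have k4 : k = 4%N :> nat by rewrite kt t4 mulnK.
  have step : cfg_state (tstep c a) = run_next k
      [ffun r => ~~ odd (head_count r t %/ J)] [ffun p => bounced p t] s a
      [ffun i => cfg_tape c i (cfg_head c i)] by rewrite /rt_step /= cE.
  rewrite -[taccepts c _]/(taccepts (tstep c a) w).
  case: a step => [[[[[eor x] x'] s'] ph]|f] step.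
    split; last by case=> f [_ _].
    have dead : cfg_state (tstep c (inl (eor, x, x', s', ph))) = None.
      by rewrite step /= k4.
    by move=> acc; case/negP: (dead_rejects w dead).
  rewrite final_accepts; last first.
    by do 3 eexists; rewrite step /= k4.
  split=> [/eqP->|]; first by exists f; split.
  by case=> f' [] [] /size0nil ->.
have := run_step a R t4; rewrite -[taccepts c _]/(taccepts (tstep c a) w).
rewrite trace_suffix_cons //; case: ifP => chk R'.
  by rewrite (IH _ _ R' t4); split=> [|[]].
by split=> [acc|[]//]; case/negP: (dead_rejects w R').
Qed.

(** In the first row time [t] is cell [t], so a correct letter merely announces the next cell. At
    the end of this row the row head is at the same cell, whence [x' == x]. *)
Lemma first_row_letter t eor x x' s' ph : (t < J)%N ->
  good_letter t (inl (eor, x, x', s', ph)) && row_check t =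
  [&& ph == 0%N :> nat, s' == s, x == d t, eor == (t.+1 == J)
    & eor ==> (x' == x)]%N.
Proof.
move=> tJ; have JJ : (J <= J * J)%N by rewrite leq_pmulr.
rewrite /row_check /good_letter (divn_small (leq_trans tJ JJ)) /= andbF /= andbT.
rewrite /zz zigzag_small // (divn_small tJ) addn0.
have -> : (J %| t.+1)%N = (t.+1 == J).
  apply/idP/eqP => [/(dvdn_leq (ltn0Sn t))|->//]; lia.
case: (ph =P 0%N :> nat) => //= _; case: (s' =P s) => //= _.
case: (x =P d t) => //= ->; case: (eor =P _) => //= -> /=.
case: eqP => //= tE; rewrite /zigzag divnn J0 modnn subn0.
by rewrite -tE.
Qed.

End Run.
Definition row0_config (ds : seq D) (so : option S)
    (c : rt_config trace_machine) : Prop :=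
  (exists dirs bits, cfg_state c = Some (ord0, true, dirs, bits, so)) /\
  (so == None) = (ds == [::]) /\
  forall i, cfg_head c i = (size ds)%:Z /\
    forall j, (j < size ds)%N -> cfg_tape c i j%:Z =
      Some (nth [ffun=> false] ds j, j == 0%N, false).

Lemma row0_step ds so c c' eor x x' s ph : row0_config ds so c ->
  c' = tstep c (inl (eor, x, x', s, ph)) ->
  if [&& good x, ph == 0%N :> nat, (if so is Some t then s == t else true)
      & eor ==> (x' == x)]
  then if eor then run_config (rcons ds x) s (size ds).+1 c'
       else row0_config (rcons ds x) (Some s) c'
  else cfg_state c' = None.
Proof.
move=> [[dirs [bits cE]] [soE tapes]] c'E.
have stE : cfg_state c' = row0_next so (inl (eor, x, x', s, ph)).
  by rewrite c'E /rt_step /= cE.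
have hdE i : cfg_head c' i = (size ds)%:Z + displacement
    (row0_act so (inl (eor, x, x', s, ph))
      [ffun i => cfg_tape c i (cfg_head c i)] i).2.
  by rewrite c'E /rt_step /= cE; have [-> _] := tapes i.
have tpE i z : cfg_tape c' i z =
    if z == (size ds)%:Z then Some (x, so == None, eor) else cfg_tape c i z.
  by rewrite c'E /rt_step /= cE; have [-> _] := tapes i.
clear c'E; case: ifP => chk; last by rewrite stE /= chk.
case: eor chk stE hdE tpE => chk stE hdE tpE; last first.
  split; [by rewrite stE /= chk; do 2 eexists|split].
    by case: ds {tapes hdE tpE soE}.
  move=> i; rewrite hdE /= size_rcons; split; first by rewrite -addn1 PoszD.
  move=> j; rewrite ltnS leq_eqVlt tpE => /orP[/eqP->|jd].
    by rewrite eqxx nth_rcons ltnn eqxx soE size_eq0.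
  rewrite eqz_nat (ltn_eqF jd) nth_rcons jd.
  by have [_ ->] := tapes i.
have J0 : (0 < size (rcons ds x))%N by rewrite size_rcons.
have sE : (so == None) = (size ds == 0%N) by rewrite soE size_eq0.
have mE p : mark_count (rcons ds x) p (size ds).+1 = (size ds).+1.
  rewrite /mark_count size_rcons big1 ?addn0 // => i _.
  by rewrite divn_small //; apply: (leq_trans (ltn_ord i)); rewrite leq_pmulr.
have cnt r : head_count (rcons ds x) r (size ds).+1 =
    ((size ds).+1 + (r == Some None))%N.
  case: r => [[p|]|] /=; rewrite ?mE ?addn0 //.
  by rewrite size_rcons divnn.
have divE r : (((size ds).+1 + (r == Some None)) %/ (size ds).+1 =
    1 + ((r == Some None) && (size ds == 0)))%N.
  case: (r == _); last by rewrite addn0 divnn.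
  case: (size ds) => [|n] //=; rewrite divnDl // divnn //= divn_small //.
split.
  exists (if so == None then inord 1 else ord0 : 'I_6); split.
    rewrite size_rcons sE; case: (size ds) => [|n]; first by rewrite inordK.
    by rewrite divn_small // ltn_Pmulr.
  rewrite stE /= chk; congr (Some (_, _, _, _, _)).
    by apply/ffunP => r; rewrite !ffunE cnt size_rcons divE sE; do 2 case: eqP.
  apply/ffunP => p; rewrite !ffunE /bounced size_rcons divnn mul1n.
  by rewrite eqxx.
move=> r; split.
  rewrite hdE /= enum_rankK cnt /zigzag size_rcons divE sE.
  case: (r == _) => /=; last by rewrite addn0 modnn subn0 addr0.
  case: (size ds) => [|n] //=; rewrite modnDl modn_small //.
move=> j; rewrite size_rcons ltnS leq_eqVlt tpE => /orP[/eqP->|jd].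
  by rewrite nth_rcons ltnn sE /= !eqxx.
rewrite eqz_nat (ltn_eqF jd) nth_rcons jd.
by have [_ ->] := tapes (enum_rank r).
Qed.

(** [ds] is the part of the pattern already written and [es] its unread completion, whose length the
    machine cannot foresee; acceptance is therefore the existence of a completion. *)
Lemma row0_accepts ds so c w : row0_config ds so c ->
  taccepts c w <-> (ds = [::] /\ exists f, w = [:: inr f]) \/
    exists es s, [/\ es != [::], all good es, so = None \/ so = Some s &
      trace_suffix (ds ++ es) s (size ds) w].
Proof.
elim: w ds so c => [|a w IH] ds so c R.
  have [[dirs [bits cE]] _] := R.
  rewrite /taccepts /= cE inE; split=> // -[[_ [f //]]|[es [s [_ _ _]]]].
  by case=> f [].
have [[dirs [bits cE]] [soE _]] := R.
rewrite -[taccepts c _]/(taccepts (tstep c a) w).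
have J0 es : es != [::] -> (0 < size (ds ++ es))%N.
  by rewrite size_cat; case: es => //= x es _; rewrite addnS.
have tJ es : es != [::] -> (size ds < size (ds ++ es))%N.
  by rewrite size_cat; case: es => //= x es _; rewrite addnS ltnS leq_addr.
have t4 es : es != [::] -> (size ds < 4 * (size (ds ++ es) * size (ds ++ es)))%N.
  move=> es0; apply: (leq_trans (tJ es es0)).
  by rewrite (leq_trans (leq_pmulr _ (J0 es es0))) // leq_pmull.
case: a => [[[[[eor x] x'] s] ph]|f]; last first.
  have stE : cfg_state (tstep c (inr f)) = row0_next so (inr f).
    by rewrite /rt_step /= cE.
  split=> [acc|[[ds0 [f' []]]|[es [s [es0 _ _]]]]].
  - left; case: (ds =P [::]) soE => [ds0|_] soE; last first.
      have dead : cfg_state (tstep c (inr f)) = None.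
        by rewrite stE /= soE.
      by case/negP: (dead_rejects w dead).
    split=> //; exists f; move: acc; rewrite final_accepts => [/eqP->//|].
    by do 3 eexists; rewrite stE /= soE.
  - move=> -> ->; rewrite final_accepts //.
    by do 3 eexists; rewrite stE /= soE ds0.
  - by rewrite (trace_suffix_cons _ _ _) ?t4 //; case.
set c' := tstep c _; have := row0_step R (erefl c').
set chk := [&& _, _, _ & _].
have suffixE es s' : es != [::] ->
    trace_suffix (ds ++ es) s' (size ds) (inl (eor, x, x', s, ph) :: w) <->
    [&& ph == 0%N :> nat, s == s', x == nth [ffun=> false] (ds ++ es) (size ds),
      eor == ((size ds).+1 == size (ds ++ es)) & eor ==> (x' == x)] /\
    trace_suffix (ds ++ es) s' (size ds).+1 w.
  move=> es0; rewrite (trace_suffix_cons _ _ _) ?t4 //.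
  by rewrite (first_row_letter _ (J0 _ es0)) ?tJ.
case: (boolP chk) => [chkT|chkF] c'E; last first.
  split=> [acc|[[_ [f]]//|[es [s' [es0 ges so' /suffixE]]]]].
    by case/negP: (dead_rejects w c'E).
  move=> /(_ es0)[/and5P[ph0 /eqP ss /eqP xE _ x'E] _].
  case/negP: chkF; rewrite /chk ph0 x'E /= andbT; apply/andP; split.
    rewrite xE nth_cat ltnn subnn; case: es es0 ges {xE} => //= e es _.
    by case/andP.
  by case: so' => -> //=; rewrite ss.
have /and4P[gx ph0 so_s x'x] := chkT.
have so'E : so = None \/ so = Some s.
  by case: so so_s {R soE cE chk chkT} => [t /eqP->|]; [right|left].
clearbody c'; case: eor suffixE {chk chkT} x'x c'E => suffixE x'x c'E.
  have sJ : (0 < size (rcons ds x))%N by rewrite size_rcons.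
  rewrite (run_accepts sJ w c'E); last first.
    have := t4 [:: x] isT; rewrite cats1 size_rcons; exact: leq_trans.
  split=> [tr|[[_ [f]]//|[es [s' [es0 ges so' /suffixE]]]]].
    right; exists [:: x], s; split=> //=; first by rewrite gx.
    rewrite suffixE // cats1 size_rcons ph0 eqxx nth_rcons ltnn eqxx /= eqxx.
    by rewrite eqxx.
  move=> /(_ es0)[/and5P[_ /eqP ss /eqP xE /eqP/esym/eqP szE _] tr].
  have {szE} es1 : size es = 1%N by move: szE; rewrite size_cat -addn1 => /addnI.
  case: es es1 xE tr {es0 ges} => // e [] //= _; rewrite nth_cat ltnn subnn /= => ->.
  by rewrite cats1 ss.
rewrite (IH _ _ _ c'E).
split=> [[[]|[es [s' [es0 ges so' tr]]]]|[[_ [f]]//|[es [s' [es0 ges so' /suffixE]]]]].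
- by case: ds {R soE J0 tJ t4 suffixE c'E IH}.
- have ss : s' = s by case: so' => // -[].
  right; exists (x :: es), s'; split=> //=; [by rewrite gx|by rewrite ss|].
  rewrite suffixE // ph0 ss eqxx nth_cat ltnn subnn /= eqxx /=.
  have -> : ((size ds).+1 == size (ds ++ x :: es)) = false.
    rewrite size_cat /= addnS eqSS -{1}(addn0 (size ds)) eqn_add2l eq_sym.
    by rewrite size_eq0 (negbTE es0).
  by move: tr; rewrite cat_rcons size_rcons ss; split.
- move=> /(_ es0)[/and5P[_ /eqP ss /eqP xE /eqP szE _] tr].
  right; case: es es0 ges xE szE tr => // e es _ /= /andP[_ ges].
  rewrite nth_cat ltnn subnn /= => xE szE tr; exists es, s; split=> //.
  + by apply/eqP => es0; move: szE; rewrite es0 size_cat addn1 eqxx.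
  + by right.
  + by rewrite cat_rcons size_rcons xE ss.
Qed.

(** With the empty pattern no letter carries signs, and [s0] takes their place. *)
Lemma trace_accepts (s0 : S) w : rt_accepts trace_machine w <->
  exists ds s, all good ds /\ trace_suffix ds s 0 w.
Proof.
have R : row0_config [::] None (rt_initial trace_machine).
  by split; [do 2 eexists|split].
rewrite /rt_accepts -/(taccepts _ w) (row0_accepts _ R).
split=> [[[_ [f ->]]|[es [s [es0 ges _ tr]]]]|[es [s [ges tr]]]].
- by exists [::], s0; split=> //; exists f.
- by exists es, s.
- case: (es =P [::]) => [es0|/eqP es0]; last by right; exists es, s; split=> //; left.
  left; split=> //; move: tr; rewrite es0 => -[f [sz _ ew]].
  by exists f; case: w sz ew => // a [] //= _ ->.
Qed.

End TraceMachine.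

(** * Geometry of the accepted words *)

Section StraightPatterns.
Local Open Scope nat_scope.
Variable J : nat.
Hypothesis J0 : 0 < J.

(* The [J]-periodic pattern of the marks of a digital line of slope [q / J]. *)
Definition line_mark (q i : nat) : bool := i.+1 * q %/ J != i * q %/ J.

Lemma line_mark_step q i : q <= J -> i.+1 * q %/ J = i * q %/ J + line_mark q i.
Proof.
move=> qJ; rewrite /line_mark.
have le1 : i * q %/ J <= i.+1 * q %/ J by rewrite leq_div2r // leq_mul2r leqnSn orbT.
have le2 : i.+1 * q %/ J <= i * q %/ J + 1.
  have -> : i * q %/ J + 1 = (i * q + J) %/ J by rewrite divnDr ?divnn ?J0.
  by rewrite leq_div2r // mulSn addnC leq_add2l.
by case: eqP => ?; lia.
Qed.

Lemma line_mark_sum q i : q <= J -> \sum_(s < i) line_mark q s = i * q %/ J.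
Proof.
move=> qJ; elim: i => [|i IH]; first by rewrite big_ord0 div0n.
by rewrite big_ord_recr /= IH line_mark_step.
Qed.

Variable f : nat -> bool.
Let q := \sum_(s < J) f s.
Let zz := zigzag J.

(** A backward sweep starts at the right end of the pattern, so its partial sums are the total minus
    a prefix. *)
Lemma zigzag_row_sum a s : s <= J ->
  \sum_(j < s) f (zz (a * J + j)) =
  if odd a then q - \sum_(j < J - s) f j else \sum_(j < s) f j.
Proof.
move=> sJ.
have zE (j : 'I_s) : zz (a * J + j) = if odd a then J.-1 - j else j.
  have jJ : j < J := leq_trans (ltn_ord j) sJ.
  by rewrite /zz /zigzag divnMDl // modnMDl (divn_small jJ) addn0 (modn_small jJ).
rewrite (eq_bigr (fun j : 'I_s => nat_of_bool (f (if odd a then J.-1 - j else j))));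
  last by move=> j _; rewrite zE.
case: odd => //.
rewrite /q -(big_mkord xpredT (fun j => nat_of_bool (f j))).
rewrite (@big_cat_nat _ _ _ (J - s)) ?leq_subr //= big_mkord addKn.
rewrite -{1}(add0n (J - s)) big_addn subKn // big_mkord (reindex_inj rev_ord_inj) /=.
apply: eq_bigr => j _; congr (nat_of_bool (f _)).
have := ltn_ord j; lia.
Qed.

Lemma zigzag_full_row a : \sum_(j < J) f (zz (a * J + j)) = q.
Proof. by rewrite zigzag_row_sum // subnn big_ord0 subn0; case: ifP. Qed.

Lemma zigzag_sum a p s : \sum_(j < p * J + s) f (zz (a * J + j)) =
  p * q + \sum_(j < s) f (zz ((a + p) * J + j)).
Proof.
elim: p a => [|p IH] a; first by rewrite mul0n addn0.
have -> : p.+1 * J + s = J + (p * J + s) by rewrite mulSn addnA.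
rewrite big_split_ord /= zigzag_full_row mulSn -addnA; congr (_ + _).
rewrite addnS -addSn -IH; apply: eq_bigr => j _; congr (nat_of_bool (f (zz _))).
by rewrite mulSn addnA [J + _]addnC.
Qed.

Hypothesis straight : forall i, i < J -> f i = line_mark q i.

Lemma count_leq : q <= J.
Proof.
apply: (@leq_trans (\sum_(s < J) 1)); last by rewrite sum1_card card_ord.
by apply: leq_sum => i _; exact: leq_b1.
Qed.

Lemma straight_prefix i : i <= J -> \sum_(s < i) f s = i * q %/ J.
Proof.
move=> iJ; rewrite -line_mark_sum ?count_leq //; apply: eq_bigr => s _.
by rewrite straight // (leq_trans (ltn_ord s)).
Qed.

(** Complete rows contribute exactly [q]. In a row of which [s] cells are done, the count is
    [s * q / J] rounded down in a forward sweep and rounded up in a backward one, so the error is at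
    most one in either direction. *)
Lemma zigzag_linear a m :
  (`|J%:Z * (\sum_(j < m) f (zz (a * J + j)))%N%:Z - m%:Z * q%:Z| <= J%:Z)%R.
Proof.
have mJ := divn_eq m J; have sJ := ltn_pmod m J0.
rewrite mJ zigzag_sum zigzag_row_sum ?(ltnW sJ) //.
rewrite !straight_prefix ?leq_subr ?(ltnW sJ) //.
move: (m %/ J) (m %% J) sJ => p s sJ.
have H1 := divn_eq (s * q) J; have H2 := ltn_pmod (s * q) J0.
have H3 := divn_eq ((J - s) * q) J; have H4 := ltn_pmod ((J - s) * q) J0.
have H5 : (J - s) * q = J * q - s * q by rewrite mulnBl.
have H6 : s * q <= J * q by rewrite leq_mul2r ltnW ?orbT.
have H7 : (J - s) * q %/ J <= q.
  by rewrite -[leqRHS](mulKn q J0) leq_div2r // leq_mul2r leq_subr orbT.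
case: ifP => _.
  move: ((J - s) * q %/ J) (((J - s) * q) %% J) H3 H4 H7 => x y H3 H4 H7.
  nia.
move: (s * q %/ J) (s * q %% J) H1 H2 => x y H1 H2; nia.
Qed.

End StraightPatterns.

(** * Accepted patterns are digital lines *)

Section MarkCounts.
Variables (P : finType).
Local Notation D := {ffun P -> bool}.
Variable ds : seq D.
Let J := size ds.
Hypothesis J0 : (0 < J)%N.
Let d t : D := nth [ffun=> false] ds t.
Let zz := zigzag J.

Definition marks_total (p : P) : nat := (\sum_(i < J) d i p)%N.

Lemma divJ x : ((J + x) %/ J = (x %/ J).+1)%N.
Proof. by rewrite divnDl ?dvdnn // divnn J0. Qed.

Lemma mark_count_row p i : (i <= J)%N ->
  mark_count ds p ((J + i) * J) = (J + i * marks_total p)%N.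
Proof.
move=> iJ; rewrite /mark_count -/J; congr (_ + _)%N.
rewrite mulnDl big_split_ord /= big1 ?add0n; last first.
  by move=> j _; rewrite divn_small.
rewrite (eq_bigr (fun j : 'I_(i * J) => nat_of_bool (d (zz (J * J + j)) p))).
  have := zigzag_sum J0 (fun j => d j p) J i 0.
  by rewrite addn0 big_ord0 addn0.
move=> j _; have jJ : (j < J * J)%N.
  by apply: (leq_trans (ltn_ord j)); rewrite leq_mul2r iJ orbT.
by rewrite divnDl // divnn muln_gt0 J0 divn_small.
Qed.

Lemma row_check_straight : (forall t, (t < 4 * (J * J))%N -> row_check ds t) <->
  forall p i, (i < J)%N -> d i p = line_mark J (marks_total p) i.
Proof.
(* [t] is the last letter of row [i] of phase 1, whose rows are numbered from [J] on in the whole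
   word. *)
have key p i : (i < J)%N -> let t := ((J + i) * J + J.-1)%N in
    [/\ (J %| t.+1)%N, (t %/ (J * J) = 1)%N, (t %/ J = J + i)%N & 
     (mark_count ds p t.+1 %/ J != mark_count ds p (t %/ J * J) %/ J)%N =
     line_mark J (marks_total p) i].
  move=> iJ t.
  have tS : t.+1 = ((J + i.+1) * J)%N by rewrite /t addnS mulSn; lia.
  have tJ : (t %/ J = J + i)%N.
    by rewrite /t divnMDl // divn_small ?addn0 //; lia.
  split=> //; first by rewrite tS dvdn_mull.
    by rewrite divnMA tJ divJ divn_small.
  rewrite tJ tS !mark_count_row ?(ltnW iJ) // /line_mark.
  by rewrite !divJ eqSS.
split=> [H p i iJ|H t t4].
  have [tS t1 tJ <-] := key p i iJ; set t := ((J + i) * J + J.-1)%N in tS t1 tJ *.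
  have t4 : (t < 4 * (J * J))%N.
    by rewrite -ltn_divLR ?muln_gt0 ?J0 // t1.
  have := H t t4; rewrite /row_check -/J tS t1 eqxx /= => /forallP/(_ p)/eqP ->.
  (* The row head has completed two sweeps before phase 1; it moves forwards again and reads cell
     [i] in row [i]. *)
  rewrite tJ /zigzag -/J !divJ.
  rewrite (divn_small iJ) /= !modnDl modn_small //.
rewrite /row_check -/J; apply/implyP => /andP[tS /eqP t1]; apply/forallP => p.
have tE : exists2 i, (i < J)%N & t = ((J + i) * J + J.-1)%N.
  have := divn_eq t J; have : (t %% J = J.-1)%N.
    by apply/eqP; rewrite -/(wraps J t) wrapsE.
  move=> -> tE; move: t1; rewrite divnMA => t1.
  exists (t %/ J %% J)%N; first exact: ltn_pmod.
  by rewrite {1}tE; congr (_ * _ + _)%N; rewrite {1}(divn_eq (t %/ J) J) t1 mul1n.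
have [i iJ ->] := tE; have [_ _ tJ ->] := key p i iJ.
rewrite tJ /zigzag -/J !divJ.
rewrite (divn_small iJ) /= !modnDl modn_small //.
by rewrite -H.
Qed.

End MarkCounts.

(** * Group values and coordinates of accepted words *)

Section Evaluation.
Variables (G : groupType) (n : nat) (e : nat -> G) (seg : nat -> nat).
Variables (cen : pred nat) (F : seq G).
Hypothesis CS : coordinate_system n e seg cen F.
Local Notation P := ('I_n * bool)%type.
Local Notation D := {ffun P -> bool}.
Local Notation Fi := 'I_(size F).
Local Notation letter := (letter P D Fi).

Definition signed (s b : bool) : int := (if s then -1 else 1) * b%:Z.

(** The line [(i, false)] is emitted at every letter, hence once per row, and [(i, true)] only at
    row ends, hence once per segment; this produces [J * q] and [r], with separate signs. *)
Definition emission (eor : bool) (x x' s : D) (i : 'I_n) : int :=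
  signed (s (i, false)) (x (i, false)) +
  signed (s (i, true)) (eor && x' (i, true)).

Definition letter_eval (a : letter) : G :=
  match a with
  | inr f => nth 1%g F f
  | inl (eor, x, x', s, ph) =>
      (\prod_(i < n | (seg i).+1 == ph) zpow (e i) (emission eor x x' s i))%g
  end.

(* Requiring a mark in every cell of the pattern bounds [J ^ 2] by a multiple of
   the largest coordinate. *)
Definition useful : pred D := [pred x : D | [exists i : 'I_n, x (i, false)]].

Definition extend (w : 'I_n -> int) (j : nat) : int := oapp w 0 (insub j).

Lemma extendE w (i : 'I_n) : extend w i = w i.
Proof. by rewrite /extend valK. Qed.

Lemma coord_prod_ext v v' : (forall i, (i < n)%N -> v i = v' i) ->
  coord_prod e seg n v = coord_prod e seg n v'.
Proof. by move=> vv; do 2 apply: eq_bigr => ? _; rewrite vv. Qed.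

(** The new factor merges with segment [k] because later segments are still trivial and elements of
    one segment commute. *)
Lemma coord_prod_step k (v w : 'I_n -> int) : (k < 3)%N ->
  (forall i : 'I_n, (k < seg i)%N -> v i = 0) ->
  (coord_prod e seg n (extend v) * \prod_(i < n | seg i == k) zpow (e i) (w i) =
  coord_prod e seg n (extend (fun i => (v i + (if seg i == k then w i else 0))%R)))%g.
Proof.
move=> k3 v0; rewrite /coord_prod.
set v' := (fun i : 'I_n => (v i + _)%R).
have same l : l != k -> (\prod_(i < n | seg i == l) zpow (e i) (extend v' i) =
    \prod_(i < n | seg i == l) zpow (e i) (extend v i))%g.
  move=> lk; apply: eq_bigr => i /eqP il; rewrite !extendE /v' il (negbTE lk).
  by rewrite addr0.
have atk : (\prod_(i < n | seg i == k) zpow (e i) (extend v' i) =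
    (\prod_(i < n | seg i == k) zpow (e i) (extend v i)) *
    \prod_(i < n | seg i == k) zpow (e i) (w i))%g.
  rewrite -prodgM_commute; last first.
    move=> i j /eqP ik /eqP jk; apply: commute_zpow2.
    by apply: (cs_comm CS); rewrite ?ik ?jk.
  by apply: eq_bigr => i /eqP ik; rewrite !extendE /v' ik eqxx zpowD.
have late l : (k < l)%N -> (\prod_(i < n | seg i == l) zpow (e i) (extend v i) = 1)%g.
  by move=> kl; rewrite big1 // => i /eqP il; rewrite extendE v0 ?il.
rewrite !big_ord_recl !big_ord0 /= !mulg1 /bump /= !addn0 ?add1n.
move: v' same atk late; clear -k3.
case: k k3 => [|[|[|//]]] _ v' same atk late.
- by rewrite atk (same 1%N) // (same 2%N) // (late 1%N) // (late 2%N) // !mulg1.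
- by rewrite atk (same 0%N) // (same 2%N) // (late 2%N) // !mulg1 -mulgA.
- by rewrite atk (same 0%N) // (same 1%N) // !mulgA.
Qed.

Section Word.
Variables (ds : seq D) (s : D).
Let J := size ds.
Hypothesis J0 : (0 < J)%N.
Let d t : D := nth [ffun=> false] ds t.
Let zz := zigzag J.

Definition step_emission (t : nat) (i : 'I_n) : int :=
  if (t %/ (J * J) == (seg i).+1)%N then
    emission (J %| t.+1)%N (d (zz t)) (d (zz (J + t %/ J))) s i
  else 0.

Definition position (t : nat) (i : 'I_n) : int := \sum_(j < t) step_emission j i.

Lemma good_letter_eval t a : good_letter ds s t a ->
  letter_eval a = (\prod_(i < n | (seg i).+1 == (t %/ (J * J))%N)
    zpow (e i) (emission (J %| t.+1)%N (d (zz t)) (d (zz (J + t %/ J))) s i))%g.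
Proof.
case: a => [[[[[eor x] x'] s'] ph]|//] /and5P[/eqP ph' /eqP-> /eqP-> /eqP-> x'E].
rewrite /= ph'; apply: eq_bigr => i _; congr zpow; rewrite /emission.
by rewrite -/J in x'E *; case: (J %| t.+1)%N x'E => //= /eqP ->.
Qed.

Lemma position_late t (i : 'I_n) : (t <= (seg i).+1 * (J * J))%N -> position t i = 0.
Proof.
move=> tJ; apply: big1 => j _; rewrite /step_emission ltn_eqF //.
by rewrite ltn_divLR ?muln_gt0 ?J0 // (leq_trans (ltn_ord j)).
Qed.

Lemma prefix_eval t (w : seq letter) : (t <= 4 * (J * J))%N ->
  (forall j, (j < t)%N -> good_letter ds s j (nth (inl (false, d 0, d 0, s, ord0)) w j)) ->
  (t <= size w)%N ->
  (\prod_(a <- take t w) letter_eval a = coord_prod e seg n (extend (position t)))%g.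
Proof.
set x0 := inl _ => + + tw.
elim: t tw => [|t IH] tw t4 gl.
  rewrite take0 big_nil /coord_prod big1 // => k _; rewrite big1 // => i _.
  by rewrite extendE /position big_ord0.
rewrite (take_nth x0) // -cats1 big_cat big_seq1 /= IH ?(ltnW t4) ?(ltnW tw) //; last first.
  by move=> j jt; apply: gl; exact: ltnW.
rewrite (good_letter_eval (gl t (ltnSn t))).
have phase4 : (t %/ (J * J) < 4)%N by rewrite ltn_divLR ?muln_gt0 ?J0.
have posS i : position t.+1 i = position t i + step_emission t i.
  by rewrite /position big_ord_recr.
case phE : (t %/ (J * J))%N phase4 => [|k] k4.
  rewrite big_pred0 // mulg1; apply: coord_prod_ext => i ni.
  by rewrite !(extendE _ (Ordinal ni)) posS /step_emission phE addr0.
rewrite (eq_bigl (fun i : 'I_n => seg i == k)); last by move=> i; rewrite eqSS.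
rewrite coord_prod_step //.
  apply: coord_prod_ext => i ni; rewrite !(extendE _ (Ordinal ni)) posS.
  by rewrite /step_emission phE eqSS eq_sym.
move=> i ki; apply: position_late; apply: (@leq_trans (k.+2 * (J * J))%N).
  by rewrite ltnW // -ltn_divLR ?muln_gt0 ?J0 // phE.
by rewrite leq_mul2r ltnS ki orbT.
Qed.

Hypothesis straight : forall p i, (i < J)%N ->
  d i p = line_mark J (marks_total ds p) i.

Definition sign_of (b : bool) : int := if b then -1 else 1.

Definition target (i : 'I_n) : int :=
  sign_of (s (i, false)) * (J * marks_total ds (i, false))%N%:Z +
  sign_of (s (i, true)) * (marks_total ds (i, true))%:Z.

Lemma row_end_sum (g : nat -> bool) m :
  (\sum_(j < m) ((J %| j.+1) && g (j %/ J)) = \sum_(r < m %/ J) g r)%N.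
Proof.
elim: m => [|m IH]; first by rewrite div0n !big_ord0.
rewrite big_ord_recr /= IH divSE // wrapsE //.
case: (_ %| _)%N; last by rewrite addn0 addn0.
by rewrite addn1 big_ord_recr.
Qed.

Lemma sum_signed m (c : bool) (h : nat -> bool) :
  \sum_(j < m) signed c (h j) = sign_of c * (\sum_(j < m) h j)%N%:Z.
Proof.
rewrite (big_morph Posz PoszD (id1 := 0)) // mulr_sumr.
by apply: eq_bigr.
Qed.

Lemma position_segment k tau (i : 'I_n) : seg i = k -> (tau <= J * J)%N ->
  position (k.+1 * (J * J) + tau) i =
  sign_of (s (i, false)) * (\sum_(j < tau) d (zz (k.+1 * J * J + j)) (i, false))%N%:Z +
  sign_of (s (i, true)) * (\sum_(r < tau %/ J) d (zz (k.+2 * J + r)) (i, true))%N%:Z.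
Proof.
move=> ik tauJ; rewrite /position big_split_ord /= big1 ?add0r; last first.
  by move=> j _; rewrite /step_emission ltn_eqF // ltn_divLR ?muln_gt0 ?J0 // ik ltn_ord.
rewrite -(row_end_sum (fun r => d (zz (k.+2 * J + r)) (i, true))).
rewrite -(sum_signed tau (s (i, false)) (fun j => d (zz (k.+1 * J * J + j)) (i, false))).
rewrite -(sum_signed tau (s (i, true)) (fun j =>
  (J %| j.+1)%N && d (zz (k.+2 * J + j %/ J)) (i, true))).
rewrite -big_split /=; apply: eq_bigr => j _.
have jJ : (j < J * J)%N := leq_trans (ltn_ord j) tauJ.
rewrite /step_emission divnMDl ?muln_gt0 ?J0 // (divn_small jJ) addn0 ik eqxx.
rewrite /emission mulnA; congr (signed _ _ + signed _ (_ && _)).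
- by rewrite -addnS dvdn_addr // dvdn_mull.
- by rewrite divnMDl // addnA mulSn.
Qed.

Lemma position_segment_end k (i : 'I_n) : seg i = k ->
  position (k.+2 * (J * J)) i = target i.
Proof.
move=> ik; rewrite mulSn addnC position_segment // /target mulnK //.
congr (_ * Posz _ + _ * Posz _).
  by have := zigzag_sum J0 (fun j => d j (i, false)) (k.+1 * J) J 0;
    rewrite addn0 big_ord0 addn0 => ->.
exact: (zigzag_full_row J0 (fun j => d j (i, true))).
Qed.

Lemma position_after k t (i : 'I_n) : seg i = k -> (k.+2 * (J * J) <= t)%N ->
  position t i = target i.
Proof.
move=> ik kt; rewrite -(position_segment_end ik) /position.
rewrite -(subnKC kt) big_split_ord /= [X in _ + X]big1 ?addr0 // => j _.
rewrite /step_emission gtn_eqF // leq_divRL ?muln_gt0 ?J0 // ik.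
exact: leq_addr.
Qed.

(** After scaling by [J * J] there are three errors of at most [J * J]: the rounding of each of the
    two lines, and the part of the current row that emissions at row ends ignore, [t * r] with [t]
    and [r] at most [J]. *)
Lemma position_near k tau : (tau <= J * J)%N ->
  near_point seg n 3 (J * J) tau k (extend target)
    (extend (position (k.+1 * (J * J) + tau))).
Proof.
move=> tauJ j jn; rewrite !(extendE _ (Ordinal jn)); set i := Ordinal jn.
split=> [ik|ik|ik].
- apply: (position_after (k := seg i)) => //.
  by apply: leq_trans (leq_addr _ _); rewrite leq_mul2r ltnS ik orbT.
- apply: position_late; apply: (@leq_trans (k.+2 * (J * J))%N).
    by rewrite mulSn addnC leq_add2r.
  by rewrite leq_mul2r ltnS ik orbT.
rewrite (position_segment (i := i) ik tauJ) /target.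
have := zigzag_linear J0 (fun h => straight (i, false) (i := h)) (k.+1 * J) tau.
have := zigzag_linear J0 (fun h => straight (i, true) (i := h)) k.+2 (tau %/ J).
have := count_leq J (fun h => d h (i, true)).
rewrite -!/(marks_total ds _).
move: (marks_total ds (i, false)) (marks_total ds (i, true)) => q r.
set S2 := (\sum_(_ < _ %/ _) _)%N; set S1 := (\sum_(_ < tau) _)%N => rJ L2 L1.
have := divn_eq tau J; have := ltn_pmod tau J0.
move: (tau %/ J)%N (tau %% J)%N S1 S2 L1 L2 => p t S1 S2 L1 L2 tJ tauE.
rewrite tauE in L1 *.
have bnd1 : `|J%:Z * (J%:Z * S1%:Z - (p * J + t)%N%:Z * q%:Z)| <= J%:Z * J%:Z.
  by rewrite normrM ler_wpM2l.
have bnd2 : `|J%:Z * (J%:Z * S2%:Z - p%:Z * r%:Z)| <= J%:Z * J%:Z.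
  by rewrite normrM ler_wpM2l.
have bnd3 : (t * r)%N%:Z <= J%:Z * J%:Z.
  by rewrite -PoszM lez_nat leq_mul // ltnW.
have -> : (J * J)%N%:Z * (sign_of (s (i, false)) * S1%:Z + sign_of (s (i, true)) * S2%:Z) -
   (p * J + t)%N%:Z * (sign_of (s (i, false)) * (J * q)%N%:Z + sign_of (s (i, true)) * r%:Z) =
   sign_of (s (i, false)) * (J%:Z * (J%:Z * S1%:Z - (p * J + t)%N%:Z * q%:Z)) +
   sign_of (s (i, true)) * (J%:Z * (J%:Z * S2%:Z - p%:Z * r%:Z) - (t * r)%N%:Z).
  by rewrite !PoszD !PoszM; ring.
have sgn b (z : int) : `|sign_of b * z| = `|z|.
  by case: b; rewrite /sign_of ?mulN1r ?normrN ?mul1r.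
apply: (le_trans (ler_normD _ _)); rewrite !sgn.
have comb (x y z m : int) : `|x| <= m -> `|y| <= m -> 0 <= z -> z <= m ->
    `|x| + `|y - z| <= 3 * m by lia.
by rewrite [(J * J)%N%:Z]PoszM; apply: comb.
Qed.

Lemma target_bound i : `|target i| <= (2 * (J * J))%N%:Z.
Proof.
rewrite /target.
have q1 : (marks_total ds (i, false) <= J)%N by exact: (count_leq J (fun h => d h (i, false))).
have r1 : (marks_total ds (i, true) <= J)%N by exact: (count_leq J (fun h => d h (i, true))).
have JJ : (J <= J * J)%N by rewrite leq_pmulr.
have b1 : (J * marks_total ds (i, false) <= J * J)%N by rewrite leq_mul2l q1 orbT.
move: (J * marks_total ds (i, false))%N (marks_total ds (i, true)) b1 r1 => x y b1 r1.
by case: (s (i, false)); case: (s (i, true)); rewrite /sign_of; lia.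
Qed.

(** Every cell has a mark of some [(i, false)], so some total [q] satisfies [J <= n * q]. Then
    [J ^ 2 <= n * (|target| + J)], and [2 * n * J <= n ^ 2 + J ^ 2] absorbs the linear term. *)
Lemma useful_bound : all useful ds -> exists i : 'I_n,
  ((J * J)%N%:Z <= (2 * n)%N%:Z * `|target i| + (n * n)%N%:Z)%R.
Proof.
move=> good.
have JS : (J <= \sum_(i < n) marks_total ds (i, false))%N.
  rewrite exchange_big /=; apply: (@leq_trans (\sum_(t < J) 1)).
    by rewrite sum1_card card_ord.
  apply: leq_sum => t _; have := elimT (all_nthP [ffun=> false]) good t (ltn_ord t).
  by move=> /existsP[i it]; rewrite (bigD1 i) //= /d it.
have [i Ji] : exists i : 'I_n, (J <= n * marks_total ds (i, false))%N.
  apply/existsP; apply: contraT; rewrite negb_exists => /forallP H.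
  have n0 : (0 < n)%N.
    rewrite lt0n; apply/eqP => n0; move: JS; rewrite big1 => [|i _].
      by rewrite leqNgt J0.
    by have := leq_trans (ltn_ord i) (eq_leq n0).
  have : (n * \sum_(i < n) marks_total ds (i, false) < n * J)%N.
    rewrite big_distrr /= -[n in (_ < n * _)%N]card_ord -sum_nat_const.
    have i0 := Ordinal n0.
    rewrite (bigD1 i0) //= [X in (_ < X)%N](bigD1 i0) //= -addSn leq_add //.
      by rewrite ltnNge H.
    by apply: leq_sum => i _; rewrite ltnW // ltnNge H.
  by rewrite ltn_mul2l => /andP[_]; rewrite ltnNge => /negP[].
exists i; rewrite /target.
have r1 : (marks_total ds (i, true) <= J)%N by exact: (count_leq J (fun h => d h (i, true))).
have JJ : (J * J <= n * (J * marks_total ds (i, false)))%N.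
  by rewrite mulnCA leq_mul2l Ji orbT.
move: (J * marks_total ds (i, false))%N (marks_total ds (i, true)) r1 JJ => x y r1 JJ.
set z := (sign_of _ * _ + _)%R.
have zx : (x%:Z <= `|z| + J%:Z)%R.
  by rewrite /z; case: (s (i, false)); case: (s (i, true)); rewrite /sign_of; lia.
move: `|z| zx => w zx.
have : (n * x)%N%:Z <= n%:Z * (w + J%:Z) by rewrite PoszM ler_wpM2l.
have Hc : (2 * (n * J) <= n * n + J * J)%N by rewrite !mulnn; have [+ _] := nat_Cauchy n J.
rewrite !PoszM mulrDr; move: (n%:Z * w) => nw; nia.
Qed.

End Word.
End Evaluation.

(** * Accepted words and coordinate vectors *)

Section TraceWords.
Variables (G : groupType) (n : nat) (e : nat -> G) (seg : nat -> nat).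
Variables (cen : pred nat) (F : seq G).
Hypothesis CS : coordinate_system n e seg cen F.
Local Notation P := ('I_n * bool)%type.
Local Notation D := {ffun P -> bool}.
Local Notation Fi := 'I_(size F).
Local Notation letter := (letter P D Fi).
Local Notation machine := (@trace_machine P D Fi (@useful n)).
Local Notation eval w := (\prod_(a <- w) @letter_eval G n e seg F a)%g.
Local Notation E v := (coord_prod e seg n v).

(** All that the geometry needs to know of an accepted word, with pattern and machine forgotten.
    [J = 0] is the word made of a final letter only. *)
Record trace_data (W : seq letter) (J : nat) (v : nat -> int) (f : G) : Prop := {
  td_fin : f \in F;
  td_size : size W = (4 * (J * J)).+1;
  td_eval : eval W = (E v * f)%g;
  td_upper : forall i, (i < n)%N -> `|v i| <= (2 * (J * J))%N%:Z;
  td_lower : J = 0%N \/ exists2 i, (i < n)%N &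
    (J * J)%N%:Z <= (2 * n)%N%:Z * `|v i| + (n * n)%N%:Z;
  td_near : forall k tau, (k < 3)%N -> (tau <= J * J)%N -> exists u,
    near_point seg n 3 (J * J) tau k v u /\
    eval (take (k.+1 * (J * J) + tau) W) = E u;
  td_idle : forall t, (t <= J * J)%N -> eval (take t W) = 1%g
}.

Lemma coord_prod_zero : E (fun=> 0) = 1%g.
Proof. by rewrite /coord_prod big1 // => k _; rewrite big1. Qed.

Lemma trace_suffix_data (ds : seq D) (s : D) (f : Fi) W : (0 < size ds)%N ->
  all (@useful n) ds -> size W = (4 * (size ds * size ds)).+1 ->
  (forall t, (t < 4 * (size ds * size ds))%N ->
     good_letter ds s t (nth (inr f) W t) && row_check ds t) ->
  nth (inr f) W (4 * (size ds * size ds)) = inr f ->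
  trace_data W (size ds) (extend (target ds s)) (nth 1%g F f).
Proof.
move=> J0 good sW gl eW; have fF : nth 1%g F f \in F by rewrite mem_nth.
pose J := size ds; rewrite -/J in J0 sW gl eW *.
have JJ0 : (0 < J * J)%N by rewrite muln_gt0 J0.
have {}gl t : (t < 4 * (J * J))%N ->
    good_letter ds s t (nth (inr f) W t) /\ row_check ds t.
  by move=> t4; apply/andP/gl.
have straight := iffLR (row_check_straight J0) (fun t t4 => proj2 (gl t t4)).
have pre t : (t <= 4 * (J * J))%N ->
    eval (take t W) = E (extend (position seg ds s t)).
  move=> t4; apply: (prefix_eval CS J0) => //; last by rewrite sW leqW.
  move=> j jt; have j4 : (j < 4 * (J * J))%N by exact: leq_trans t4.
  by rewrite (set_nth_default (inr f)) ?sW ?leqW //; case: (gl j j4).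
split=> //.
- have -> : W = rcons (take (4 * (J * J)) W) (inr f).
    by rewrite -eW -take_nth ?sW // -sW take_size.
  rewrite -cats1 big_cat big_seq1 /= pre //; congr (_ * _)%g.
  apply: coord_prod_ext => i ni; rewrite !(extendE _ (Ordinal ni)).
  apply: (position_after s J0 (k := seg i)) => //.
  by rewrite leq_mul2r (cs_seg CS ni : (seg i).+2 <= 4)%N orbT.
- by move=> i ni; rewrite (extendE _ (Ordinal ni)); exact: target_bound.
- right; have [i iJ] := useful_bound s J0 good.
  by exists i; rewrite ?ltn_ord // extendE.
- move=> k tau k3 tauJ; exists (extend (position seg ds s (k.+1 * (J * J) + tau))).
  split; first exact: (position_near seg s J0 straight).
  apply: pre; apply: (@leq_trans (k.+2 * (J * J))%N).
    by rewrite [leqRHS]mulSn addnC leq_add2r.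
  by rewrite leq_mul2r (k3 : k.+2 <= 4)%N orbT.
- move=> t tJ; rewrite pre; last by rewrite (leq_trans tJ) // leq_pmull.
  rewrite -[RHS]coord_prod_zero; apply: coord_prod_ext => i ni.
  rewrite (extendE _ (Ordinal ni)); apply: (position_late s J0).
  by rewrite (leq_trans tJ) // leq_pmull.
Qed.

Lemma trace_word_data W : rt_accepts machine W -> exists J v f, trace_data W J v f.
Proof.
move=> /(trace_accepts _ [ffun=> false])[ds [s [good [f [sW gl eW]]]]].
have fF : nth 1%g F f \in F by rewrite mem_nth.
have [J0|J0] := posnP (size ds); last first.
  exists (size ds), (extend (target ds s)), (nth 1%g F f).
  by move: sW gl eW; rewrite subn0; exact: trace_suffix_data.
exists 0%N, (fun=> 0), (nth 1%g F f).
have WE : W = [:: inr f].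
  by move: sW eW; rewrite J0; case: W {gl} => // a [] //= _ ->.
split=> //.
- by rewrite sW J0.
- by rewrite WE big_seq1 coord_prod_zero mul1g.
- by left.
- move=> k tau k3; rewrite !muln0 leqn0 => /eqP->; exists (fun=> 0).
  by rewrite take0 big_nil coord_prod_zero; split.
- by move=> t; rewrite muln0 leqn0 => /eqP->; rewrite take0 big_nil.
Qed.

(** Near [J * J] the remainder is signed, so that a largest coordinate gets [q = J]: its line has a
    mark in every cell, which makes the pattern [useful]. *)
Lemma split_coordinate (J x : nat) : (0 < J)%N -> (x <= J * J + J)%N ->
  exists q r (b : bool), [/\ (q <= J)%N, (r <= J)%N,
    x%:Z = (J * q)%N%:Z + (if b then -1 else 1) * r%:Z :> int &
    (J * J <= x + J)%N -> q = J].
Proof.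
move=> J0 xJ; have [big|small] := leqP (J * J) (x + J); last first.
  exists (x %/ J)%N, (x %% J)%N, false; split.
  - by rewrite -[leqRHS](mulnK J J0) leq_div2r //; lia.
  - by rewrite ltnW // ltn_pmod.
  - by rewrite mul1r -PoszD mulnC -divn_eq.
  - by [].
have [xb|xb] := leqP (J * J) x.
  by exists J, (x - J * J)%N, false; split=> //; lia.
by exists J, (J * J - x)%N, true; split=> //; lia.
Qed.

(** The intervals from [J * J - J] to [J * J + J] leave no gap, since
    [(J - 1) ^ 2 + (J - 1) = J ^ 2 - J]. *)
Lemma square_near (V : nat) : exists2 J, (0 < J)%N & (V <= J * J + J)%N && (J * J <= V + J)%N.
Proof.
have ex : exists J, (0 < J)%N && (V <= J * J + J)%N.
  by exists V.+1; rewrite (leq_trans (leqnSn V)) // leq_addl.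
have [J /andP[J0 VJ] min] := ex_minnP ex; exists J => //; rewrite VJ /=.
case: J J0 VJ min => [//|[|J]] _ VJ min; first by rewrite leq_addl.
have : ~~ (V <= J.+1 * J.+1 + J.+1)%N.
  by apply/negP => H; have := min J.+1; rewrite H ltnn => /(_ isT).
by rewrite -ltnNge; nia.
Qed.

Lemma marks_total_line (J : nat) (ds : seq D) p q : (0 < J)%N -> size ds = J -> (q <= J)%N ->
  (forall i, (i < J)%N -> nth [ffun=> false] ds i p = line_mark J q i) ->
  marks_total ds p = q.
Proof.
move=> J0 sds qJ H; rewrite /marks_total sds.
transitivity (\sum_(i < J) line_mark J q i)%N.
  by apply: eq_bigr => i _; rewrite H.
by rewrite line_mark_sum // mulKn.
Qed.

Lemma trace_word_exists v f : f \in F -> exists2 W, rt_accepts machine W &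
  eval W = (E v * f)%g.
Proof.
move=> fF; pose fi : Fi := Ordinal (etrans (index_mem f F) fF).
have fiE : nth 1%g F fi = f by rewrite /= nth_index.
have [n0|n0] := posnP n.
  exists [:: inr fi].
    apply/(trace_accepts _ [ffun=> false]); exists [::], [ffun=> false]; split=> //.
    by exists fi; split.
  rewrite big_seq1 /= fiE /coord_prod big1 ?mul1g // => k _; rewrite big1 // => i.
  by have := leq_trans (ltn_ord i) (eq_leq n0).
pose V := (\max_(i < n) `|v i|)%N.
have [J J0 /andP[VJ JV]] := square_near V.
have vV (i : 'I_n) : (absz (v i) <= V)%N.
  exact: (leq_bigmax (F := fun i : 'I_n => absz (v i)) i).
have /choice[dat datP] : forall i : 'I_n, exists t : nat * nat * bool,
    [/\ (t.1.1 <= J)%N, (t.1.2 <= J)%N,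
     `|v i| = (J * t.1.1)%N%:Z + (if t.2 then -1 else 1) * t.1.2%:Z &
     (J * J <= `|v i| + J)%N -> t.1.1 = J].
  move=> i; have [|q [r [b [qJ rJ vE qE]]]] := @split_coordinate J `|v i|%N J0.
    by rewrite (leq_trans (vV i)).
  by exists (q, r, b); split=> //; rewrite -abszE.
pose slope (p : P) := if p.2 then (dat p.1).1.2 else (dat p.1).1.1.
have slopeJ p : (slope p <= J)%N by rewrite /slope; case: ifP; case: (datP p.1).
pose ds : seq D := mkseq (fun i => [ffun p => line_mark J (slope p) i]) J.
have sds : size ds = J by rewrite size_mkseq.
have dsE i p : (i < J)%N -> nth [ffun=> false] ds i p = line_mark J (slope p) i.
  by move=> iJ; rewrite nth_mkseq // ffunE.
have tot p : marks_total ds p = slope p.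
  by apply: (marks_total_line J0 sds) => // i; exact: dsE.
(* [(dat p.1).2] is the sign of the remainder relative to that of the coordinate. *)
pose s : D := [ffun p : P => (v p.1 < 0) (+) (p.2 && (dat p.1).2)].
have good : all (@useful n) ds.
  apply/(all_nthP [ffun=> false]) => i; rewrite sds => iJ; apply/existsP.
  have [i0 _ Vi0] : exists2 i0 : 'I_n, true & V = absz (v i0).
    have [|i0 Vi0] := @bigop.eq_bigmax 'I_n (fun i : 'I_n => absz (v i)).
      by rewrite card_ord.
    by exists i0.
  exists i0; rewrite dsE // /line_mark /slope /=.
  have [_ _ _ ->] := datP i0; last by rewrite -Vi0.
  by rewrite !mulnK // gtn_eqF.
pose body t : letter := inl ((J %| t.+1)%N, nth [ffun=> false] ds (zigzag J t),
  nth [ffun=> false] ds (zigzag J (J + t %/ J)), s, inord (t %/ (J * J))).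
pose W := rcons (mkseq body (4 * (J * J))) (inr fi).
have JJ0 : (0 < J * J)%N by rewrite muln_gt0 J0.
have sds0 : (0 < size ds)%N by rewrite sds.
have straight : forall p i, (i < size ds)%N ->
    nth [ffun=> false] ds i p = line_mark (size ds) (marks_total ds p) i.
  by move=> p i; rewrite sds tot => /dsE.
have chk := iffRL (row_check_straight sds0) straight.
have sW : size W = (4 * (size ds * size ds)).+1.
  by rewrite size_rcons size_mkseq sds.
have gl t : (t < 4 * (size ds * size ds))%N ->
    good_letter ds s t (nth (inr fi) W t) && row_check ds t.
  move=> t4; rewrite chk // andbT; move: t4; rewrite sds => t4.
  rewrite nth_rcons size_mkseq t4 nth_mkseq //.
  rewrite /body /good_letter sds !eqxx implybT !andbT; apply/eqP/inordK.
  by rewrite ltn_divLR.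
have eW : nth (inr fi) W (4 * (size ds * size ds)) = inr fi.
  by rewrite sds nth_rcons size_mkseq ltnn eqxx.
exists W.
  apply/(trace_accepts _ [ffun=> false]); exists ds, s; split=> //; exists fi.
  by rewrite subn0; split.
rewrite (td_eval (trace_suffix_data sds0 good sW gl eW)) fiE; congr (_ * _)%g.
apply: coord_prod_ext => i ni; rewrite (extendE _ (Ordinal ni)) /target !tot /slope sds /=.
have [_ _ vE _] := datP (Ordinal ni).
rewrite !ffunE /= addbF.
have vi : v i = (if v i < 0 then -1 else 1) * `|v i|.
  by case: (ltrP (v i) 0) => v0; [rewrite ltr0_norm // mulN1r opprK|rewrite ger0_norm // mul1r].
rewrite [RHS]vi vE /sign_of; case: (v i < 0); case: (dat _).2 => /=; ring.
Qed.

End TraceWords.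

(** * Fellow travelling *)

Section CayleyPaths.
Variables (R : realType) (G : groupType) (X : {fset G}).
Local Notation Vertex := (@Vertex R G X).
Local Notation EdgePoint := (@EdgePoint R G X).
Local Notation cpath := (@cayley_path R G X).

Lemma cayley_path_trans p q r (a b : R) : cpath p q a -> cpath q r b ->
  cpath p r (a + b).
Proof.
elim=> [p'|p' q' r' a' b' pq _ IH] qr; first by rewrite add0r.
by rewrite -addrA; apply: (PathCons pq); exact: IH.
Qed.

Lemma word_eval_cat (u v : seq X) : word_eval (u ++ v) = (word_eval u * word_eval v)%g.
Proof. by rewrite /word_eval big_cat. Qed.

Lemma word_path (w : seq X) g :
  cpath (Vertex g) (Vertex (g * word_eval w)%g) (size w)%:R.
Proof.
elim: w g => [|x w IH] g.
  by rewrite /word_eval big_nil mulg1; exact: PathNil.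
have -> : (g * word_eval (x :: w) = g * val x * word_eval w)%g.
  by rewrite /word_eval big_cons mulgA.
have -> : (size (x :: w))%:R = 0 + (`|0 - 1| + (0 + (size w)%:R)) :> R.
  by rewrite !add0r normrN normr1 /= -natr1 addrC.
apply: PathCons (SegSourceV R g x) _.
apply: PathCons (SegEdge g x _ _) _; rewrite ?lexx ?ler01 //.
by apply: PathCons (SegTarget R g x) _; exact: IH.
Qed.

Lemma edge_path g x (t : R) : 0 <= t <= 1 ->
  cpath (EdgePoint g x t) (Vertex g) t /\ cpath (Vertex g) (EdgePoint g x t) t.
Proof.
move=> t01; have z01 : 0 <= (0 : R) <= 1 by rewrite lexx ler01.
have [t0 _] := andP t01.
have E1 : `|t - 0| + (0 + 0) = t by rewrite subr0 !addr0 ger0_norm.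
have E2 : 0 + (`|0 - t| + 0) = t by rewrite sub0r normrN addr0 add0r ger0_norm.
split; [rewrite -[X in cpath _ _ X]E1|rewrite -[X in cpath _ _ X]E2].
  apply: PathCons (SegEdge g x t01 z01) _.
  exact: PathCons (SegSource R g x) (PathNil _).
apply: PathCons (SegSourceV R g x) _.
exact: PathCons (SegEdge g x z01 t01) (PathNil _).
Qed.

(** [m] is the integer part of [t], cut off at the end of the word. Both directions are kept because
    a connection leaves one edge point and arrives at another. *)
Lemma path_from_prefix (w : seq X) g (t : R) : 0 <= t -> exists m,
  [/\ (m <= size w)%N, m%:R <= t, m = size w \/ t < m%:R + 1 &
   exists2 r, r <= 1 &
     cpath (path_from g w t) (Vertex (g * word_eval (take m w))%g) r /\
     cpath (Vertex (g * word_eval (take m w))%g) (path_from g w t) r].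
Proof.
elim: w g t => [|x w IH] g t t0 /=.
  exists 0%N; split=> //; first by left.
  by exists 0 => //; rewrite /word_eval big_nil mulg1; split; exact: PathNil.
case: ltP => t1.
  exists 0%N; split=> //; first by right; rewrite add0r.
  exists t; first exact: ltW.
  by rewrite /word_eval big_nil mulg1; apply: edge_path; rewrite t0 ltW.
have [|m [mw mt mt1 [r r1 [p1 p2]]]] := IH (g * val x)%g (t - 1).
  by rewrite subr_ge0.
exists m.+1; split=> //.
- by rewrite -natr1 -lerBrDr.
- by case: mt1 => [->|mt1]; [left|right; rewrite -natr1 -ltrBlDr].
exists r => //.
have -> : (g * word_eval (take m.+1 (x :: w)) =
    g * val x * word_eval (take m w))%g.
  by rewrite /word_eval /= big_cons mulgA.
by split.
Qed.

Lemma cayley_dist_prefix (v w z : seq X) (t s : R) m m' :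
  (exists2 r, r <= 1 & cpath (path_at v t) (Vertex (word_eval (take m v))) r) ->
  (exists2 r, r <= 1 & cpath (Vertex (word_eval (take m' w))) (path_at w s) r) ->
  (word_eval (take m v) * word_eval z)%g = word_eval (take m' w) ->
  (cayley_dist (path_at v t) (path_at w s) <= (2 + (size z)%:R)%:E)%E.
Proof.
move=> [r r1 p] [r' r1' p'] E.
have pz := word_path z (word_eval (take m v)); rewrite E in pz.
have P := cayley_path_trans p (cayley_path_trans pz p').
apply: (@le_trans _ _ (r + ((size z)%:R + r'))%:E).
  by apply: ereal_inf_lbound; exists (r + ((size z)%:R + r')).
by rewrite lee_fin; lra.
Qed.

(** The relative speed is the constant [Nw / Nv], as the prescribed intervals demand. Rounding to
    the vertices [m] and [m'] costs 1 on either path. The two inequalities say that [m] and [m'] are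
    matched integer parts, without denominators; they persist beyond the ends, where [m] and [m']
    stop at the sizes. *)
Lemma linear_fellow_travel (K0 : nat) (M : R) (v w : seq X) :
  let Nv := (size v).+1 in let Nw := (size w).+1 in
  1 / M <= Nw%:R / Nv%:R <= M ->
  (forall m m', (m <= size v)%N -> (m' <= size w)%N ->
     (m * Nw < m'.+1 * Nv)%N -> (m' * Nv < m.+1 * Nw)%N ->
     exists z : seq X, (size z <= K0)%N /\
       (word_eval (take m v) * word_eval z)%g = word_eval (take m' w)) ->
  bounded_async_fellow_travel (2 + K0%:R) M v w.
Proof.
move=> Nv Nw slopeM close.
have Nv0 : 0 < Nv%:R :> R by rewrite ltr0n.
have Nw0 : 0 < Nw%:R :> R by rewrite ltr0n.
pose sg : R := Nw%:R / Nv%:R.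
have sg0 : 0 < sg by rewrite divr_gt0.
have sgN : Nv%:R * sg = Nw%:R by rewrite /sg mulrC divfK // gt_eqF.
pose h (t : R) := sg * t.
have dh (t : R) : is_derive t 1 h sg.
  rewrite -[sg in is_derive _ _ _ sg]mulr1.
  exact: is_deriveZ.
exists h; last by move=> t; rewrite derive1E derive_val.
split; first split.
- by move=> t; have := dh t => -[].
- rewrite !natr1 -/Nv -/Nw; apply/seteqP; split=> [_ [t /= + <-]|t /=].
    by rewrite !in_itv /= /h -sgN => /andP[t0 tN]; rewrite mulr_ge0 ?(ltW sg0) //= mulrC ler_pM2r.
  rewrite !in_itv /= => /andP[t0 tN]; exists (t / sg); last by rewrite /h mulrC divfK // gt_eqF.
  by rewrite /= in_itv /= divr_ge0 ?(ltW sg0) //= ler_pdivrMr // sgN.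
- by move=> s t _ _ st; rewrite /h ltr_pM2l.
move=> t t0; have ht0 : 0 < h t by rewrite mulr_gt0.
have maxt (u : R) : 0 < u -> Num.max 0 u = u by move=> u0; rewrite max_r // ltW.
have [m [mv mt mt1 [r r1 [p1 _]]]] := path_from_prefix v 1%g (ltW t0).
have [m' [mw mt' mt1' [r' r1' [_ p2]]]] := path_from_prefix w 1%g (ltW ht0).
have H1 : (m * Nw < m'.+1 * Nv)%N.
  have H : m%:R * sg < m'.+1%:R.
    case: mt1' => [->|mt1'].
      by rewrite -/Nw -sgN ltr_pM2r // ltr_nat ltnS.
    apply: le_lt_trans (_ : _ <= h t) _; first by rewrite /h mulrC ler_pM2l.
    by rewrite -natr1.
  by rewrite -(ltr_nat R) !natrM -sgN mulrCA [ltRHS]mulrC ltr_pM2l.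
have H2 : (m' * Nv < m.+1 * Nw)%N.
  have H : m'%:R < m.+1%:R * sg.
    case: mt1 => [mE|mt1]; first by rewrite mE -/Nv sgN ltr_nat ltnS.
    apply: (le_lt_trans mt'); rewrite /h mulrC ltr_pM2r //.
    by rewrite -natr1.
  by rewrite -(ltr_nat R) !natrM -sgN mulrCA [ltLHS]mulrC ltr_pM2l.
have [z [zK E]] := close m m' mv mw H1 H2.
apply: (@le_trans _ _ (2 + (size z)%:R)%:E); last first.
  by rewrite lee_fin lerD2l ler_nat.
apply: (cayley_dist_prefix (m := m) (m' := m')) => //.
  by exists r => //; move: p1; rewrite /path_at maxt // mul1g.
by exists r' => //; move: p2; rewrite /path_at maxt // mul1g.
Qed.

End CayleyPaths.

(** * Rounding in the linear reparametrization *)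

Section IndexMatch.
Local Open Scope nat_scope.

(** Lengths plus one are [4 * b * j + (b + 1)], and only the first term is wanted. The rest
    contributes at most [(4 * b * j + 2 * b) * (2 * b)], which becomes [2 * j + 1] after division by
    [4 * (b * b)]. *)
Lemma index_half (b j j' m m' q s : nat) : 0 < b -> q * b <= m' ->
  m.+1 <= s * b -> m <= b * (4 * j).+1 ->
  m' * (b * (4 * j).+1).+1 < m.+1 * (b * (4 * j').+1).+1 ->
  q * j <= s * j' + (2 * j + 1).
Proof.
move=> b0 qm ms mj H.
have bb : 0 < 4 * (b * b) by rewrite !muln_gt0 b0.
have L1 : q * b * (4 * b * j) <= m' * (4 * b * j) by rewrite leq_mul2r qm orbT.
have L2 : m' * (4 * b * j) <= m.+1 * (4 * b * j') + m.+1 * (b + 1).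
  move: H; have -> : (b * (4 * j).+1).+1 = 4 * b * j + (b + 1) by lia.
  have -> : (b * (4 * j').+1).+1 = 4 * b * j' + (b + 1) by lia.
  rewrite !mulnDr; clear; lia.
have L3 : m.+1 * (4 * b * j') <= s * b * (4 * b * j') by rewrite leq_mul2r ms orbT.
have L4 : m.+1 * (b + 1) <= (4 * b * j + 2 * b) * (2 * b) by apply: leq_mul; lia.
rewrite -(leq_pmul2l bb).
have -> : 4 * (b * b) * (q * j) = q * b * (4 * b * j) by lia.
have -> : 4 * (b * b) * (s * j' + (2 * j + 1)) =
  s * b * (4 * b * j') + (4 * b * j + 2 * b) * (2 * b) by lia.
exact: leq_trans L1 (leq_trans L2 (leq_add L3 L4)).
Qed.

(* [t] and [t'] are the same fraction of two words made of [4 * j + 1] and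
   [4 * j' + 1] blocks of length [b]; [m] and [m'] are the positions matched by
   the linear reparametrization. *)
Lemma index_match (b C j j' m m' : nat) : 0 < b -> j'.+1 <= C * j.+1 ->
  m <= b * (4 * j).+1 -> m' <= b * (4 * j').+1 ->
  m * (b * (4 * j').+1).+1 < m'.+1 * (b * (4 * j).+1).+1 ->
  m' * (b * (4 * j).+1).+1 < m.+1 * (b * (4 * j').+1).+1 ->
  let t := minn (m %/ b) (4 * j) in let t' := t * j' %/ j in
  m' %/ b <= t' + (4 * C + 4) /\ t' <= m' %/ b + (4 * C + 4).
Proof.
move=> b0 jC mj mj' H1 H2 t t'.
have th : m %/ b <= 4 * j + 1.
  by rewrite addn1 -[leqRHS](mulKn _ b0) leq_div2r.
have th' : m' %/ b <= 4 * j' + 1.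
  by rewrite addn1 -[leqRHS](mulKn _ b0) leq_div2r.
(* Division by [j = 0] gives [t' = 0]; then [j' < C], and [m' %/ b <= 4 * j' + 1] is small
   enough. *)
have [j0|j0] := posnP j.
  rewrite /t' j0 divn0 add0n; split; last by [].
  by move: jC; rewrite j0; clear -th'; lia.
have jC' : j' <= C * j + C * j.
  have : C * j.+1 <= C * j + C * j by rewrite mulnS leq_add2r leq_pmulr.
  by move: (C * j) jC; clear; lia.
have tq : t <= m %/ b by exact: geq_minl.
(* The minimum cuts off the final letter, which changes the index by at most one. *)
have qt : m %/ b <= t + 1 by rewrite /t; clear -th; lia.
have D3 := divn_eq (t * j') j; rewrite -/t' in D3; have r3 := ltn_pmod (t * j') j0.
have U : m' %/ b * j <= (t + 2) * j' + (2 * j + 1).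
  apply: (index_half b0 _ _ mj H2); first exact: leq_divM.
  apply: (leq_trans (ltn_ceil m b0)); rewrite leq_mul2r; apply/orP; right.
  by clear -qt; lia.
have L : t * j' <= (m' %/ b).+1 * j + (2 * j' + 1).
  apply: (index_half b0 _ _ mj' H1); last exact: ltn_ceil.
  by apply: leq_trans (leq_divM m b); rewrite leq_mul2r tq orbT.
move: (m' %/ b) (t * j' %% j) t' U L D3 r3 => q r t'' U L D3 r3.
have [U' L'] : q * j < (t'' + (4 * C + 4)).+1 * j /\ t'' * j < (q + (4 * C + 4)).+1 * j.
  rewrite mulnDl in U; rewrite (mulSn q) in L.
  have EX x : (x + (4 * C + 4)).+1 * j = x * j + 4 * (C * j) + 5 * j.
    by clear; lia.
  rewrite !EX.
  move: (t * j') (t'' * j) (q * j) (C * j) U L D3 jC'.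
  clear -r3 j0; lia.
by move: U' L'; rewrite !ltn_mul2r !ltnS => /andP[_ ->] /andP[_ ->].
Qed.

End IndexMatch.

(** * Closeness and comparable lengths of traces *)

Section TraceFellow.
Variables (G : groupType) (n : nat) (e : nat -> G) (seg : nat -> nat).
Variables (cen : pred nat) (F : seq G).
Hypothesis CS : coordinate_system n e seg cen F.
Local Notation P := ('I_n * bool)%type.
Local Notation D := {ffun P -> bool}.
Local Notation letter := (letter P D 'I_(size F)).
Local Notation eval w := (\prod_(a <- w) @letter_eval G n e seg F a)%g.
Local Notation E v := (coord_prod e seg n v).

Lemma trace_close h : exists B : seq G, forall W J v f W' J' v' f' t,
  trace_data e seg (F := F) W J v f -> trace_data e seg (F := F) W' J' v' f' ->
  (E v * h)%g = E v' -> (t <= 4 * (J * J))%N ->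
  ((eval (take t W))^-1 * eval (take (t * (J' * J') %/ (J * J)) W'))%g \in B.
Proof.
(* The 5 is the 3 of [td_near] plus 2 for rounding [tau'] down: by [td_upper], one unit of time
   moves a coordinate by at most 2 on the straight line. *)
have [B hB] := cs_close CS h 5.
exists (1%g :: B) => W J v f W' J' v' f' t dW dW' Ev t4.
pose j := (J * J)%N; pose j' := (J' * J')%N; rewrite -/j -/j' in t4 *.
have [tj|tj] := leqP t j.
  rewrite (td_idle dW) // (td_idle dW') ?mulg1 ?invg1 ?mem_head //.
  have [j0|j0] := posnP j; first by rewrite j0 divn0.
  by rewrite -[leqRHS](mulKn (J' * J') j0) leq_div2r // leq_mul2r tj orbT.
have j0 : (0 < j)%N by case: (posnP j) t4 tj => // ->; rewrite muln0 leqn0 => /eqP->.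
(* [t.-1] assigns a boundary to the earlier segment, so that [t = 4 * j] is still in the last
   one. *)
pose k := (t.-1 %/ j).-1; pose tau := (t - k.+1 * j)%N.
have [k3 tauj tE] : [/\ (k < 3)%N, (tau <= j)%N & t = (k.+1 * j + tau)%N].
  have k1 : (0 < t.-1 %/ j)%N by rewrite divn_gt0 //; lia.
  have kE : (t.-1 %/ j = k.+1)%N by rewrite prednK.
  have k4 : (t.-1 %/ j < 4)%N by rewrite ltn_divLR //; lia.
  have D1 := divn_eq t.-1 j; have D2 := ltn_pmod t.-1 j0.
  rewrite kE in D1 k4; rewrite /tau; move: (k.+1 * j)%N D1 => x D1.
  by split; [exact: k4|lia|lia].
have t'E : (t * j' %/ j = k.+1 * j' + tau * j' %/ j)%N.
  by rewrite {1}tE mulnDl mulnAC divnMDl.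
rewrite t'E; set tau' := (tau * j' %/ j)%N.
have tauj' : (tau' <= j')%N.
  by rewrite /tau' -[leqRHS](mulKn j' j0) leq_div2r // leq_mul2r tauj orbT.
have [u [nu ->]] : exists u, near_point seg n 3 j tau k v u /\ eval (take t W) = E u.
  by rewrite tE; exact: (td_near dW).
have nu5 : near_point seg n 5 j tau k v u.
  move=> i ni; have [a1 a2 a3] := nu i ni; split=> // /a3; lia.
rewrite inE; apply/orP; right.
have [j'0|j'0] := posnP j'.
  have v'0 i : (i < n)%N -> v' i = 0.
    by move=> ni; have := td_upper dW' ni; rewrite -/j' j'0 muln0; clear; lia.
  have -> : eval (take (k.+1 * j' + tau') W') = E (fun=> 0).
    by move: tauj'; rewrite j'0 muln0 leqn0 => /eqP->; rewrite take0 big_nil coord_prod_zero.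
  apply: (hB _ _ Ev j tau k) => // i ni; rewrite v'0 //.
  by split=> // _; rewrite !mulr0 subr0 normr0.
have [u' [nu' ->]] := td_near dW' k3 tauj'.
apply: (hB _ _ Ev j tau k) => //.
move=> i ni; have [a1 a2 a3] := nu' i ni; split=> // /a3; rewrite -/j' => near3.
have up := td_upper dW' ni; rewrite -/j' in up.
have D3 := divn_eq (tau * j') j; rewrite -/tau' in D3; have r3 := ltn_pmod (tau * j') j0.
have j'P : (0 < j'%:Z :> int) by rewrite ltz_nat.
rewrite -(ler_pM2l j'P) -[X in X * `|_|](gtr0_norm j'P) -normrM.
have -> : j'%:Z * (j%:Z * u' i - tau%:Z * v' i) =
    j%:Z * (j'%:Z * u' i - tau'%:Z * v' i) - (tau * j' %% j)%N%:Z * v' i.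
  have -> : (tau * j' %% j)%N%:Z = tau%:Z * j'%:Z - tau'%:Z * j%:Z.
    move: (congr1 Posz D3); rewrite PoszD !PoszM => ->.
    by rewrite addrC addKr.
  ring.
apply: (le_trans (ler_normB _ _)); rewrite !normrM.
have b1 : `|j%:Z| * `|j'%:Z * u' i - tau'%:Z * v' i| <= j%:Z * (3 * j'%:Z).
  by rewrite ger0_norm // ler_wpM2l.
have b2 : `|(tau * j' %% j)%N%:Z| * `|v' i| <= j%:Z * (2 * j')%N%:Z.
  by apply: ler_pM => //; rewrite ger0_norm // lez_nat ltnW.
apply: (le_trans (lerD b1 b2)); rewrite PoszM.
have -> : j%:Z * (3 * j'%:Z) + j%:Z * (2 * j'%:Z) = j'%:Z * (5 * j%:Z) by ring.
by [].
Qed.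

(* Length comparison of two traces whose targets differ by a fixed element. *)
Lemma trace_comparable h : exists C, forall (W W' : seq letter) J v f J' v' f',
  trace_data e seg (F := F) W J v f -> trace_data e seg (F := F) W' J' v' f' ->
  (E v * h)%g = E v' -> ((J' * J').+1 <= C * (J * J).+1)%N.
Proof.
have [C hC] := cs_step CS h.
(* Coordinates of [v] are at most [2 * j], hence those of [v'] at most
   [(2 + C * (1 + 2 * n)) * j + C]; [td_lower] turns this into a bound on [j']. *)
exists (2 * n * (2 + C * (1 + 2 * n)) + n * n + 1)%N => W W' J v f J' v' f' dW dW' Ev.
pose j := (J * J)%N; pose j' := (J' * J')%N; rewrite -/j -/j'.
have [J'0|[i ni]] := td_lower dW'.
  by rewrite /j' J'0 muln0 mulnS (leq_trans _ (leq_addr _ _)) // addn1.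
rewrite -/j' => lo.
have up i' : (i' < n)%N -> `|v i'| <= (2 * j)%N%:Z by exact: (td_upper dW).
have st : `|v' i - v i| <= C%:Z * (1 + (n * (2 * j))%N%:Z).
  apply: (le_trans (hC _ _ Ev i ni)); apply: ler_wpM2l => //; rewrite lerD2l.
  case: ifP => // _; apply: (@le_trans _ _ (\sum_(i' < n) (2 * j)%N%:Z)).
    by rewrite big_mkcond; apply: ler_sum => i' _; case: ifP => // _; exact: up.
  by rewrite sumr_const card_ord -mulr_natl natz PoszM.
have vi := up i ni.
have bnd : `|v' i| <= ((2 + C * (1 + 2 * n)) * j + C)%N%:Z.
  have EA : C%:Z * (1 + (n * (2 * j))%N%:Z) = (C * (1 + n * (2 * j)))%N%:Z.
    by rewrite PoszM PoszD.
  have : (C * (1 + n * (2 * j)) + 2 * j <= (2 + C * (1 + 2 * n)) * j + C)%N.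
    by clear; lia.
  rewrite EA in st; move: (C * (1 + n * (2 * j)))%N st => A st.
  by rewrite -lez_nat; apply: le_trans; clear -st vi; lia.
have n2 : (2 * n)%N%:Z * `|v' i| <= (2 * n)%N%:Z * ((2 + C * (1 + 2 * n)) * j + C)%N%:Z.
  exact: ler_wpM2l.
have : (j' <= 2 * n * ((2 + C * (1 + 2 * n)) * j + C) + n * n)%N.
  rewrite -lez_nat; apply: (le_trans lo).
  by rewrite [X in _ <= X]PoszD [X in _ <= X + _]PoszM lerD2r.
move=> H; have : (2 * n * ((2 + C * (1 + 2 * n)) * j + C) + n * n <
   (2 * n * (2 + C * (1 + 2 * n)) + n * n + 1) * j.+1)%N.
  by clear; nia.
exact: leq_ltn_trans.
Qed.

End TraceFellow.

Section Reach.
Variables (G : groupType) (X : {fset G}).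
Hypothesis X_inv : inverse_closed X.

Definition reach (K : nat) (g h : G) : Prop :=
  exists z : seq X, (size z <= K)%N /\ (g * word_eval z)%g = h.

Lemma reach_trans K L g h k : reach K g h -> reach L h k -> reach (K + L) g k.
Proof.
move=> [y [yK <-]] [z [zL <-]]; exists (y ++ z); rewrite size_cat leq_add //.
by rewrite word_eval_cat mulgA.
Qed.

Lemma reach_word (z : seq X) g : reach (size z) g (g * word_eval z)%g.
Proof. by exists z. Qed.

Lemma reach_weak K L g h : (K <= L)%N -> reach K g h -> reach L g h.
Proof. by move=> KL [z [zK E]]; exists z; split=> //; exact: leq_trans KL. Qed.

Lemma word_inverse (z : seq X) : exists2 y : seq X, size y = size z &
  word_eval y = (word_eval z)^-1%g.
Proof.
elim: z => [|x z [y sy yE]].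
  by exists [::] => //; rewrite /word_eval !big_nil invg1.
exists (rcons y (FSetSub (X_inv (fsvalP x)))); first by rewrite size_rcons sy.
by rewrite -cats1 word_eval_cat yE /word_eval big_seq1 big_cons invgM.
Qed.

Lemma reach_sym K g h : reach K g h -> reach K h g.
Proof.
move=> [z [zK <-]]; have [y sy yE] := word_inverse z; exists y.
by rewrite sy yE mulgK.
Qed.

Hypothesis X_all : forall g, exists z : seq X, word_eval z = g.

Lemma reach_finite (B : seq G) : exists K, forall g h, (g^-1 * h)%g \in B -> reach K g h.
Proof.
have /choice[w wE] := X_all; exists (\max_(g <- B) size (w g))%N => g h ghB.
exists (w (g^-1 * h)%g); rewrite wE mulVKg; split=> //.
exact: (bigmaxn_sup_seq (g^-1 * h)%g).
Qed.

End Reach.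

(** * Coordinates against word length *)

Section Growth.
Variables (G : groupType) (n : nat) (e : nat -> G) (seg : nat -> nat).
Variables (cen : pred nat) (F : seq G).
Hypothesis CS : coordinate_system n e seg cen F.
Local Notation E v := (coord_prod e seg n v).

Lemma uniform_step (H : seq G) : exists C : nat, forall h v v', h \in H ->
  (E v * h)%g = E v' -> forall i, (i < n)%N -> (`|v' i - v i| <= C%:Z *
    (1 + (if cen i then \sum_(j < n | ~~ cen j) `|v j| else 0)))%R.
Proof.
have /choice[C hC] := cs_step CS; exists (\max_(h <- H) C h)%N => h v v' hH Ev i ni.
apply: (le_trans (hC h v v' Ev i ni)); apply: ler_wpM2r.
  by apply: addr_ge0 => //; case: ifP => // _; apply: sumr_ge0.
by rewrite lez_nat; exact: (bigmaxn_sup_seq h).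
Qed.

(** Coordinates of successive prefixes are arbitrary choices; two of them differ by some
    [f * x * f'^-1], from a finite list. So coordinates outside [cen] grow by a bounded amount per
    letter, and those in [cen] by an amount linear in the length so far. *)
Lemma coordinate_growth (X : {fset G}) : exists C : nat, forall (z : seq X) v f,
  f \in F -> (E v * f)%g = word_eval z -> forall i, (i < n)%N ->
  `|v i| <= (C * ((size z).+1 * (size z).+1))%N%:Z.
Proof.
have [v0 [f0 f0F E0]] := cs_cover CS 1%g.
pose H := [seq (a * f^-1)%g | a <- [seq (f * x)%g | f <- F, x <- 1%g :: enum_fset X], f <- F].
have HP f x f' : f \in F -> x = 1%g \/ x \in X -> f' \in F -> (f * x * f'^-1)%g \in H.
  move=> fF xX f'F; apply: allpairs_f => //; apply: allpairs_f => //.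
  by rewrite inE; case: xX => [->|->]; rewrite ?eqxx ?orbT.
have [C hC] := uniform_step H.
pose B0 := (\max_(i < n) `|v0 i|)%N.
have hB0 i : (i < n)%N -> `|v0 i| <= B0%:Z.
  by move=> ni; rewrite -abszE lez_nat; exact: (leq_bigmax (F := fun i : 'I_n => absz (v0 i)) (Ordinal ni)).
(* [C1] is the slope of the linear bound, with [B0] for the start; [C2] makes a step of size
   [C * (1 + n * (C1 * s))] fit into [C2 * s]. *)
pose C1 := (B0 + C)%N; pose C2 := (C1 + C * (1 + n * C1))%N.
have sum_le (v : nat -> int) (b : nat) : (forall i, (i < n)%N -> ~~ cen i -> `|v i| <= b%:Z) ->
    \sum_(j < n | ~~ cen j) `|v j| <= (n * b)%N%:Z.
  move=> vb; apply: (@le_trans _ _ (\sum_(i' < n) b%:Z)).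
    by rewrite big_mkcond; apply: ler_sum => i' _; case: ifP => // c; exact: vb.
  by rewrite sumr_const card_ord -mulr_natl natz PoszM.
suff G0 : forall (z : seq X) v f, f \in F -> (E v * f)%g = word_eval z ->
    (forall i, (i < n)%N -> ~~ cen i -> `|v i| <= (C1 * (size z).+1)%N%:Z) /\
    (forall i, (i < n)%N -> `|v i| <= (C2 * ((size z).+1 * (size z).+1))%N%:Z).
  by exists C2 => z v f fF Ev; have [] := G0 z v f fF Ev.
elim/last_ind => [|z x IH] v f fF Ev.
  have Eh : (E v0 * (f0 * 1 * f^-1))%g = E v.
    rewrite mulg1 mulgA -E0; apply/esym/(canRL (mulgK _)); rewrite Ev.
    by rewrite /word_eval big_nil.
  have {}hC := hC _ _ _ (HP _ _ _ f0F (or_introl erefl) fF) Eh.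
  split=> [i ni ci|i ni]; have := hC i ni; have := hB0 i ni.
    by rewrite (negbTE ci) addr0 mulr1 /= muln1 /C1; clear; lia.
  have S0 : \sum_(j < n | ~~ cen j) `|v0 j| <= (n * C1)%N%:Z.
    by apply: sum_le => j nj _; have := hB0 j nj; rewrite /C1; clear; lia.
  have S1 : C%:Z * (1 + (if cen i then \sum_(j < n | ~~ cen j) `|v0 j| else 0)) <=
      (C * (1 + n * C1))%N%:Z.
    by rewrite PoszM PoszD ler_wpM2l // lerD2l; case: ifP.
  move: S1; rewrite /= !muln1 /C2 /C1; move: (C%:Z * _) (C * _)%N => A A'.
  by clear; lia.
have [v1 [f1 f1F E1]] := cs_cover CS (word_eval z).
have Eh : (E v1 * (f1 * val x * f^-1))%g = E v.
  rewrite !mulgA -E1; apply/esym/(canRL (mulgK _)); rewrite Ev -cats1 word_eval_cat.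
  by rewrite {2}/word_eval big_seq1.
have {}hC := hC _ _ _ (HP _ _ _ f1F (or_intror (fsvalP x)) fF) Eh.
have [IH1 IH2] := IH v1 f1 f1F (esym E1).
rewrite size_rcons; set s := (size z).+1 in IH1 IH2 *.
split=> [i ni ci|i ni]; have := hC i ni.
  have := IH1 i ni ci; rewrite (negbTE ci) addr0 mulr1 mulnS /C1.
  by move: (_ * s)%N => y; clear; lia.
have S0 := sum_le _ _ IH1.
have S1 : C%:Z * (1 + (if cen i then \sum_(j < n | ~~ cen j) `|v1 j| else 0)) <=
    (C * (1 + n * (C1 * s)))%N%:Z.
  by rewrite PoszM PoszD ler_wpM2l // lerD2l; case: ifP.
have S2 : (C2 * (s * s) + C * (1 + n * (C1 * s)) <= C2 * (s.+1 * s.+1))%N.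
  have s1 : (C * 1 <= C * s)%N by rewrite leq_mul2l orbT.
  have -> : (C2 * (s.+1 * s.+1) = C2 * (s * s) + (C2 * s + C2 * s + C2))%N by clear; lia.
  rewrite leq_add2l {2}/C2.
  have -> : ((C1 + C * (1 + n * C1)) * s = C1 * s + C * s + C * (n * (C1 * s)))%N by clear; lia.
  by move: s1; clear; lia.
have := IH2 i ni; move: S1 S2; move: (C%:Z * _) (C * (1 + _))%N (C2 * (s * s))%N (C2 * _)%N.
by clear; lia.
Qed.

End Growth.

(** * The combing *)

Section Combing.
Variables (R : realType) (G : groupType).
Variables (n : nat) (e : nat -> G) (seg : nat -> nat) (cen : pred nat) (F : seq G).
Hypothesis CS : coordinate_system n e seg cen F.
Variables (gens : seq G) (g0 : G).
Hypothesis gens_all : generates [set x | x \in gens].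
Hypothesis g0_nontrivial : g0 != 1%g.
Local Notation P := ('I_n * bool)%type.
Local Notation D := {ffun P -> bool}.
Local Notation letter := (letter P D 'I_(size F)).
Local Notation ev := (@letter_eval G n e seg F).
Local Notation machine := (@trace_machine P D 'I_(size F) (@useful n)).
Local Notation E v := (coord_prod e seg n v).

Definition base_seq : seq G := gens ++ [:: 1%g; g0] ++ [seq ev a | a : letter].
Definition base : {fset G} := [fset x in base_seq ++ [seq x^-1%g | x <- base_seq]]%fset.

Lemma in_base x : (x \in base) = (x \in base_seq) || (x \in [seq x^-1%g | x <- base_seq]).
Proof. by rewrite in_fset mem_cat. Qed.

Lemma base_inv : inverse_closed base.
Proof.
move=> x; rewrite !in_base => /orP[xb|/mapP[y yb ->]].
  by rewrite map_f ?orbT.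
by rewrite invgK yb.
Qed.

Lemma one_base : 1%g \in base.
Proof. by rewrite in_base mem_cat mem_cat !inE eqxx !orbT. Qed.

Lemma g0_base : g0 \in base.
Proof. by rewrite in_base mem_cat mem_cat !inE eqxx !orbT. Qed.

Lemma ev_base (a : letter) : ev a \in base.
Proof. by rewrite in_base !mem_cat (fintype.image_f ev) ?orbT. Qed.

Definition to_base (x : G) : base := insubd [` one_base]%fset x.

Lemma val_to_base x : x \in base -> val (to_base x) = x.
Proof. by move=> xb; rewrite insubdK. Qed.

(* The letters of the machine may have equal values in [G], so a letter is
   encoded by its value followed by a block of trivial value, in which the
   position of the nontrivial element [g0] is the index of the letter. *)
Definition block (a : letter) : seq base :=
  to_base (ev a) :: nseq (enum_rank a) (to_base 1%g) ++
    to_base g0 :: to_base g0^-1%g :: nseq (#|{: letter}| - enum_rank a) (to_base 1%g).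

Definition block_len := #|{: letter}|.+2.

Lemma size_block a : size (block a) = block_len.+1.
Proof.
rewrite /block /= size_cat /= !size_nseq /block_len.
by rewrite !addnS subnKC // ltnW.
Qed.

Lemma block_inj : injective block.
Proof.
move=> a b [_ ab]; apply: enum_rank_inj; apply: val_inj => /=.
have idx (c : letter) s : index (to_base g0) (nseq (enum_rank c) (to_base 1%g) ++ to_base g0 :: s) = enum_rank c.
  rewrite index_cat mem_nseq; have /negPf -> : to_base g0 != to_base 1%g.
    apply: contra g0_nontrivial => /eqP/(congr1 val).
    by rewrite !val_to_base ?g0_base ?one_base // => ->.
  by rewrite andbF /= eqxx addn0 size_nseq.
by have := congr1 (index (to_base g0)) ab; rewrite !idx.
Qed.

Lemma block_eval a : word_eval (block a) = ev a.
Proof.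
have triv k : word_eval (nseq k (to_base 1%g)) = 1%g.
  rewrite /word_eval big1_seq // => x /andP[_]; rewrite mem_nseq => /andP[_ /eqP->].
  by rewrite val_to_base // one_base.
rewrite /word_eval /block big_cons big_cat !big_cons -!/(word_eval _) !triv.
rewrite !val_to_base ?ev_base ?g0_base ?base_inv ?g0_base //.
by rewrite /= !(mul1g, mulg1) mulgV mulg1.
Qed.

Lemma blocks_cons a W :
  flatten (map block (a :: W)) = block a ++ flatten (map block W).
Proof. by []. Qed.

Lemma blocks_eval W : word_eval (flatten (map block W)) = (\prod_(a <- W) ev a)%g.
Proof.
elim: W => [|a W IH]; first by rewrite /word_eval !big_nil.
by rewrite blocks_cons word_eval_cat IH block_eval big_cons.
Qed.

Lemma size_blocks W : size (flatten (map block W)) = (block_len.+1 * size W)%N.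
Proof.
elim: W => [|a W IH]; first by rewrite muln0.
by rewrite blocks_cons size_cat IH size_block mulnS.
Qed.

Lemma take_blocks W t :
  take (t * block_len.+1) (flatten (map block W)) = flatten (map block (take t W)).
Proof.
elim: W t => [|a W IH] [|t]; rewrite ?mul0n ?take0 //.
rewrite blocks_cons [take t.+1 _]/= blocks_cons.
by rewrite mulSn take_cat size_block ltnNge leq_addr addKn IH.
Qed.

Lemma blocks_prefix W m : reach base block_len.+1 (\prod_(a <- take (m %/ block_len.+1) W) ev a)%g
  (word_eval (take m (flatten (map block W)))).
Proof.
set b := block_len.+1; set w := flatten _.
have -> : take m w = take (m %/ b * b) w ++ take (m %% b) (drop (m %/ b * b) w).
  by rewrite -takeD -divn_eq.
rewrite word_eval_cat take_blocks blocks_eval; apply: reach_weak (reach_word _ _).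
by rewrite size_take_min (leq_trans (geq_minl _ _)) // ltnW // ltn_pmod.
Qed.

Lemma blocks_between W t t' : (t <= t')%N ->
  reach base ((t' - t) * block_len.+1) (\prod_(a <- take t W) ev a)%g (\prod_(a <- take t' W) ev a)%g.
Proof.
move=> tt'; have -> : take t' W = take t W ++ take (t' - t) (drop t W).
  by rewrite -takeD subnKC.
rewrite big_cat -(blocks_eval (take (t' - t) _)).
apply: reach_weak (reach_word _ _); rewrite size_blocks mulnC leq_mul2r orbC.
by rewrite size_take_min geq_minl.
Qed.

Definition combing_language : set (seq base) :=
  [set w | rt_accepts (block_machine machine block_len block) w].

Lemma combing_word w : combing_language w <->
  exists2 W, rt_accepts machine W & w = flatten (map block W).
Proof. by rewrite /combing_language /=; apply: block_accepts; [exact: size_block|exact: block_inj]. Qed.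

Lemma combing_all : represents_all combing_language.
Proof.
move=> g; have [v [f fF ->]] := cs_cover CS g.
have [W WA WE] := trace_word_exists CS v fF.
by exists (flatten (map block W)); [apply/combing_word; exists W|rewrite blocks_eval].
Qed.

Lemma base_all g : exists z : seq base, word_eval z = g.
Proof. by have [w _ E] := combing_all g; exists w. Qed.

Lemma combing_fellow : exists (K : nat) (M : R), 0 < M /\
  forall v w, combing_language v -> combing_language w -> neighbours v w ->
    bounded_async_fellow_travel (2 + K%:R) M v w.
Proof.
pose H := [seq (a * f^-1)%g | a <- [seq (f * x)%g | f <- F, x <- 1%g :: enum_fset base], f <- F].
have HP f x f' : f \in F -> x \in base \/ x = 1%g -> f' \in F -> (f * x * f'^-1)%g \in H.
  move=> fF xX f'F; apply: allpairs_f => //; apply: allpairs_f => //.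
  by rewrite inE; case: xX => [->|->]; rewrite ?eqxx ?orbT.
have /choice[B hB] := trace_close CS.
have /choice[C1 hC1] := trace_comparable CS.
(* Both [h] and its inverse enter because the relative speed must be bounded from below as well. *)
pose C := (\max_(h <- H) (C1 h + C1 h^-1%g))%N.
have [K1 hK1] := reach_finite base_all (flatten [seq B h | h <- H]).
pose b := block_len.+1.
(* In order: back to the block boundary before [m], the final letter cut off in [t], the closeness
   of traces, the mismatch of [index_match] counted in blocks, and forward to [m']. *)
exists (b + (b + (K1 + ((4 * C + 4) * b + b))))%N, (8 * C.+1)%:R; split.
  by rewrite ltr0n.
move=> v w /combing_word[W WA ->] /combing_word[W' WA' ->] [x [xX]].
rewrite !blocks_eval => xE.
have [J [p [f dW]]] := trace_word_data CS WA.
have [J' [p' [f' dW']]] := trace_word_data CS WA'.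
move: xE; rewrite (td_eval dW) (td_eval dW') => xE.
set h := (f * x * f'^-1)%g.
have hH : h \in H by apply: HP; rewrite ?(td_fin dW) ?(td_fin dW').
have Eh : (E p * h)%g = E p'.
  by rewrite /h !mulgA -xE mulgK.
have Eh' : (E p' * h^-1)%g = E p by rewrite -Eh mulgK.
pose j := (J * J)%N; pose j' := (J' * J')%N.
have le_C k : (C1 k + C1 k^-1%g <= C)%N -> (C1 k <= C)%N by move=> kC; rewrite (leq_trans (leq_addr _ _) kC).
have hCC : (C1 h + C1 h^-1%g <= C)%N by exact: (bigmaxn_sup_seq h).
have cmp : (j'.+1 <= C * j.+1)%N.
  apply: (leq_trans (hC1 h _ _ _ _ _ _ _ _ dW dW' Eh)).
  by rewrite leq_mul2r (leq_trans (leq_addr _ _) hCC) orbT.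
have cmp' : (j.+1 <= C * j'.+1)%N.
  apply: (leq_trans (hC1 h^-1%g _ _ _ _ _ _ _ _ dW' dW Eh')).
  by rewrite leq_mul2r (leq_trans (leq_addl _ _) hCC) orbT.
have sz : size (flatten (map block W)) = (b * (4 * j).+1)%N.
  by rewrite size_blocks (td_size dW).
have sz' : size (flatten (map block W')) = (b * (4 * j').+1)%N.
  by rewrite size_blocks (td_size dW').
apply: linear_fellow_travel.
  rewrite sz sz'.
  have ratio (a c : nat) : (a.+1 <= C * c.+1)%N ->
      (((b * (4 * a).+1).+1)%:R / ((b * (4 * c).+1).+1)%:R <= (8 * C.+1)%:R :> R).
    move=> ac; rewrite ler_pdivrMr ?ltr0n // -natrM ler_nat.
    have : (b * a.+1 <= b * (C * c.+1))%N by rewrite leq_mul2l ac orbT.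
    rewrite mulnCA => Xa; apply: (@leq_trans (8 * C.+1 * (b * c.+1))%N).
      have : (1 <= b * c.+1)%N by rewrite muln_gt0.
      have E1 : (b * (4 * a).+1 <= 4 * (b * a.+1))%N by clear; lia.
      move: (b * c.+1)%N Xa => X Xa.
      have -> : (8 * C.+1 * X = 8 * (C * X) + 8 * X)%N by clear; lia.
      move: (C * X)%N (b * a.+1)%N Xa (b * _)%N E1 => y z; clear; lia.
    apply: leq_mul => //; apply: leqW; apply: leq_mul => //.
    by clear; lia.
  rewrite ratio // andbT div1r -[leRHS]invf_div.
  by rewrite lef_pV2 ?posrE ?divr_gt0 ?ltr0n //; exact: ratio.
rewrite !sz !sz' => m m' mv mw H1 H2.
have b0 : (0 < b)%N by [].
have [U L] := index_match b0 cmp mv mw H1 H2.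
set t := minn (m %/ b) (4 * j) in U L; set t' := (t * j' %/ j)%N in U L.
have t4 : (t <= 4 * j)%N by exact: geq_minr.
apply: (@reach_trans _ _ b); first exact/(reach_sym base_inv)/blocks_prefix.
apply: (@reach_trans _ _ b _ _ (\prod_(a <- take t W) ev a)%g).
  apply: (reach_sym base_inv); apply: reach_weak (blocks_between _ _); last exact: geq_minl.
  rewrite -[leqRHS]mul1n leq_mul2r; apply/orP; right.
  have : (m %/ b <= 4 * j + 1)%N.
    by rewrite addn1 -[leqRHS](mulKn _ b0) leq_div2r.
  by rewrite /t; move: (m %/ b)%N (4 * j)%N => q q4; clear; lia.
apply: (@reach_trans _ _ K1 _ _ (\prod_(a <- take t' W') ev a)%g).
  apply: hK1; apply/flattenP; exists (B h); first exact: map_f.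
  exact: (hB h _ _ _ _ _ _ _ _ _ dW dW' Eh t4).
apply: reach_trans (blocks_prefix _ _).
have [tt|tt] := leqP t' (m' %/ b).
  apply: reach_weak (blocks_between _ tt); rewrite leq_mul2r leq_subLR U orbT //.
apply: (reach_sym base_inv); apply: reach_weak (blocks_between _ (ltnW tt)).
by rewrite leq_mul2r leq_subLR L orbT.
Qed.

Lemma combing_length : exists A : nat, forall w, combing_language w ->
  (size w <= A * ((geodesic_length w).+1 * (geodesic_length w).+1))%N.
Proof.
have [C hC] := coordinate_growth CS base.
exists (block_len.+1 * (4 * (2 * n * C + n * n)).+1)%N => w /combing_word[W WA wE].
have [J [v [f dW]]] := trace_word_data CS WA.
rewrite wE size_blocks (td_size dW) -wE -mulnA leq_mul2l /=.
set l := (_.+1 * _.+1)%N.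
have l1 : (0 < l)%N by [].
have J_le : (J * J <= (2 * n * C + n * n) * l)%N.
  have [->|[i ni lo]] := td_lower dW; first by [].
  have [z [sz zE]] : exists z : seq base, size z = geodesic_length w /\ word_eval z = word_eval w.
    rewrite /geodesic_length; case: ex_minnP => k /asboolP[z [zk zw]] _.
    by exists z.
  have vi : `|v i| <= (C * l)%N%:Z.
    rewrite /l -sz; apply: (hC z v f (td_fin dW)) => //.
    by rewrite zE wE blocks_eval (td_eval dW).
  rewrite -lez_nat; apply: (le_trans lo).
  have -> : ((2 * n * C + n * n) * l)%N%:Z = (2 * n)%N%:Z * (C * l)%N%:Z + (n * n * l)%N%:Z.
    by rewrite -PoszM -PoszD; congr Posz; clear; lia.
  by apply: lerD; [apply: ler_wpM2l|rewrite lez_nat leq_pmulr].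
have E0 (q x : nat) : ((4 * q).+1 * x = 4 * (q * x) + x)%N by lia.
rewrite E0; move: J_le l1; move: (_ * l)%N (J * J)%N => x y; clear; lia.
Qed.

Lemma combing_theorem : exists (X : {fset G}) (L : set (seq X)),
    [/\ inverse_closed X, generates [set x | x \in X],
        real_time_combing R L, bounded_async_combing R L
      & exists f : nat -> nat, is_length_function L f /\
          exists p : {poly R}, size p = 3%N /\
            forall n : nat, (f n)%:R <= p.[n%:R]].
Proof.
exists base, combing_language.
have bounded : bounded_async_combing R combing_language.
  split; first exact: combing_all.
  by have [K [M [M0 H]]] := combing_fellow; exists (2 + K%:R), M.
split=> //.
- exact: base_inv.
- apply/seteqP; split=> // g _.
  move: gens_all => /seteqP[_ /(_ g I)] gg A [sA bA]; apply: gg; split=> //.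
  by move=> x xg; apply: bA; rewrite /= in_base mem_cat xg.
- split; last by exists (block_machine machine block_len block).
  split; first exact: combing_all.
  have [_ [K [M [_ H]]]] := bounded; exists K => v w Lv Lw vw.
  by have [h hh _] := H v w Lv Lw vw; exists h.
have [A hA] := combing_length.
pose good k l := `[< exists w, [/\ combing_language w, (geodesic_length w <= k)%N & size w = l] >].
have ex k : exists l, good k l.
  (* A word for the identity has geodesic length 0, so the maximum is over a nonempty set for every
     [k]. *)
  have [w Lw w1] := combing_all 1%g; exists (size w); apply/asboolP; exists w; split=> //.
  rewrite /geodesic_length; case: ex_minnP => m _ /(_ 0%N) m0.
  apply: leq_trans (m0 _) _ => //; apply/asboolP; exists [::]; split=> //.
  by rewrite /same_element w1 /word_eval big_nil.
have ub k l : good k l -> (l <= A * (k.+1 * k.+1))%N.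
  move=> /asboolP[w [Lw wk <-]]; apply: (leq_trans (hA w Lw)).
  by rewrite leq_mul2l leq_mul ?orbT // ltnS.
pose f k := ex_maxn (ex k) (ub k).
exists f; split.
  move=> k; rewrite /f; case: ex_maxnP => l /asboolP[w wP] lmax; split; first by exists w.
  by move=> w' Lw' w'k; apply: lmax; apply/asboolP; exists w'.
have c0 : (2 * A.+1)%:R != 0 :> R by rewrite pnatr_eq0.
(* The bound is [(k + 1) ^ 2 <= 2 * (k ^ 2 + 1)]; [A.+1] in place of [A] keeps the leading
   coefficient nonzero. *)
exists ((2 * A.+1)%:R *: ('X^2 + 1)); split.
  by rewrite size_scale // size_polyDl ?size_polyXn // size_poly1.
move=> k; rewrite hornerZ hornerD hornerXn hornerC.
have := ub k (f k); rewrite /f; case: ex_maxnP => l lP _ /(_ lP) lA.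
rewrite -natrX natr1 -natrM ler_nat.
apply: (leq_trans lA); rewrite [(2 * _)%N]mulnC -mulnA leq_mul ?leqnSn //.
have [k2 _] := nat_Cauchy k 1; rewrite -!mulnn in k2.
have -> : (k.+1 * k.+1 = k * k + 2 * k + 1)%N by clear; lia.
by rewrite -mulnn; move: (k * k)%N k2; clear; lia.
Qed.

End Combing.

Theorem theorem6p3 (R : realType) (G : groupType)
    (hclass : nilpotent_of_class G 2)
    (hgen : exists s : seq G,
      (size s = 2%N \/ size s = 3%N) /\ generates [set x | x \in s]) :
  exists (X : {fset G}) (L : set (seq X)),
    [/\ inverse_closed X, generates [set x | x \in X],
        real_time_combing R L, bounded_async_combing R L
      & exists f : nat -> nat, is_length_function L f /\
          exists p : {poly R}, size p = 3%N /\
            forall n : nat, (f n)%:R <= p.[n%:R]].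
Proof.
have [n [e [seg [cen [F CS]]]]] := coordinates_exist hclass hgen.
have [s [_ gens_all]] := hgen.
have [g0 g0_nontrivial] := class2_nontrivial hclass.
exact: (combing_theorem R CS gens_all g0_nontrivial).
Qed.
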